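(* Suppose that each $f_i,g_i:\mathbb{R}^n\to\mathbb{R}$ ($i\in\mathcal{N}=\{1,\dots,N\}$) is convex and twice differentiable, each $h_i:\mathbb{R}^n\to\mathbb{R}$ is affine, Slater's condition holds and there exists a finite optimal solution for the problem $$\min_{z\in\mathbb{R}^n}\ \sum_{i\in\mathcal{N}} f_i(z)\quad\text{s.t.}\quad g_i(z)\le 0,\ h_i(z)=0,\ i\in\mathcal{N},$$ and that the communication graph $\mathcal{G}=(\mathcal{N},\mathcal{E})$ is undirected and connected. Let $m\ge 2$, $b^i_m>\dots>b^i_2>b^i_1=0$, $c^i_k>0$ for all $i,k$, let $\eta>0$, and let $T_{ij}\ge 0$, $(i,j)\in\mathcal{E}$, be arbitrary (possibly different) constant delays from agent $i$ to agent $j$. Consider the closed-loop system consisting of, for $i\in\mathcal{N}$, $$\dot\rho^i_k=-b^i_k\rho^i_k+c^i_k\nu_i,\quad k=1,\dots,m,\qquad x_i=\sum_{k=1}^m\rho^i_k,$$ $$\nu_i=-\nabla f_i(x_i)-\lambda_i^2\nabla g_i(x_i)-\mu_i\nabla h_i(x_i)+\sum_{j\in\mathcal{N}_i}a_{ij}(r^x_{ij}-x_i)-\sum_{j\in\mathcal{N}_i}a_{ij}(r^\xi_{ij}-\xi_i),$$ $$\dot\xi_i=\sum_{j\in\mathcal{N}_i}a_{ij}(r^x_{ij}-x_i),\qquad \dot\lambda_i=2\lambda_i g_i(x_i),\qquad \dot\mu_i=h_i(x_i),$$ where the signals $r_{ij}=\mathrm{col}(r^x_{ij},r^\xi_{ij})$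 are determined by the scattering transformation with delays described in the context. Then every trajectory of this closed-loop system with initial condition $\lambda_i(0)>0$ for all $i\in\mathcal{N}$ asymptotically converges, as $t\to\infty$, to a fixed equilibrium that solves the problem $$\min_{x\in\mathbb{R}^{nN}}\ \sum_{i\in\mathcal{N}} f_i(x_i)+x^T\mathbf{L}x\quad\text{s.t.}\quad g_i(x_i)\le 0,\ h_i(x_i)=0,\ i\in\mathcal{N},\ \ \mathbf{L}x=\mathbf{0},$$ i.e. the $x$-component of the equilibrium is an optimal solution of this last problem.
   Context: $\mathcal{N}=\{1,\dots,N\}$ is a set of agents. The graph $\mathcal{G}=(\mathcal{N},\mathcal{E})$ has adjacency matrix $\mathcal{A}=[a_{ij}]$ with $a_{ii}=0$, $a_{ij}=a_{ji}>0$ if $(i,j)\in\mathcal{E}$ and $a_{ij}=0$ otherwise; $\mathcal{N}_i=\{j:(i,j)\in\mathcal{E}\}$ is the neighbor set of $i$. $L=\mathrm{diag}\{\mathcal{A}\mathbf{1}_N\}-\mathcal{A}$ is the graph Laplacian and $\mathbf{L}=L\otimes I_n$. State variables: $\rho^i_k\in\mathbb{R}^n$, $\xi_i\in\mathbb{R}^n$, $\lambda_i\in\mathbb{R}$, $\mu_i\in\mathbb{R}$; $x_i\in\mathbb{R}^n$ is the output defined by $x_i=\sum_k\rho^i_k$, and $x=\mathrm{col}(x_1,\dots,x_N)$ is the stacked column vector. Slater's condition: there is $z\in\mathbb{R}^n$ with $g_i(z)<0$ and $h_i(z)=0$ for all $i\in\mathcal{N}$. Scattering transformation. For $i\in\mathcal{N}$,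 $j\in\mathcal{N}_i$, let $$p_{ij}=E_{ij}\begin{bmatrix} r^x_{ij}-x_i\\ r^\xi_{ij}-\xi_i\end{bmatrix}\in\mathbb{R}^{2n},\qquad E_{ij}=\begin{bmatrix} a_{ij}&-a_{ij}\\ a_{ij}&0\end{bmatrix}\otimes I_n .$$ For each $(i,j)\in\mathcal{E}$ the agents exchange, instead of $x$ and $\xi$, the scattering variables $$s_{\overrightarrow{ij}}=\tfrac{1}{\sqrt{2\eta}}(-p_{ij}+\eta r_{ij}),\quad s_{\overleftarrow{ij}}=\tfrac{1}{\sqrt{2\eta}}(p_{ij}+\eta r_{ij}),\quad s_{\overleftarrow{ji}}=\tfrac{1}{\sqrt{2\eta}}(p_{ji}+\eta r_{ji}),\quad s_{\overrightarrow{ji}}=\tfrac{1}{\sqrt{2\eta}}(-p_{ji}+\eta r_{ji}),$$ where $s_{\overrightarrow{ij}}$ is the signal agent $i$ sends to agent $j$ and $s_{\overleftarrow{ji}}$ is the signal agent $j$ receives from agent $i$ (and similarly with $i,j$ exchanged). They are related through the delays by $$s_{\overleftarrow{ji}}(t)=s_{\overrightarrow{ij}}(t-T_{ij}),\qquad s_{\overleftarrow{ij}}(t)=s_{\overrightarrow{ji}}(t-T_{ji}),$$ with the convention that all scattering variables vanish for $t<0$. Each agent $i$ computes $r_{ij}(t)$ from the received signal $s_{\overleftarrow{ij}}(t)$ and its own $x_i(t),\xi_i(t)$ through the relation $s_{\overleftarrow{ij}}=\frac{1}{\sqrt{2\eta}}(p_{ij}+\eta r_{ij})$. *)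

(* Defs.v *)
From HB Require Import structures.
From mathcomp Require Import all_boot all_order all_algebra.
From mathcomp Require Import mxtens.
From mathcomp Require Import all_classical all_reals all_analysis.

Set Implicit Arguments.
Unset Strict Implicit.
Unset Printing Implicit Defensive.

Import Order.TTheory GRing.Theory Num.Theory.
Import numFieldNormedType.Exports.
Local Open Scope classical_set_scope.
Local Open Scope ring_scope.

(* MathComp / MathComp-Analysis.  R^n is 'cV[R]_n; agents are indexed by 'I_N
   and the internal states of an agent by 'I_m, both starting at 0. *)

Definition grad (R : realType) (n : nat) (f : 'cV[R]_n -> R) (z : 'cV[R]_n) :
  'cV[R]_n := \col_j 'D_(delta_mx j 0) f z.

Definition twice_differentiable (R : realType) (n : nat)
    (f : 'cV[R]_n -> R) : Prop :=
  (forall z, differentiable f z) /\ (forall z, differentiable (grad f) z).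

Definition affine (R : realType) (n : nat) (f : 'cV[R]_n -> R) : Prop :=
  exists (a : 'cV[R]_n) (d : R), forall z, f z = (a^T *m z) 0 0 + d.

Definition optimal (R : realType) (T : Type) (cost : T -> R)
    (feasible : set T) (x : T) : Prop :=
  feasible x /\ forall y, feasible y -> cost x <= cost y.

(* [delay i j] is the delay T_ij from i to j; [decay i k] and [gain i k] are
   the coefficients b^i_{k+1} and c^i_{k+1}. *)
Record system (R : realType) (N n m : nat) := System {
  obj : 'I_N -> 'cV[R]_n -> R;
  ineq : 'I_N -> 'cV[R]_n -> R;
  equa : 'I_N -> 'cV[R]_n -> R;
  edge : rel 'I_N;
  adj : 'M[R]_N;
  delay : 'I_N -> 'I_N -> R;
  decay : 'I_N -> 'I_m -> R;
  gain : 'I_N -> 'I_m -> R;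
  eta : R
}.

(* The values of all signals at one instant.  [rsig i j] is
   r_ij = col(r^x_ij, r^xi_ij); it is only meaningful when (i, j) is an edge. *)
Record state (R : realType) (N n m : nat) := State {
  rho : 'I_N -> 'I_m -> 'cV[R]_n;
  xi : 'I_N -> 'cV[R]_n;
  lam : 'I_N -> R;
  mu : 'I_N -> R;
  rsig : 'I_N -> 'I_N -> 'cV[R]_(n + n)
}.

Definition undirected_connected_graph (R : realType) (N n m : nat)
    (P : system R N n m) : Prop :=
  [/\ symmetric (edge P),
      (forall i j, connect (edge P) i j),
      (forall i, adj P i i = 0),
      (forall i j, edge P i j -> adj P i j = adj P j i /\ 0 < adj P i j) &
      (forall i j, ~~ edge P i j -> adj P i j = 0)].

Definition slater (R : realType) (N n m : nat) (P : system R N n m) : Prop :=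
  exists z, forall i, ineq P i z < 0 /\ equa P i z = 0.

Definition central_cost (R : realType) (N n m : nat) (P : system R N n m)
    (z : 'cV[R]_n) : R := \sum_i obj P i z.

Definition central_feasible (R : realType) (N n m : nat) (P : system R N n m) :
    set 'cV[R]_n :=
  [set z | forall i, ineq P i z <= 0 /\ equa P i z = 0].

Definition laplacian (R : realType) (N : nat) (A : 'M[R]_N) : 'M[R]_N :=
  diag_mx (A *m const_mx 1 : 'cV[R]_N)^T - A.

Definition big_laplacian (R : realType) (N n m : nat) (P : system R N n m) :
  'M[R]_(N * n) := laplacian (adj P) *t (1%:M : 'M[R]_n).

Definition stack (R : realType) (N n : nat) (x : 'I_N -> 'cV[R]_n) :
    'cV[R]_(N * n) :=
  \col_k x (mxtens_unindex k).1 (mxtens_unindex k).2 0.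

Definition block (R : realType) (N n : nat) (x : 'cV[R]_(N * n)) (i : 'I_N) :
    'cV[R]_n :=
  \col_j x (mxtens_index (i, j)) 0.

Definition consensus_cost (R : realType) (N n m : nat) (P : system R N n m)
    (x : 'cV[R]_(N * n)) : R :=
  \sum_i obj P i (block x i) + (x^T *m big_laplacian P *m x) 0 0.

Definition consensus_feasible (R : realType) (N n m : nat)
    (P : system R N n m) : set 'cV[R]_(N * n) :=
  [set x | (forall i, ineq P i (block x i) <= 0 /\ equa P i (block x i) = 0)
           /\ big_laplacian P *m x = 0].

Definition output (R : realType) (N n m : nat) (s : state R N n m) (i : 'I_N) :
  'cV[R]_n := \sum_k rho s i k.

Definition rx_gap (R : realType) (N n m : nat) (P : system R N n m)
    (s : state R N n m) (i : 'I_N) : 'cV[R]_n :=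
  \sum_(j | edge P i j) adj P i j *: (usubmx (rsig s i j) - output s i).

Definition rxi_gap (R : realType) (N n m : nat) (P : system R N n m)
    (s : state R N n m) (i : 'I_N) : 'cV[R]_n :=
  \sum_(j | edge P i j) adj P i j *: (dsubmx (rsig s i j) - xi s i).

Definition nu (R : realType) (N n m : nat) (P : system R N n m)
    (s : state R N n m) (i : 'I_N) : 'cV[R]_n :=
  - grad (obj P i) (output s i)
  - (lam s i) ^+ 2 *: grad (ineq P i) (output s i)
  - mu s i *: grad (equa P i) (output s i)
  + rx_gap P s i - rxi_gap P s i.

Definition rho_field (R : realType) (N n m : nat) (P : system R N n m)
    (s : state R N n m) (i : 'I_N) (k : 'I_m) : 'cV[R]_n :=
  - (decay P i k *: rho s i k) + gain P i k *: nu P s i.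

Definition xi_field (R : realType) (N n m : nat) (P : system R N n m)
    (s : state R N n m) (i : 'I_N) : 'cV[R]_n := rx_gap P s i.

Definition lam_field (R : realType) (N n m : nat) (P : system R N n m)
    (s : state R N n m) (i : 'I_N) : R :=
  2 * lam s i * ineq P i (output s i).

Definition mu_field (R : realType) (N n m : nat) (P : system R N n m)
    (s : state R N n m) (i : 'I_N) : R := equa P i (output s i).

(* [[a, -a], [a, 0]] (x) I_n *)
Definition coupling (R : realType) (n : nat) (a : R) : 'M[R]_(n + n) :=
  block_mx a%:M (- a)%:M a%:M 0.

Definition scat_p (R : realType) (N n m : nat) (P : system R N n m)
    (s : state R N n m) (i j : 'I_N) : 'cV[R]_(n + n) :=
  coupling n (adj P i j) *m (rsig s i j - col_mx (output s i) (xi s i)).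

(* s_{->ij}, sent by i to j *)
Definition scat_out (R : realType) (N n m : nat) (P : system R N n m)
    (s : state R N n m) (i j : 'I_N) : 'cV[R]_(n + n) :=
  (Num.sqrt (2 * eta P))^-1 *: (- scat_p P s i j + eta P *: rsig s i j).

(* s_{<-ij}, received by i from j *)
Definition scat_in (R : realType) (N n m : nat) (P : system R N n m)
    (s : state R N n m) (i j : 'I_N) : 'cV[R]_(n + n) :=
  (Num.sqrt (2 * eta P))^-1 *: (scat_p P s i j + eta P *: rsig s i j).

(* Scattering variables vanish at negative times. *)
Definition causal (R : realType) (V : zmodType) (u : R -> V) (t : R) : V :=
  if t < 0 then 0 else u t.

(* Because of the zero prehistory, the delayed signals in general jump when the
   first transmissions arrive and each time their reflections do.  The states
   are therefore continuous on [0, +oo[, and the differential equations are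
   required at all positive times outside a locally finite set D of switching
   times.  The algebraic channel relations hold at all times. *)
Definition trajectory (R : realType) (N n m : nat) (P : system R N n m)
    (S : R -> state R N n m) : Prop :=
  [/\ (forall i,
        [/\ forall k, {within `[0, +oo[, continuous (fun t => rho (S t) i k)},
            {within `[0, +oo[, continuous (fun t => xi (S t) i)},
            {within `[0, +oo[, continuous (fun t => lam (S t) i)} &
            {within `[0, +oo[, continuous (fun t => mu (S t) i)}]),
      (exists2 D : set R,
         (forall t, finite_set (D `&` `[0, t])) &
         forall t, 0 < t -> ~ D t -> forall i,
           [/\ forall k, is_derive t 1 (fun u => rho (S u) i k)
                                       (rho_field P (S t) i k),
               is_derive t 1 (fun u => xi (S u) i) (xi_field P (S t) i),
               is_derive t 1 (fun u => lam (S u) i) (lam_field P (S t) i) &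
               is_derive t 1 (fun u => mu (S u) i) (mu_field P (S t) i)]) &
      (forall i j, edge P i j -> forall t,
         causal (fun u => scat_in P (S u) j i) t =
         causal (fun u => scat_out P (S u) i j) (t - delay P i j))].

(* A steady state: the fields vanish and the channels carry constant signals,
   for which the delay is immaterial. *)
Definition equilibrium (R : realType) (N n m : nat) (P : system R N n m)
    (e : state R N n m) : Prop :=
  (forall i, [/\ forall k, rho_field P e i k = 0,
                 xi_field P e i = 0,
                 lam_field P e i = 0 &
                 mu_field P e i = 0])
  /\ (forall i j, edge P i j -> scat_in P e j i = scat_out P e i j).

Definition converges_to (R : realType) (N n m : nat) (P : system R N n m)
    (S : R -> state R N n m) (e : state R N n m) : Prop :=
  (forall i, [/\ forall k, rho (S t) i k @[t --> +oo] --> rho e i k,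
                 xi (S t) i @[t --> +oo] --> xi e i,
                 lam (S t) i @[t --> +oo] --> lam e i &
                 mu (S t) i @[t --> +oo] --> mu e i])
  /\ (forall i j, edge P i j -> rsig (S t) i j @[t --> +oo] --> rsig e i j).

(* Main.v *)
Require Import Defs.
From mathcomp Require Import all_boot all_order all_algebra.
From mathcomp Require Import all_classical all_reals all_analysis.
From mathcomp Require Import measurable_realfun mxtens ring lra.

(** A Slater point turns optimality into the existence of multipliers (Farkas'
    lemma, with the consensus constraint [L x = 0] whose multipliers are [xi]),
    i.e. into a steady state of the loop.  Around any steady state the weighted
    squared distance, with a logarithmic Bregman term for [lam] and the energy
    stored in the delayed channels, is nonincreasing: convexity handles the
    agents, and the scattering variables make the channels passive.

    This bounds the trajectory and yields [rho_k -> 0] for [k > 1] (Barbalat),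
    so that [x], and by the dissipation also [xi], vary slowly: their increments
    over windows of fixed length vanish.  The scattering reflection is a
    contraction in a suitable norm, hence each [r_ij] is asymptotic to the mean
    of the states of [i] and [j], and all the remaining right-hand sides vanish
    asymptotically.  Every cluster point is therefore a steady state, except
    possibly for [g_i <= 0].

    Let [V] be the energy centred at a cluster point.  Where [g_i > 0] at that
    point, [lam_i] is zero there and [V] need not decrease, but
    [V - sum lam_i^2 / 2] over those [i] does, as long as the trajectory stays
    close; there [lam_i g_i -> 0] forces [lam_i] to be small, so the trajectory
    never leaves and [V -> 0].  Then [lam_i] is both eventually increasing and
    convergent to zero, which is absurd: [g_i <= 0] and the limit is optimal. *)

(** The equation of [lam] keeps [lam_i = 0] invariant, so the loop has steady states with [g_i > 0],
    and stationarity of a cluster point does not make it feasible. Hence two centres: at an optimal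
    point the energy is a genuine Lyapunov function and yields the asymptotic facts; these no longer
    mention the centre and are then combined with the energy centred at a cluster point.

    The signals [r_ij] jump, so the gaps [r_ij - x_i] are not uniformly continuous a priori and
    Barbalat's lemma cannot be applied to them at once. It applies first to [rho_k] with [k > 1],
    which is Lipschitz; a combination of [rho_1] and [rho_2] free of [nu] then makes [x] slow. The
    derivative of [xi] is linear in the gaps while the dissipation is quadratic, so Young's
    inequality makes [xi] slow. Only then do the channels make [r_ij] slow, and Barbalat's lemma
    reaches the gaps.

    The energy is used only past the sum of all delays, when the zero prehistory has left the
    channels. *)

Set Implicit Arguments.
Unset Strict Implicit.
Unset Printing Implicit Defensive.

Import Order.TTheory GRing.Theory Num.Theory.
Import numFieldNormedType.Exports.
Local Open Scope classical_set_scope.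
Local Open Scope ring_scope.

(** * Functions differentiable off finite sets *)

Section PiecewiseDerivative.
Variable R : realType.
Implicit Types (u v w : R -> R) (a b s t : R) (D : seq R).

(** Induction on the list: an exceptional point inside the interval splits it, and continuity there
    joins the two halves; with no point left the mean value theorem applies. *)
Lemma nonincreasing_off_seq D u v s t : s <= t ->
  (forall r, s <= r <= t -> {for r, continuous u}) ->
  (forall r, s < r < t -> r \notin D -> is_derive r 1 u (v r)) ->
  (forall r, s < r < t -> v r <= 0) -> u t <= u s.
Proof.
elim: D s t => [|d D IH] s t st cu du vle.
  have [->//|nst] := eqVneq s t.
  have lst : s < t by rewrite lt_neqAle nst.
  have cc : {within `[s, t], continuous u}.
    by apply: continuous_in_subspaceT => r; rewrite inE/= in_itv/=; exact: cu.
  have dd : forall x, x \in `]s, t[%R -> is_derive x 1 u (v x).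
    by move=> x; rewrite in_itv/= => xst; exact: du.
  have [r /[!in_itv]/= rst /eqP] := MVT lst dd cc.
  rewrite subr_eq => /eqP ->.
  by rewrite gerDr mulr_le0_ge0 ?subr_ge0// vle.
have [dst|dst] := boolP (s < d < t); last first.
  apply: IH => // r rst rD; apply: du => //.
  rewrite inE negb_or rD andbT; apply: contra dst => /eqP <- //.
have /andP[sd dt] := dst.
apply: (@le_trans _ _ (u d)).
- apply: IH (ltW dt) _ _ _ => r /andP[r1 r2].
  + by apply: cu; rewrite r2 (le_trans (ltW sd)).
  + move=> rD; apply: du; rewrite ?r2 ?(lt_trans sd)//.
    by rewrite inE negb_or rD andbT gt_eqF.
  + by apply: vle; rewrite r2 (lt_trans sd).
- apply: IH (ltW sd) _ _ _ => r /andP[r1 r2].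
  + by apply: cu; rewrite r1 (le_trans r2 (ltW dt)).
  + move=> rD; apply: du; rewrite ?r1 ?(lt_trans r2)//.
    by rewrite inE negb_or rD andbT lt_eqF.
  + by apply: vle; rewrite r1 (lt_trans r2).
Qed.

(** The list depends on [b] because the switching times are only locally finite; the start [a] is a
    parameter because a shift by a delay moves it. *)
Definition pder a u v :=
  (forall t, a < t -> {for t, continuous u}) /\
  (forall b, exists D, forall t, a < t < b -> t \notin D ->
     is_derive t 1 u (v t)).

Lemma pder_le a u v s t K : pder a u v -> a < s -> s <= t ->
  (forall r, s < r < t -> v r <= K) -> u t - u s <= K * (t - s).
Proof.
move=> [cu du] sa st vK; have [D dD] := du t.
have der (r : R) : s < r < t -> r \notin D ->
    is_derive r 1 (u \- K \*: (@id R)) (v r - K).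
  move=> /andP[r1 r2] rD; have ? := dD r.
  have -> : v r - K = v r - K *: 1 by rewrite /GRing.scale/= mulr1.
  apply: is_deriveB; first by apply: dD => //; rewrite r2 (lt_trans sa).
have := @nonincreasing_off_seq D (u \- K \*: (@id R)) (fun r => v r - K) s t st.
rewrite /= /GRing.scale/= => H.
have {}H : u t - K * t <= u s - K * s.
  apply: H => [r /andP[r1 r2]|r rst]; last by rewrite subr_le0 vK.
  apply: continuousB; first by apply: cu; rewrite (lt_le_trans sa).
  by apply: continuousM; [exact: cst_continuous|exact: cvg_id].
by rewrite mulrBr; lra.
Qed.

Lemma pderD a u v u' v' : pder a u v -> pder a u' v' ->
  pder a (fun t => u t + u' t) (fun t => v t + v' t).
Proof.
move=> [cu du] [cu' du']; split=> [t /[dup] /cu ? /cu' ?|b].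
  exact: continuousD.
have [D dD] := du b; have [D' dD'] := du' b; exists (D ++ D') => t tb.
rewrite mem_cat negb_or => /andP[tD tD'].
by apply: is_deriveD; [exact: dD|exact: dD'].
Qed.

Lemma pder_cst a c : pder a (fun=> c) (fun=> 0).
Proof.
split=> [t _|b]; first exact: cst_continuous.
by exists [::] => t _ _; exact: is_derive_cst.
Qed.

Lemma pderM a u v u' v' : pder a u v -> pder a u' v' ->
  pder a (fun t => u t * u' t) (fun t => v t * u' t + u t * v' t).
Proof.
move=> [cu du] [cu' du']; split=> [t /[dup] /cu ? /cu' ?|b].
  exact: continuousM.
have [D dD] := du b; have [D' dD'] := du' b; exists (D ++ D') => t tb.
rewrite mem_cat negb_or => /andP[tD tD'].
apply: is_derive_eq (is_deriveM (dD _ tb tD) (dD' _ tb tD')) _.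
by rewrite addrC /GRing.scale/= mulrC.
Qed.

Lemma pder_ext a u v u' v' : (forall t, a < t -> v t = v' t) -> u =1 u' ->
  pder a u v -> pder a u' v'.
Proof.
move=> vv' /funext -> [cu du]; split=> // b; have [D dD] := du b.
by exists D => t tb tD; rewrite -vv'; [exact: dD|case/andP: tb].
Qed.

Lemma pderZ a c u v : pder a u v -> pder a (fun t => c * u t) (fun t => c * v t).
Proof.
move=> uv; have := pderM (pder_cst a c) uv.
by apply: pder_ext => // t _; rewrite mul0r add0r.
Qed.

Lemma pderB a u v u' v' : pder a u v -> pder a u' v' ->
  pder a (fun t => u t - u' t) (fun t => v t - v' t).
Proof.
move=> uv /(pderZ (-1)) uv'; have := pderD uv uv'.
by apply: pder_ext => t *; rewrite !mulN1r.
Qed.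

Lemma pder_sqr a u v c : pder a u v ->
  pder a (fun t => (u t - c) ^+ 2) (fun t => 2 * ((u t - c) * v t)).
Proof.
move=> uv; have pc := pderB uv (pder_cst a c).
apply: pder_ext (pderM pc pc) => t; last by rewrite expr2.
by move=> _; rewrite subr0; ring.
Qed.

Lemma pder_sum a (I : Type) (r : seq I) (P : pred I) (u v : I -> R -> R) :
  (forall i, P i -> pder a (u i) (v i)) ->
  pder a (fun t => \sum_(i <- r | P i) u i t) (fun t => \sum_(i <- r | P i) v i t).
Proof.
move=> uv; elim: r => [|i r IH].
  by apply: pder_ext (pder_cst a 0) => t *; rewrite big_nil.
have [Pi|Pi] := boolP (P i).
  by apply: pder_ext (pderD (uv i Pi) IH) => t *; rewrite big_cons Pi.
by apply: pder_ext IH => t *; rewrite big_cons (negbTE Pi).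
Qed.

Lemma pder_sub a a' u v : a <= a' -> pder a u v -> pder a' u v.
Proof.
move=> aa' [cu du]; split=> [t ta|b]; first by apply: cu; exact: le_lt_trans ta.
have [D dD] := du b; exists D => t /andP[t1 t2]; apply: dD.
by rewrite t2 (le_lt_trans aa').
Qed.

Lemma is_derive_shift u (c t l : R) : is_derive (t - c) 1 u l ->
  is_derive t 1 (fun r => u (r - c)) l.
Proof.
move=> ul.
have h : is_derive t 1 (fun r : R => r - c) 1.
  by rewrite -[X in is_derive _ _ _ X]subr0; exact: is_deriveB.
have := @is_derive1_comp _ u (fun r => r - c) t l 1 ul h.
by rewrite mulr1.
Qed.

Lemma pder_shift a u v c : pder a u v ->
  pder (a + c) (fun t => u (t - c)) (fun t => v (t - c)).
Proof.
move=> [cu du]; split=> [t ta|b].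
  apply: (@continuous_comp _ _ _ (fun r : R => r - c) u).
    by apply: continuousB; [exact: cvg_id|exact: cst_continuous].
  by apply: cu; rewrite ltrBrDr.
have [D dD] := du (b - c); exists [seq r + c | r <- D] => t /andP[t1 t2] tD.
apply: is_derive_shift; apply: dD.
  by rewrite ltrBrDr t1 ltrD2r.
by apply: contra tD => ?; apply/mapP; exists (t - c) => //; rewrite subrK.
Qed.

Lemma pder_comp a u v (f df : R -> R) : pder a u v ->
  (forall t, a < t -> is_derive (u t) 1 f (df (u t))) ->
  pder a (fun t => f (u t)) (fun t => df (u t) * v t).
Proof.
move=> [cu du] fdf; split=> [t ta|b].
  apply: continuous_comp; first exact: cu.
  by apply: differentiable_continuous; apply/derivable1_diffP; apply: ex_derive; exact: fdf.
have [D dD] := du b; exists D => t tb tD.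
have ta : a < t by case/andP: tb.
exact: (@is_derive1_comp _ f u t _ _ (fdf t ta) (dD t tb tD)).
Qed.

End PiecewiseDerivative.

(** * Piecewise continuity and antiderivatives *)

Section PiecewiseContinuity.
Variable R : realType.
Implicit Types (u v : R -> R) (a b c s t T : R).

(** The regularity that received signals keep despite the jumps at first arrivals and at their
    reflections; it is enough for measurability. *)
Definition pcont b u := exists D : seq R, forall t, 0 < t < b -> t \notin D ->
  {for t, continuous u}.

Lemma measurable_fun_finite (D : seq R) (A : set R) u : A `<=` [set` D] ->
  measurable_fun A u.
Proof.
move=> AD _ Y _; apply: countable_measurable; first exact: measurable_set1.
by apply/finite_set_countable; apply: (@sub_finite_set _ _ [set` D]) => // t [/AD].
Qed.

Lemma pcont_measurable b u : pcont b u -> measurable_fun `[0, b]%classic u.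
Proof.
move=> [D Dc]; pose A := `]0, b[%classic `\` [set` D].
have mD (E : seq R) : measurable [set` E].
  apply: countable_measurable; first exact: measurable_set1.
  exact/finite_set_countable/finite_seq.
have mA : measurable A by apply: measurableD.
have AE : `[0, b]%classic `<=` A `|` [set` 0 :: b :: D].
  move=> t /=; rewrite in_itv/= => /andP[t0 tb].
  have [tD|tD] := boolP (t \in 0 :: b :: D); [by right|left].
  move: tD; rewrite !inE !negb_or => /and3P[n0 nb nD].
  split; last by move=> /= tD; rewrite tD in nD.
  by rewrite /= in_itv/= !lt_neqAle t0 tb eq_sym n0 nb.
apply: measurable_funS AE _; first exact: measurableU.
apply/(measurable_funU _ mA (mD _)); split; last exact: (@measurable_fun_finite (0 :: b :: D) _ u (fun _ h => h)).
apply: subspace_continuous_measurable_fun => //.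
apply: continuous_in_subspaceT => t; rewrite inE => -[/= + tD].
rewrite in_itv/= => tb; apply: Dc => //; exact/negP.
Qed.

(** The Lebesgue integral from 0 is continuous across the jumps of [u]. It provides the energy
    stored in a channel and the integrating factor for [lam]. *)
Lemma pcont_antiderivative u : (forall b, pcont b u) ->
  (forall b, exists K : R, forall t, 0 <= t <= b -> `|u t| <= K) ->
  exists F, forall t, 0 < t ->
    {for t, continuous F} /\ ({for t, continuous u} -> is_derive t 1 F (u t)).
Proof.
move=> pu bu; pose mu := @lebesgue_measure R.
have int b : mu.-integrable `[0, b] (EFin \o u).
  apply: measurable_bounded_integrable => //.
  - by rewrite /= lebesgue_measure_itv; case: ifP => _; rewrite ?ltry// -EFinD ltry.
  - exact: pcont_measurable.
  - have [K uK] := bu b; exists K; split; first exact: num_real.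
    move=> M KM t /=; rewrite in_itv/= => tb.
    by rewrite (le_trans (uK _ tb))// ltW.
exists (fun x => \int[mu]_(t in `[0, x]) u t) => t t0.
have tt : t < t + 1 by rewrite ltrDl.
split.
  have t10 : 0 <= t + 1 by rewrite (le_trans (ltW t0))// ltW.
  have := parameterized_integral_continuous t10 (int (t + 1)).
  move/within_continuous_continuous; apply.
  - exact: lt_trans tt.
  - by rewrite in_itv/= t0 tt.
move=> cu; have [d1 d2] := continuous_FTC1_closed tt (int (t + 1)) t0 cu.
by rewrite -d2 derive1E; apply: DeriveDef.
Qed.

Lemma eq_pcont b u v : u =1 v -> pcont b u -> pcont b v.
Proof. by move=> /funext ->. Qed.

Lemma pcontD b u v : pcont b u -> pcont b v -> pcont b (fun t => u t + v t).
Proof.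
move=> [D cu] [E cv]; exists (D ++ E) => t tb; rewrite mem_cat negb_or.
by move=> /andP[? ?]; apply: continuousD; [exact: cu|exact: cv].
Qed.

Lemma pcontM b u v : pcont b u -> pcont b v -> pcont b (fun t => u t * v t).
Proof.
move=> [D cu] [E cv]; exists (D ++ E) => t tb; rewrite mem_cat negb_or.
by move=> /andP[? ?]; apply: continuousM; [exact: cu|exact: cv].
Qed.

Lemma pcont_continuous b u : (forall t, 0 < t -> {for t, continuous u}) ->
  pcont b u.
Proof. by move=> cu; exists [::] => t /andP[t0 _] _; exact: cu. Qed.

Lemma pcont_cst b c : pcont b (fun=> c).
Proof. by apply: pcont_continuous => t _; exact: cst_continuous. Qed.

Lemma pcontB b u v : pcont b u -> pcont b v -> pcont b (fun t => u t - v t).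
Proof.
move=> pu pv; by apply: eq_pcont (pcontD pu (pcontM (pcont_cst b (-1)) pv)) => t; rewrite mulN1r.
Qed.

Lemma pcont_sum b (I : Type) (r : seq I) (P : pred I) (u : I -> R -> R) :
  (forall i, P i -> pcont b (u i)) -> pcont b (fun t => \sum_(i <- r | P i) u i t).
Proof.
move=> pu; elim: r => [|i r IH].
  by apply: eq_pcont (pcont_cst b 0) => t; rewrite big_nil.
have [Pi|Pi] := boolP (P i).
  by apply: eq_pcont (pcontD (pu i Pi) IH) => t; rewrite big_cons Pi.
by apply: eq_pcont IH => t; rewrite big_cons (negbTE Pi).
Qed.

Lemma pcont_delay b T u : pcont b u ->
  pcont (b + T) (fun t => if t < T then 0 else u (t - T)).
Proof.
move=> [D cu]; exists (T :: [seq r + T | r <- D]) => t /andP[t0 tb].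
rewrite inE negb_or => /andP[tT tD].
have [ltT|leT] := ltP t T.
  have : {for t, continuous (fun=> 0 : R)} by exact: cst_continuous.
  rewrite /prop_for /continuous_at ltT; apply: cvg_trans.
  apply: near_eq_cvg; near=> x.
  have -> // : x < T by near: x; exact: lt_nbhsl.
have {tT leT} ltT : T < t by rewrite lt_neqAle eq_sym tT.
have ct : {for t, continuous (fun x => u (x - T))}.
  apply: (@continuous_comp _ _ _ (fun r : R => r - T) u).
    by apply: continuousB; [exact: cvg_id|exact: cst_continuous].
  apply: cu; first by rewrite subr_gt0 ltT ltrBlDr.
  by apply: contra tD => ?; apply/mapP; exists (t - T) => //; rewrite subrK.
move: ct; rewrite /prop_for /continuous_at ltNge (ltW ltT); apply: cvg_trans.
apply: near_eq_cvg; near=> x.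
have -> // : (x < T) = false.
by apply/negbTE; rewrite -leNgt ltW//; near: x; exact: lt_nbhsr.
Unshelve. all: by end_near. Qed.

Lemma pcont_sub b b' u : b <= b' -> pcont b' u -> pcont b u.
Proof.
move=> bb [D cu]; exists D => t /andP[t0 tb]; apply: cu.
by rewrite t0 (lt_le_trans tb).
Qed.

End PiecewiseContinuity.

(** * Slowly varying functions *)

Section Asymptotics.
Variable R : realType.
Implicit Types (u v w V dV l g : R -> R) (a b c s t T H K : R).

(** Weaker than convergence ([ln t] qualifies), but enough to make a delayed signal asymptotic to
    the current one and to spread a limit along a sequence of times over windows of fixed length. *)
Definition slow u := forall H e, 0 < e ->
  \forall t \near +oo, forall h, 0 <= h <= H -> `|u (t + h) - u t| <= e.

Lemma nearyP (P : set R) :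
  (\forall t \near +oo, P t) <-> exists T, forall t, T <= t -> P t.
Proof.
split=> [[M [_ MP]]|[T TP]].
  by exists (M + 1) => t Mt; apply: MP; rewrite (lt_le_trans _ Mt)// ltrDl.
by exists T; split; [exact: num_real|move=> t /ltW; exact: TP].
Qed.

Lemma near_and (P Q : set R) : (\forall t \near +oo, P t) ->
  (\forall t \near +oo, Q t) -> \forall t \near +oo, P t /\ Q t.
Proof. by move=> FP FQ; apply: filterS2 FP FQ. Qed.

Lemma near_ge T : \forall t \near +oo, T <= t.
Proof. by apply/nearyP; exists T. Qed.

Lemma near_gt T : \forall t \near +oo, T < t.
Proof. by apply/nearyP; exists (T + 1) => t; apply: lt_le_trans; rewrite ltrDl. Qed.

Lemma near_tail (P : set R) c : (\forall t \near +oo, P t) ->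
  \forall t \near +oo, forall s, t - c <= s -> P s.
Proof.
move=> /nearyP[T TP]; apply/nearyP; exists (T + c) => t Tt s ts.
by apply: TP; apply: le_trans ts; rewrite lerBrDr.
Qed.

Lemma vanishP u : u t @[t --> +oo] --> 0 <->
  forall e, 0 < e -> \forall t \near +oo, `|u t| <= e.
Proof. exact: cvgr0Pnorm_le. Qed.

Lemma slow_vanish u : u t @[t --> +oo] --> 0 -> slow u.
Proof.
move=> /vanishP u0 H e e0; have := near_tail 0 (u0 _ (divr_gt0 e0 (ltr0n _ 2))).
apply: filterS => t ut h /andP[h0 _].
rewrite (le_trans (ler_normB _ _))// (splitr e) lerD//; apply: ut; first by lra.
by lra.
Qed.

Lemma eq_slow u v : u =1 v -> slow u -> slow v.
Proof. by move=> /funext ->. Qed.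

Lemma slow_cst c : slow (fun=> c).
Proof. by move=> H e e0; near=> t => h _; rewrite subrr normr0 ltW.
Unshelve. all: by end_near. Qed.

Lemma slowD u v : slow u -> slow v -> slow (fun t => u t + v t).
Proof.
move=> su sv H e e0; have e2 : 0 < e / 2 by exact: divr_gt0.
apply: filterS2 (su H _ e2) (sv H _ e2) => t ut vt h hH.
rewrite opprD addrACA (splitr e) (le_trans (ler_normD _ _))// lerD//.
  exact: ut.
exact: vt.
Qed.

Lemma slowM u v K : (\forall t \near +oo, `|u t| <= K) ->
  (\forall t \near +oo, `|v t| <= K) -> slow u -> slow v ->
  slow (fun t => u t * v t).
Proof.
move=> uK vK su sv H e e0.
have K0 : 0 <= K.
  by have [t /(le_trans (normr_ge0 _))] := filter_ex uK.
have d0 : 0 < e / (2 * (K + 1)) by apply: divr_gt0 => //; lra.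
have := near_and (near_tail 0 uK) (near_tail 0 vK).
apply: filterS3 (su H _ d0) (sv H _ d0) => t ut vt [uKt vKt] h /[dup] hH /andP[h0 _].
have -> : u (t + h) * v (t + h) - u t * v t =
  (u (t + h) - u t) * v (t + h) + u t * (v (t + h) - v t) by ring.
have -> : e = e / (2 * (K + 1)) * (K + 1) + (K + 1) * (e / (2 * (K + 1))).
  by field; lra.
rewrite (le_trans (ler_normD _ _))// !normrM lerD// ler_pM//.
- exact: ut.
- by rewrite (le_trans (vKt _ _))//; lra.
- by rewrite (le_trans (uKt _ _))//; lra.
- exact: vt.
Qed.

Lemma slowZ c u : slow u -> slow (fun t => c * u t).
Proof.
move=> su H e e0; have d0 : 0 < e / (`|c| + 1).
  by apply: divr_gt0 => //; rewrite ltr_pwDr.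
apply: filterS (su H _ d0) => t ut h hH.
rewrite -mulrBr normrM.
have -> : e = (`|c| + 1) * (e / (`|c| + 1)).
  by field; rewrite gt_eqF// ltr_pwDr.
by rewrite ler_pM// ?lerDl// ut.
Qed.

Lemma slowB u v : slow u -> slow v -> slow (fun t => u t - v t).
Proof.
move=> su /(slowZ (-1)) sv; apply: eq_slow (slowD su sv) => t.
by rewrite mulN1r.
Qed.

Lemma slow_sum (I : Type) (r : seq I) (P : pred I) (u : I -> R -> R) :
  (forall i, P i -> slow (u i)) -> slow (fun t => \sum_(i <- r | P i) u i t).
Proof.
move=> su; elim: r => [|i r IH].
  by apply: eq_slow (slow_cst 0) => t; rewrite big_nil.
have [Pi|Pi] := boolP (P i).
  by apply: eq_slow (slowD (su i Pi) IH) => t; rewrite big_cons Pi.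
by apply: eq_slow IH => t; rewrite big_cons (negbTE Pi).
Qed.

Lemma slow_shift u c : 0 <= c -> slow u ->
  u (t - c) - u t @[t --> +oo] --> 0.
Proof.
move=> c0 su; apply/vanishP => e e0.
have := near_tail c (su c e e0); apply: filterS => t /(_ (t - c) (lexx _)).
move=> /(_ c); rewrite c0 lexx subrK distrC; exact.
Qed.

Lemma vanishD u v : u t @[t --> +oo] --> 0 -> v t @[t --> +oo] --> 0 ->
  u t + v t @[t --> +oo] --> 0.
Proof. by move=> u0 v0; rewrite -(addr0 0); exact: cvgD. Qed.

Lemma vanishB u v : u t @[t --> +oo] --> 0 -> v t @[t --> +oo] --> 0 ->
  u t - v t @[t --> +oo] --> 0.
Proof. by move=> u0 v0; rewrite -(subr0 0); exact: cvgB. Qed.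

Lemma vanishZ c u : u t @[t --> +oo] --> 0 -> c * u t @[t --> +oo] --> 0.
Proof. by move=> u0; rewrite -(mulr0 c); apply: cvgM => //; exact: cvg_cst. Qed.

Lemma eq_vanish u v : u =1 v -> u t @[t --> +oo] --> 0 ->
  v t @[t --> +oo] --> 0.
Proof. by move=> /funext ->. Qed.

Lemma vanish_sum (I : Type) (r : seq I) (P : pred I) (u : I -> R -> R) :
  (forall i, P i -> u i t @[t --> +oo] --> 0) ->
  \sum_(i <- r | P i) u i t @[t --> +oo] --> 0.
Proof.
move=> u0; elim: r => [|i r IH].
  by apply: (@eq_vanish (fun=> 0)) => [t|]; [rewrite big_nil|exact: cvg_cst].
have [Pi|Pi] := boolP (P i).
  by apply: eq_vanish (vanishD (u0 i Pi) IH) => t; rewrite big_cons Pi.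
by apply: eq_vanish IH => t; rewrite big_cons (negbTE Pi).
Qed.

Lemma pder_norm_le a u v s t K : pder a u v -> a < s -> s <= t ->
  (forall r, s < r < t -> `|v r| <= K) -> `|u t - u s| <= K * (t - s).
Proof.
move=> uv sa st vK; rewrite ler_norml; apply/andP; split.
  have H : -1 * u t - -1 * u s <= K * (t - s).
    apply: (pder_le (pderZ (-1) uv)) => // r /vK.
    by rewrite ler_norml => /andP[]; lra.
  by lra.
by apply: (pder_le uv) => // r /vK; rewrite ler_norml => /andP[].
Qed.

Lemma pder_slow a u v : pder a u v -> v t @[t --> +oo] --> 0 -> slow u.
Proof.
move=> uv /vanishP v0 H e e0.
have d0 : 0 < e / (`|H| + 1) by apply: divr_gt0 => //; rewrite ltr_pwDr.
have := near_tail 0 (v0 _ d0); apply: filterS2 (near_gt a) => t ta vt h /andP[h0 hH].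
have := @pder_norm_le a u v t (t + h) (e / (`|H| + 1)) uv ta.
rewrite lerDl => /(_ h0) ut; apply: (le_trans (ut _)) => [r /andP[r1 _]|].
  by apply: vt; rewrite subr0 ltW.
rewrite (addrC t) addrK mulrAC ler_pdivrMr ?ltr_pwDr// ler_pM2l//.
by rewrite (le_trans hH)// (le_trans (ler_norm _))// lerDl.
Qed.

(** Where [|v|] exceeds [e], slowness keeps [v] beyond [e / 2] with the same sign over a whole
    window, and [u] would leave its bounds. *)
Lemma pder_vanish a u v B : pder a u v -> (\forall t \near +oo, `|u t| <= B) ->
  slow v -> v t @[t --> +oo] --> 0.
Proof.
move=> uv uB sv; apply/vanishP => e e0.
have B0 : 0 <= B by have [t /(le_trans (normr_ge0 _))] := filter_ex uB.
have e2 : 0 < e / 2 by exact: divr_gt0.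
(* Long enough that a slope [e / 2] moves [u] by more than [2 * B]. *)
pose H := 4 * B / e + 1.
have H0 : 0 < H by rewrite ltr_wpDl// divr_ge0 ?mulr_ge0// ltW.
have HB : B *+ 2 < e / 2 * H.
  rewrite mulrDr mulr1 (_ : e / 2 * _ = B *+ 2); first by rewrite ltrDl.
  by field; rewrite gt_eqF.
have := near_and (near_gt a) (near_tail 0 uB).
apply: filterS2 (sv H _ e2) => t vt [ta ut].
rewrite leNgt; apply/negP => evt.
have uu : `|u (t + H) - u t| <= B *+ 2.
  rewrite (le_trans (ler_normB _ _))// mulr2n lerD//; apply: ut; last by lra.
  by lra.
suff : e / 2 * H <= `|u (t + H) - u t| by lra.
have tH : t <= t + H by lra.
have [v0|v0] := lerP 0 (v t).
  rewrite ger0_norm// in evt.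
  rewrite ler_normr; apply/orP; left.
  have := pder_le (pderZ (-1) uv) ta tH (K := - (e / 2)).
  have -> : t + H - t = H by ring.
  rewrite [- (e / 2) * H]mulNr => h.
  suff : -1 * u (t + H) - -1 * u t <= - (e / 2 * H) by lra.
  apply: h => r /andP[r1 r2]; have := vt (r - t); rewrite subrKC.
  have -> : 0 <= r - t <= H by apply/andP; split; lra.
  by move=> /(_ isT); rewrite ler_distl => /andP[]; lra.
rewrite ltr0_norm// in evt.
rewrite ler_normr; apply/orP; right.
have := pder_le uv ta tH (K := - (e / 2)).
have -> : t + H - t = H by ring.
rewrite [- (e / 2) * H]mulNr => h; suff : u (t + H) - u t <= - (e / 2 * H) by lra.
apply: h => r /andP[r1 r2]; have := vt (r - t); rewrite subrKC.
have -> : 0 <= r - t <= H by apply/andP; split; lra.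
by move=> /(_ isT); rewrite ler_distl => /andP[]; lra.
Qed.

(** Once [V] is within [e] of its infimum, no later loss can exceed [e]. *)
Lemma lyapunov_cauchy a V dV : pder a V dV -> (forall t, a < t -> 0 <= V t) ->
  (forall t, a < t -> dV t <= 0) -> forall e, 0 < e ->
  \forall t \near +oo, forall h, 0 <= h -> V t - V (t + h) <= e.
Proof.
move=> pV V0 dV0 e e0.
have mono s t : a < s -> s <= t -> V t <= V s.
  move=> sa st; have := pder_le pV sa st (K := 0); rewrite mul0r subr_le0.
  by apply=> r /andP[r1 _]; apply: dV0; exact: lt_trans r1.
pose A := [set V t | t in [set t | a < t]].
have hA : has_inf A.
  split; first by exists (V (a + 1)), (a + 1) => //=; rewrite ltrDl.
  by exists 0 => _ [t /= ta <-]; exact: V0.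
have [_ [T /= Ta <-] VT] := inf_adherent e0 hA.
apply/nearyP; exists T => t Tt h h0.
have ta : a < t by exact: lt_le_trans Tt.
have : inf A <= V (t + h).
  by apply: ge_inf; [exact: (proj2 hA)|exists (t + h) => //=; lra].
by have := mono _ _ Ta Tt; lra.
Qed.

(** The common ground of the two uses of Barbalat's lemma: Lipschitz functions have this property,
    and so do slow functions, even with jumps. *)
Definition late_unif_continuous u := forall e, 0 < e -> exists2 h, 0 < h &
  \forall t \near +oo, forall s, 0 <= s <= h -> `|u (t + s) - u t| <= e.

Lemma slow_luc u : slow u -> late_unif_continuous u.
Proof. by move=> su e e0; exists 1 => //; exact: su. Qed.

Lemma lipschitz_luc a u v K : pder a u v -> (forall t, a < t -> `|v t| <= K) ->
  late_unif_continuous u.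
Proof.
move=> uv vK e e0; exists (e / (`|K| + 1)); first by rewrite divr_gt0// ltr_pwDr.
apply: filterS (near_gt a) => t ta s /andP[s0 se].
have := @pder_norm_le a u v t (t + s) K uv ta; rewrite lerDl => /(_ s0) h.
apply: (le_trans (h _)) => [r /andP[r1 _]|].
  by apply: vK; exact: lt_trans r1.
rewrite (addrC t) addrK (@le_trans _ _ ((`|K| + 1) * s))//.
  by apply: ler_wpM2r => //; rewrite (le_trans (ler_norm _))// lerDl.
by rewrite mulrC -ler_pdivlMr// ltr_pwDr.
Qed.

(** If [|y t| > e] at a late time, then [|y| >= e / 2] up to [t + h], and [V] loses twice what
    [lyapunov_cauchy] allows. *)
Lemma barbalat a V dV y k : pder a V dV -> (forall t, a < t -> 0 <= V t) ->
  0 < k -> (forall t, a < t -> dV t <= - (k * y t ^+ 2)) ->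
  late_unif_continuous y -> y t @[t --> +oo] --> 0.
Proof.
move=> pV V0 k0 dVy luc; apply/vanishP => e e0.
have e2 : 0 < e / 2 by exact: divr_gt0.
have [h h0 yh] := luc _ e2.
have dV0 t : a < t -> dV t <= 0.
  by move=> /dVy/le_trans; apply; rewrite oppr_le0 mulr_ge0 ?sqr_ge0// ltW.
have d0 : 0 < k * (e / 2) ^+ 2 * h / 2 by rewrite divr_gt0// !mulr_gt0.
apply: filterS3 (near_gt a) yh (lyapunov_cauchy pV V0 dV0 d0) => t ta yt Vt.
rewrite leNgt; apply/negP => ety.
have th : t <= t + h by lra.
have := pder_le pV ta th (K := - (k * (e / 2) ^+ 2)).
have -> : t + h - t = h by ring.
move=> H; have {H} : V (t + h) - V t <= - (k * (e / 2) ^+ 2) * h.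
  apply: H => r /andP[r1 r2].
  have := yt (r - t); rewrite subrKC.
  have -> : 0 <= r - t <= h by apply/andP; split; lra.
  move=> /(_ isT) yrt; have yr : e / 2 <= `|y r|.
    have : `|y t| <= `|y r - y t| + `|y r|.
      by rewrite -[X in `|X| <= _](subKr (y r)) (le_trans (ler_normB _ _))// addrC.
    by lra.
  apply: (le_trans (dVy _ (lt_trans ta r1))).
  rewrite lerN2 ler_pM2l// -(real_normK (num_real (y r))).
  by rewrite ler_sqr ?nnegrE// ltW.
have := Vt h (ltW h0); set q := k * _ ^+ 2 in d0 *; rewrite mulNr.
by move: d0; lra.
Qed.

(** The hypothesis is Young's inequality with a free weight, for a [v] linear in quantities whose
    squares are dissipated. Over a window of length [H] it bounds the increment of [u] by
    [k * C * H] plus the loss of [V] divided by [k]: fix [k] small, then take the time late. This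
    works for a [v] with jumps. *)
Lemma slow_of_dissipation a V dV u v C : pder a V dV -> pder a u v ->
  (forall t, a < t -> 0 <= V t) -> 0 <= C ->
  (forall k t, 0 < k -> a < t -> `|v t| <= k * C - dV t / k) ->
  slow u.
Proof.
move=> pV uv V0 C0 vC H e e0.
(* Were [dV t] positive, the weight [k] below would make the right-hand side of the hypothesis
   negative. *)
have dV0 t : a < t -> dV t <= 0.
  move=> ta; rewrite leNgt; apply/negP => dt.
  have k0 : 0 < dV t / (C + dV t + 1) by rewrite divr_gt0//; lra.
  have C1 : C + dV t + 1 != 0 by rewrite gt_eqF//; lra.
  have := le_trans (normr_ge0 _) (vC _ _ k0 ta).
  rewrite (_ : _ - _ = dV t * C / (C + dV t + 1) - (C + dV t + 1)); last first.
    by field; rewrite ?C1 ?(gt_eqF dt).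
  have : dV t * C / (C + dV t + 1) <= dV t.
    by rewrite ler_pdivrMr; [nra|lra].
  lra.
(* With this weight [k * C * H] is at most [e / 2], and a loss of [V] up to [k * e / 2] costs the
   other half. *)
pose k := e / (2 * (C * `|H| + 1)).
have CH : 0 <= C * `|H| by rewrite mulr_ge0.
have k0 : 0 < k by rewrite divr_gt0//; lra.
have d0 : 0 < k * e / 2 by rewrite divr_gt0// mulr_gt0.
apply: filterS2 (near_gt a) (lyapunov_cauchy pV V0 dV0 d0) => t ta Vt h.
move=> /andP[h0 hH]; have th : t <= t + h by lra.
have bound u' v' : pder a u' v' ->
    (forall r, a < r -> v' r <= k * C - dV r / k) -> u' (t + h) - u' t <= e.
  move=> uv' vC'; have := pder_le (pderD uv' (pderZ k^-1 pV)) ta th (K := k * C).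
  have -> : t + h - t = h by ring.
  move=> D; have {D} : u' (t + h) + k^-1 * V (t + h) - (u' t + k^-1 * V t) <=
      k * C * h.
    apply: D => r /andP[r1 _]; have := vC' _ (lt_trans ta r1).
    by rewrite [dV r / k]mulrC; lra.
  have : k^-1 * (V t - V (t + h)) <= e / 2.
    by rewrite mulrC ler_pdivrMr// (le_trans (Vt _ h0))//; lra.
  have : k * C * h <= e / 2.
    rewrite (@le_trans _ _ (k * (C * `|H| + 1)))//.
      rewrite -mulrA ler_pM2l// (@le_trans _ _ (C * `|H|)) ?lerDl// ler_wpM2l//.
      by rewrite (le_trans hH)// ler_norm.
    by rewrite /k le_eqVlt; apply/orP; left; apply/eqP; field; lra.
  by rewrite mulrBr; lra.
rewrite ler_norml; apply/andP; split; last first.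
  apply: bound uv _ => r ra; exact: le_trans (ler_norm _) (vC _ _ k0 ra).
have := bound _ _ (pderZ (-1) uv).
rewrite !mulN1r => D; have {D} : - u (t + h) - - u t <= e; last by lra.
apply: D => r ra; rewrite mulN1r.
by rewrite (le_trans _ (vC _ _ k0 ra))// -normrN ler_norm.
Qed.

(** Used with [l = ln lam]. If the product is large at [t], then [|g t| > e / B], and by slowness
    [g] keeps its sign and half this size nearby. A positive [g] drives [l] above [ln B] after [t].
    A negative [g] gives no contradiction later, since [l] may tend to minus infinity; but looking
    back, [l] must have exceeded [ln B] at [t - H]. *)
Lemma exp_mul_vanish a l g G B : pder a l (fun t => 2 * g t) -> slow g ->
  (\forall t \near +oo, `|g t| <= G) ->
  (\forall t \near +oo, expR (l t) <= B) ->
  expR (l t) * g t @[t --> +oo] --> 0.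
Proof.
move=> pl sg gG lB; apply/vanishP => e e0.
have B0 : 0 < B.
  by have [t /(lt_le_trans (expR_gt0 _))] := filter_ex lB.
have G0 : 0 <= G by have [t /(le_trans (normr_ge0 _))] := filter_ex gG.
have d0 : 0 < e / (2 * B) by apply: divr_gt0 => //; lra.
(* on a window of length [H] the exponent varies by at least [ln B - m],
   where [m] bounds [l t] from below *)
pose m := ln (e / (G + 1)).
have em : expR m = e / (G + 1) by rewrite lnK// posrE divr_gt0//; lra.
pose H := (`|ln B - m| + 1) / (e / B).
have eB : 0 < e / B by rewrite divr_gt0.
have H0 : 0 < H by rewrite divr_gt0// ltr_pwDr.
have He : (e / B) * H = `|ln B - m| + 1 by rewrite mulrC divfK// gt_eqF.
have := near_and (near_tail H gG) (near_tail H lB).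
apply: filterS3 (near_gt (a + H)) (near_tail H (sg H _ d0)) => t ta gt [gGt lBt].
rewrite leNgt; apply/negP => egt.
have lt_lnB s : t - H <= s -> l s <= ln B.
  by move=> ts; rewrite -ler_expR lnK ?posrE// lBt.
have mlt : m <= l t.
  rewrite -ler_expR em ler_pdivrMr; last by lra.
  rewrite (le_trans (ltW egt))// normrM (ger0_norm (expR_ge0 _)) ler_pM2l ?expR_gt0//.
  by rewrite (le_trans (gGt t _))//; lra.
have egB : e / B < `|g t|.
  rewrite ltr_pdivrMr// (lt_le_trans egt)// normrM (ger0_norm (expR_ge0 _)).
  by rewrite mulrC ler_wpM2l// lBt//; lra.
have eB2 : e / B = e / (2 * B) * 2 by field; rewrite gt_eqF.
have lnBm : ln B - m <= `|ln B - m| by exact: ler_norm.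
have [g0|g0] := lerP 0 (g t).
  rewrite ger0_norm// in egB.
  have at' : a < t by lra.
  have tH : t <= t + H by lra.
  have := pder_le (pderZ (-1) pl) at' tH (K := - (e / B)).
  have -> : t + H - t = H by ring.
  rewrite [- (e / B) * H]mulNr He => D; have := lt_lnB (t + H).
  have -> : t - H <= t + H by lra.
  move=> /(_ isT) lB'; have : -1 * l (t + H) - -1 * l t <= - (`|ln B - m| + 1).
    apply: D => r /andP[r1 r2]; have := gt t _ (r - t); rewrite subrKC.
    have -> : t - H <= t by lra.
    have -> : 0 <= r - t <= H by apply/andP; split; lra.
    by move=> /(_ isT isT); rewrite ler_distl => /andP[]; lra.
  lra.
rewrite ltr0_norm// in egB.
have at' : a < t - H by lra.
have tH : t - H <= t by lra.
have := pder_le pl at' tH (K := - (e / B)).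
have -> : t - (t - H) = H by ring.
rewrite [- (e / B) * H]mulNr He => D; have := lt_lnB (t - H) (lexx _).
have : l t - l (t - H) <= - (`|ln B - m| + 1).
  apply: D => r /andP[r1 r2]; have := gt r _ (t - r); rewrite subrKC.
  have -> : t - H <= r by lra.
  have -> : 0 <= t - r <= H by apply/andP; split; lra.
  by move=> /(_ isT isT); rewrite ler_distl => /andP[]; lra.
lra.
Qed.

End Asymptotics.

(** * Scattering channels *)

Section DelayedContraction.
Variable R : realType.
Implicit Types (A c : R -> R) (b t T th C K : R).

(** Induction on the number of delays elapsed; a zero delay gives the bound directly. Everything is
    confined to [[0, b]] so that it can be used before the states are known to be bounded for all
    time. *)
Lemma contraction_bound A T th C b : 0 <= T -> 0 <= th < 1 -> 0 <= C ->
  (forall t, 0 <= t <= b -> A t <= th * (if t < T then 0 else A (t - T)) + C) ->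
  forall t, 0 <= t <= b -> A t <= C / (1 - th).
Proof.
move=> T0 /andP[th0 th1] C0 AC.
have q0 : 0 <= C / (1 - th) by rewrite divr_ge0//; lra.
have qE : th * (C / (1 - th)) + C = C / (1 - th) by field; lra.
move: T0; rewrite le_eqVlt => /predU1P[T0|T0] t.
  move=> tb; have := AC _ tb; rewrite -T0 ltNge (andP tb).1 /= subr0 => At.
  by rewrite ler_pdivlMr; lra.
have [k] : exists k : nat, t < T *+ k.
  exists (Num.bound `|t / T|); rewrite -mulr_natr -ltr_pdivrMl// mulrC.
  by rewrite (le_lt_trans (ler_norm _))// archi_boundP.
elim: k t => [|k IH] t; first by rewrite mulr0n => t0 /andP[]; lra.
rewrite mulrS => tk tb; apply: le_trans (AC _ tb) _; rewrite -[leRHS]qE lerD2r.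
case: ltP => tT; first by rewrite mulr0 mulr_ge0.
by rewrite ler_wpM2l//; apply: IH; [lra|apply/andP; case/andP: tb; split; lra].
Qed.

(** Once [c] stays below [e / 2 * (1 - th)], each further delay multiplies the excess of the bound
    over [e / 2] by [th]. *)
Lemma contraction_vanish A c T th K : 0 <= T -> 0 <= th < 1 ->
  (forall t : R, 0 <= t -> 0 <= A t <= K) ->
  (forall t, T <= t -> A t <= th * A (t - T) + c t) ->
  c t @[t --> +oo] --> 0 -> A t @[t --> +oo] --> 0.
Proof.
move=> T0 /andP[th0 th1] AK Ac /vanishP c0; apply/vanishP => e e0.
have d0 : 0 < e / 2 * (1 - th) by rewrite mulr_gt0//; lra.
have /nearyP[s0 cs0] := c0 _ d0.
pose s := `|s0|; have s_ge0 : 0 <= s by exact: normr_ge0.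
have cs t : s <= t -> c t <= e / 2 * (1 - th).
  move=> st; apply: le_trans (ler_norm _) (cs0 _ _).
  exact: le_trans (ler_norm _) st.
have K0 : 0 <= K by have /andP[] := AK 0 (lexx 0); exact: le_trans.
have bound k t : s + T *+ k <= t -> A t <= th ^+ k * K + e / 2.
  elim: k t => [|k IH] t.
    rewrite mulr0n addr0 mul1r => st.
    by have /andP[_] := AK t (le_trans s_ge0 st); lra.
  rewrite mulrS => st.
  have Tk : 0 <= T *+ k by rewrite mulrn_wge0.
  have At : A t <= th * A (t - T) + c t by apply: Ac; lra.
  have ct : c t <= e / 2 * (1 - th) by apply: cs; lra.
  have AtT : A (t - T) <= th ^+ k * K + e / 2 by apply: IH; lra.
  have := ler_wpM2l th0 AtT; rewrite exprS; lra.
have [k thk] : exists k, th ^+ k * K <= e / 2.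
  have : (th ^+ k * K) @[k --> \oo] --> 0.
    rewrite -(mul0r K); apply: cvgM; last exact: cvg_cst.
    by apply: cvg_expr; rewrite ger0_norm.
  move=> /cvgr0Pnorm_le/(_ (e / 2)); rewrite divr_gt0// => /(_ isT).
  move=> [k _ /(_ k (leqnn k))/= kle]; exists k.
  exact: le_trans (ler_norm _) kle.
apply/nearyP; exists (s + T *+ k) => t st.
have t0 : 0 <= t by apply: le_trans st; rewrite addr_ge0// mulrn_wge0.
have /andP[At0 _] := AK t t0.
by rewrite ger0_norm// (le_trans (bound k t st))//; lra.
Qed.

End DelayedContraction.


(* One coordinate of the two-way channel between two agents, with the signals
   scaled by [sqrt (2 eta)] and [E = a [[1, -1], [1, 0]]].  In the norm whose
   square is [qf], [E / a] is a rotation by a sixth of a turn, so the reflection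
   [(eta - E) / (eta + E)] scales [qf] by
   [(eta^2 - eta a + a^2) / (eta^2 + eta a + a^2) < 1], although it is not a
   strict contraction of the Euclidean norm. *)
Section Channel.
Variable R : realType.
Variables (a eta : R).
Hypotheses (a0 : 0 < a) (eta0 : 0 < eta).

Definition qf (u v : R) := u ^+ 2 + v ^+ 2 + (u - v) ^+ 2.

Lemma qf_ge0 u v : 0 <= qf u v.
Proof. by rewrite /qf !addr_ge0 ?sqr_ge0. Qed.

Lemma qfD_le (e u v u' v' : R) : 0 < e ->
  qf (u + u') (v + v') <= (1 + e) * qf u v + (1 + e^-1) * qf u' v'.
Proof.
move=> e0; have sq (x y : R) : (x + y) ^+ 2 <= (1 + e) * x ^+ 2 + (1 + e^-1) * y ^+ 2.
  rewrite -subr_ge0 (_ : _ - _ = e^-1 * (e * x - y) ^+ 2); last first.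
    by field; rewrite gt_eqF.
  by rewrite mulr_ge0 ?sqr_ge0// invr_ge0 ltW.
have := sq u u'; have := sq v v'; have := sq (u - v) (u' - v').
by rewrite /qf (_ : u - v + (u' - v') = u + u' - (v + v')); [lra|ring].
Qed.

Lemma qf_bound (B u v : R) : `|u| <= B -> `|v| <= B -> qf u v <= 6 * B ^+ 2.
Proof.
have B2 (x : R) : `|x| <= B -> x ^+ 2 <= B ^+ 2.
  move=> xB; rewrite -(real_normK (num_real x)) ler_sqr ?nnegrE//.
  exact: le_trans xB.
move=> /B2 uB /B2 vB; rewrite /qf.
have -> : (u - v) ^+ 2 = 2 * u ^+ 2 + 2 * v ^+ 2 - (u + v) ^+ 2 by ring.
by have := sqr_ge0 (u + v); lra.
Qed.

Definition outx (rx rv x v : R) := eta * rx - (a * (rx - x) - a * (rv - v)).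
Definition outv (rx rv x : R) := eta * rv - a * (rx - x).
Definition incx (rx rv x v : R) := eta * rx + (a * (rx - x) - a * (rv - v)).
Definition incv (rx rv x : R) := eta * rv + a * (rx - x).

Definition qnum := eta ^+ 2 - eta * a + a ^+ 2.
Definition qden := eta ^+ 2 + eta * a + a ^+ 2.

Lemma qden_gt0 : 0 < qden.
Proof. by rewrite !addr_gt0// ?exprn_gt0// mulr_gt0. Qed.

Lemma qnum_gt0 : 0 < qnum.
Proof.
have ea : 0 < eta * a by rewrite mulr_gt0.
have sq : 0 <= (eta - a) ^+ 2 by exact: sqr_ge0.
by rewrite /qnum; lra.
Qed.

Lemma qnum_lt_qden : qnum < qden.
Proof. by have : 0 < eta * a by [rewrite mulr_gt0]; rewrite /qnum /qden; lra. Qed.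

Lemma qf_out u v : qf (outx u v 0 0) (outv u v 0) = qnum * qf u v.
Proof. by rewrite /qf /outx /outv /qnum; ring. Qed.

Lemma qf_inc u v : qf (incx u v 0 0) (incv u v 0) = qden * qf u v.
Proof. by rewrite /qf /incx /incv /qden; ring. Qed.

(* The signal sent in steady state by an agent with state [(x, v)] to one with
   state [(x', v')]; there [r] is the mean of the two states. *)
Definition steadyx (x v x' v' : R) := outx ((x + x') / 2) ((v + v') / 2) x v.
Definition steadyv (x v x' v' : R) := outv ((x + x') / 2) ((v + v') / 2) x.

Lemma outx_split rx rv x v x' v' :
  outx rx rv x v = outx (rx - (x + x') / 2) (rv - (v + v') / 2) 0 0 + steadyx x v x' v'.
Proof. by rewrite /steadyx /outx; ring. Qed.

Lemma outv_split rx rv x v x' v' :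
  outv rx rv x = outv (rx - (x + x') / 2) (rv - (v + v') / 2) 0 + steadyv x v x' v'.
Proof. by rewrite /steadyv /outv; ring. Qed.

Lemma incx_split rx rv x v x' v' :
  incx rx rv x v = incx (rx - (x + x') / 2) (rv - (v + v') / 2) 0 0 + steadyx x' v' x v.
Proof. by rewrite /steadyx /outx /incx; field. Qed.

Lemma incv_split rx rv x v x' v' :
  incv rx rv x = incv (rx - (x + x') / 2) (rv - (v + v') / 2) 0 + steadyv x' v' x v.
Proof. by rewrite /steadyv /outv /incv; field. Qed.

(** Cramer's rule: [qden] is also the determinant of [eta + E]. *)
Lemma inc_inv u v : u = (eta * incx u v 0 0 + a * incv u v 0) / qden /\
  v = ((a + eta) * incv u v 0 - a * incx u v 0 0) / qden.
Proof.
have := gt_eqF qden_gt0; rewrite /qden /incx /incv => h.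
by split; field; rewrite h.
Qed.

(** The midpoint of the reflection factor [qnum / qden] and 1: the margin pays for separating a
    disturbance by Young's inequality, and [leak] is the resulting weight of the disturbance. *)
Definition theta := (1 + qnum / qden) / 2.
Definition leak := (1 + (2 * qnum) / (qden - qnum)) / qden.

Lemma theta_bounds : 0 <= theta < 1.
Proof.
have h : 0 <= qnum / qden < 1.
  by rewrite divr_ge0 ?ltW ?qnum_gt0 ?qden_gt0//= ltr_pdivrMr ?qden_gt0// mul1r qnum_lt_qden.
by rewrite /theta; lra.
Qed.

Lemma leak_ge0 : 0 <= leak.
Proof.
have := qnum_gt0; have := qden_gt0; have := qnum_lt_qden => h1 h2 h3.
have d0 : 0 < qden - qnum by rewrite subr_gt0.
rewrite /leak divr_ge0// ?(ltW h2)// addr_ge0// divr_ge0// ?(ltW d0)//.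
by rewrite mulr_ge0// ltW.
Qed.

Lemma reflect_le (ux uv wx wv dx dv : R) :
  incx ux uv 0 0 = outx wx wv 0 0 + dx -> incv ux uv 0 = outv wx wv 0 + dv ->
  qf ux uv <= theta * qf wx wv + leak * qf dx dv.
Proof.
move=> ex ev; have := qnum_gt0; have P := qden_gt0; have := qnum_lt_qden => h1 h3.
(* The weight for which [(1 + e) * qnum / qden] equals [theta]. *)
pose e := (qden - qnum) / (2 * qnum).
have e0 : 0 < e by rewrite divr_gt0//; lra.
rewrite -(ler_pM2l P) -qf_inc ex ev (le_trans (qfD_le _ _ _ _ e0))// qf_out.
rewrite le_eqVlt; apply/orP; left; apply/eqP; rewrite /e /theta /leak.
by field; rewrite ?(gt_eqF P) ?(gt_eqF h3)//=; apply/andP; split; rewrite ?subr_eq0 ?gt_eqF.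
Qed.

End Channel.

(** * One coordinate of a channel with delays *)

Section Link.
Variable R : realType.
Variables (a eta : R).
Hypotheses (a0 : 0 < a) (eta0 : 0 < eta).

Definition delayed (T : R) (u : R -> R) (t : R) : R := if t < T then 0 else u (t - T).

Definition link (T : R) (x1 v1 r1x r1v x2 v2 r2x r2v : R -> R) := forall t : R, 0 <= t ->
  incx a eta (r1x t) (r1v t) (x1 t) (v1 t) =
    delayed T (fun s => outx a eta (r2x s) (r2v s) (x2 s) (v2 s)) t /\
  incv a eta (r1x t) (r1v t) (x1 t) =
    delayed T (fun s => outv a eta (r2x s) (r2v s) (x2 s)) t.

Let errx (x1 x2 r1x : R -> R) (t : R) : R := r1x t - (x1 t + x2 t) / 2.
Let drift (T : R) (s : R -> R) (t : R) : R := delayed T s t - s t.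
Let stx (x1 v1 x2 v2 : R -> R) (t : R) : R := steadyx a eta (x1 t) (v1 t) (x2 t) (v2 t).
Let stv (x1 v1 x2 v2 : R -> R) (t : R) : R := steadyv a eta (x1 t) (v1 t) (x2 t) (v2 t).

(** Removing the steady signals of the current states leaves the same linear reflection for the
    deviation of [r] from the mean, disturbed only by the change of the steady signal during the
    delay. Before the first arrival the delayed steady signal counts as zero. *)
Lemma link_err (T : R) (x1 v1 r1x r1v x2 v2 r2x r2v : R -> R) :
  link T x1 v1 r1x r1v x2 v2 r2x r2v -> forall t : R, 0 <= t ->
  incx a eta (errx x1 x2 r1x t) (errx v1 v2 r1v t) 0 0 =
    delayed T (fun s => outx a eta (errx x2 x1 r2x s) (errx v2 v1 r2v s) 0 0) t
    + drift T (stx x2 v2 x1 v1) t /\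
  incv a eta (errx x1 x2 r1x t) (errx v1 v2 r1v t) 0 =
    delayed T (fun s => outv a eta (errx x2 x1 r2x s) (errx v2 v1 r2v s) 0) t
    + drift T (stv x2 v2 x1 v1) t.
Proof.
move=> L t t0; have [] := L t t0.
rewrite (incx_split _ _ _ _ _ _ (x2 t) (v2 t)) (incv_split _ _ _ _ _ (v1 t) (x2 t) (v2 t)).
rewrite /drift /stx /stv /errx /delayed; case: ifP => _.
  by rewrite !add0r => /eqP; rewrite addr_eq0 => /eqP -> /eqP; rewrite addr_eq0 => /eqP ->.
set s := t - T.
rewrite (outx_split _ _ _ _ _ _ (x1 s) (v1 s)) (outv_split _ _ _ _ _ (v2 s) (x1 s) (v1 s)).
by move=> /eqP; rewrite -subr_eq => /eqP <- /eqP; rewrite -subr_eq => /eqP <-; split; ring.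
Qed.

Lemma link_step (T : R) (x1 v1 r1x r1v x2 v2 r2x r2v : R -> R) :
  link T x1 v1 r1x r1v x2 v2 r2x r2v -> forall t : R, 0 <= t ->
  qf (errx x1 x2 r1x t) (errx v1 v2 r1v t) <=
   theta a eta * delayed T (fun s => qf (errx x2 x1 r2x s) (errx v2 v1 r2v s)) t +
   leak a eta * qf (drift T (stx x2 v2 x1 v1) t) (drift T (stv x2 v2 x1 v1) t).
Proof.
move=> L t t0; have [] := link_err L t0; rewrite /delayed; case: ifP => _ ex ev.
  rewrite mulr0 add0r; apply: le_trans (reflect_le a0 eta0 (wx := 0) (wv := 0) _ _) _.
  - by rewrite ex /outx !(subr0, mulr0).
  - by rewrite ev /outv !(subr0, mulr0).
  - by rewrite /qf !(subr0, mulr0, expr0n, addr0) /= add0r.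
exact: reflect_le.
Qed.

Section TwoWay.
Variables (T12 T21 : R) (x1 v1 r1x r1v x2 v2 r2x r2v : R -> R).
Hypotheses (T12_ge0 : 0 <= T12) (T21_ge0 : 0 <= T21).
Hypothesis L1 : link T21 x1 v1 r1x r1v x2 v2 r2x r2v.
Hypothesis L2 : link T12 x2 v2 r2x r2v x1 v1 r1x r1v.

Let A t := qf (errx x1 x2 r1x t) (errx v1 v2 r1v t).
Let c1 t := leak a eta * qf (drift T21 (stx x2 v2 x1 v1) t) (drift T21 (stv x2 v2 x1 v1) t).
Let c2 t := leak a eta * qf (drift T12 (stx x1 v1 x2 v2) t) (drift T12 (stv x1 v1 x2 v2) t).
Let th := theta a eta.
Let T := T12 + T21.

Let th_bounds : 0 <= th < 1. Proof. exact: theta_bounds. Qed.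
Let th2_bounds : 0 <= th ^+ 2 < 1.
Proof.
have /andP[h0 h1] := th_bounds.
by rewrite sqr_ge0 expr2 (le_lt_trans _ h1)// ler_piMl// ltW.
Qed.

(** One reflection bounds the error at one end by the error at the other; the recursion closes after
    two, hence [th ^+ 2] and the total delay. *)
Let round_trip t : 0 <= t ->
  A t <= th ^+ 2 * delayed T A t + (th * delayed T21 c2 t + c1 t).
Proof.
move=> t0; have /andP[h0 h1] := th_bounds.
apply: le_trans (link_step L1 t0) _; rewrite addrA lerD2r.
rewrite expr2 -mulrA -mulrDr ler_wpM2l// {1 3}/delayed.
have [tT|Tt] := ltP t T21.
  have tT' : t < T by rewrite (lt_le_trans tT)// lerDr.
  by rewrite /delayed tT' mulr0 addr0.
have s0 : 0 <= t - T21 by rewrite subr_ge0.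
apply: le_trans (link_step L2 s0) _.
rewrite /delayed ltrBlDr -/T; case: ifP => // _.
by rewrite -addrA -opprD [T21 + _]addrC.
Qed.

(** [K] is chosen before [b], so the lemma serves both on compact intervals and, once the states are
    bounded, for all times. *)
Lemma link_bound (B : R) : 0 <= B -> exists K : R, forall b : R,
  (forall t, 0 <= t <= b ->
     [/\ `|x1 t| <= B, `|v1 t| <= B, `|x2 t| <= B & `|v2 t| <= B]) ->
  forall t, 0 <= t <= b -> `|r1x t| <= K /\ `|r1v t| <= K.
Proof.
move=> B0; have /andP[h0 h1] := th_bounds; have lk := leak_ge0 a0 eta0.
(* Bounds both components of a steady signal when the states are at most [B]; a drift is then at
   most [2 * S]. *)
pose S := (eta + 4 * a) * B.
pose C := th * (leak a eta * (6 * (2 * S) ^+ 2)) + leak a eta * (6 * (2 * S) ^+ 2).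
pose Q := C / (1 - th ^+ 2).
have M0 : 0 <= leak a eta * (6 * (2 * S) ^+ 2).
  by rewrite mulr_ge0// mulr_ge0// sqr_ge0.
have C0 : 0 <= C by rewrite addr_ge0// mulr_ge0.
exists (Q + 1 + B) => b bd t tb.
have steady (y w y' w' : R) : `|y| <= B -> `|w| <= B -> `|y'| <= B -> `|w'| <= B ->
    `|steadyx a eta y w y' w'| <= S /\ `|steadyv a eta y w y' w'| <= S.
  rewrite !ler_norml /steadyx /steadyv /outx /outv /S => /andP[? ?] /andP[? ?] /andP[? ?] /andP[? ?].
  have prod (k z : R) : 0 < k -> - B <= z <= B -> - (k * B) <= k * z <= k * B.
    move=> k0 /andP[zl zu]; rewrite -mulrN !ler_pM2l// zl zu//.
  have /andP[? ?] : - (eta * B) <= eta * ((y + y') / 2) <= eta * B by apply: prod => //; lra.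
  have /andP[? ?] : - (eta * B) <= eta * ((w + w') / 2) <= eta * B by apply: prod => //; lra.
  have /andP[? ?] : - (a * B) <= a * ((y + y') / 2 - y) <= a * B by apply: prod => //; lra.
  have /andP[? ?] : - (a * B) <= a * ((w + w') / 2 - w) <= a * B by apply: prod => //; lra.
  have aB : 0 <= a * B by rewrite mulr_ge0// ltW.
  by rewrite mulrDl; split; apply/andP; split; lra.
have S0 : 0 <= S by rewrite mulr_ge0// addr_ge0 ?ltW// mulr_gt0.
have dr (T' : R) (s : R -> R) (r : R) : 0 <= T' -> 0 <= r <= b -> (forall r : R, 0 <= r <= b -> `|s r| <= S) ->
    `|drift T' s r| <= 2 * S.
  move=> T'0 /andP[r0 rb] sS; rewrite /drift /delayed; case: ltP => rT.
    by rewrite sub0r normrN (le_trans (sS _ _)) ?r0//; lra.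
  rewrite (le_trans (ler_normB _ _))// mulrDl mul1r lerD// sS ?r0//.
  by apply/andP; split; lra.
have cb1 (r : R) : 0 <= r <= b -> c1 r <= leak a eta * (6 * (2 * S) ^+ 2).
  move=> rb; rewrite ler_wpM2l// qf_bound// dr// => r' r'b; have [? ? ? ?] := bd r' r'b.
    by have [] := steady (x2 r') (v2 r') (x1 r') (v1 r').
  by have [] := steady (x2 r') (v2 r') (x1 r') (v1 r').
have cb2 (r : R) : 0 <= r <= b -> c2 r <= leak a eta * (6 * (2 * S) ^+ 2).
  move=> rb; rewrite ler_wpM2l// qf_bound// dr// => r' r'b; have [? ? ? ?] := bd r' r'b.
    by have [] := steady (x1 r') (v1 r') (x2 r') (v2 r').
  by have [] := steady (x1 r') (v1 r') (x2 r') (v2 r').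
have AQ : A t <= Q.
  apply: (@contraction_bound _ A T (th ^+ 2) C b) tb => //; first exact: addr_ge0.
  move=> r /[dup] rb /andP[r0 rb']; apply: le_trans (round_trip r0) _.
  rewrite lerD2l /C lerD ?cb1// ler_wpM2l// /delayed; case: ltP => rT.
    by [].
  by apply: cb2; rewrite subr_ge0 rT lerBlDr (le_trans rb')// lerDl.
have [x1B v1B x2B v2B] := bd t tb.
(* The inequality [|d| <= d ^+ 2 + 1] avoids a square root. *)
have root (q u y y' : R) : (u - (y + y') / 2) ^+ 2 <= q -> `|y| <= B -> `|y'| <= B ->
    `|u| <= q + 1 + B.
  set d := u - _ => dQ; rewrite !ler_norml => /andP[? ?] /andP[? ?].
  have d1 : 0 <= (d - 1) ^+ 2 by exact: sqr_ge0.
  have d2 : 0 <= (d + 1) ^+ 2 by exact: sqr_ge0.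
  have d3 : 0 <= d ^+ 2 by exact: sqr_ge0.
  have -> : u = d + (y + y') / 2 by rewrite /d; ring.
  by clearbody d; apply/andP; split; lra.
have [sx sv] : errx x1 x2 r1x t ^+ 2 <= Q /\ errx v1 v2 r1v t ^+ 2 <= Q.
  by split; apply: le_trans AQ; rewrite /A /qf -?addrA;
    [rewrite lerDl|rewrite addrCA lerDl]; rewrite addr_ge0 ?sqr_ge0.
by split; [exact: root sx _ _|exact: root sv _ _].
Qed.

Lemma link_vanish (B : R) : 0 <= B -> (forall t, 0 <= t ->
     [/\ `|x1 t| <= B, `|v1 t| <= B, `|x2 t| <= B & `|v2 t| <= B]) ->
  slow x1 -> slow v1 -> slow x2 -> slow v2 ->
  r1x t - (x1 t + x2 t) / 2 @[t --> +oo] --> 0 /\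
  r1v t - (v1 t + v2 t) / 2 @[t --> +oo] --> 0.
Proof.
move=> B0 bd sx1 sv1 sx2 sv2; have [K KP] := link_bound B0.
have r1K t : 0 <= t -> `|r1x t| <= K /\ `|r1v t| <= K.
  move=> t0; apply: (KP t); last by rewrite t0 lexx.
  by move=> r /andP[r0 _]; exact: bd.
have AK t : 0 <= t -> 0 <= A t <= 6 * (K + B) ^+ 2.
  move=> t0; rewrite qf_ge0/=; have [? ?] := r1K t t0; have [? ? ? ?] := bd t t0.
  have avg (r y y' : R) : `|r| <= K -> `|y| <= B -> `|y'| <= B ->
      `|r - (y + y') / 2| <= K + B.
    by rewrite !ler_norml => /andP[? ?] /andP[? ?] /andP[? ?]; apply/andP; split; lra.
  by apply: qf_bound; exact: avg.
have slow_stx (y w y' w' : R -> R) : slow y -> slow w -> slow y' -> slow w' ->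
    slow (stx y w y' w').
  move=> sy sw sy' sw'.
  apply: eq_slow (slowD (slowD (slowZ ((eta + a) / 2) sy) (slowZ ((eta - a) / 2) sy'))
    (slowD (slowZ (- (a / 2)) sw) (slowZ (a / 2) sw'))) => t.
  by rewrite /stx /steadyx /outx; field.
have slow_stv (y w y' w' : R -> R) : slow y -> slow w -> slow y' -> slow w' ->
    slow (stv y w y' w').
  move=> sy sw sy' sw'.
  apply: eq_slow (slowD (slowD (slowZ (a / 2) sy) (slowZ (- (a / 2)) sy'))
    (slowD (slowZ (eta / 2) sw) (slowZ (eta / 2) sw'))) => t.
  by rewrite /stv /steadyv /outv; field.
have late_eq (u w : R -> R) (T0 : R) : (forall t, T0 <= t -> u t = w t) ->
    w t @[t --> +oo] --> 0 -> u t @[t --> +oo] --> 0.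
  move=> uw; apply: cvg_trans; apply: near_eq_cvg.
  by apply: filterS (near_ge T0) => t /uw ->.
have drift0 (T' : R) (u : R -> R) : 0 <= T' -> slow u -> drift T' u t @[t --> +oo] --> 0.
  move=> T'0 su; apply: (late_eq _ _ T') (slow_shift T'0 su) => t Tt.
  by rewrite /drift /delayed ltNge Tt.
have qf0 (u w : R -> R) : u t @[t --> +oo] --> 0 -> w t @[t --> +oo] --> 0 ->
    leak a eta * qf (u t) (w t) @[t --> +oo] --> 0.
  move=> u0 w0; apply: vanishZ.
  have sq (y : R -> R) : y t @[t --> +oo] --> 0 -> y t ^+ 2 @[t --> +oo] --> 0.
    move=> y0; apply: (@eq_vanish _ (fun t => y t * y t)) => [t|].
      by rewrite expr2.
    have := cvgM y0 y0; rewrite mulr0; exact.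
  by apply: vanishD; [apply: vanishD; exact: sq|apply: sq; exact: vanishB].
have c10 : c1 t @[t --> +oo] --> 0.
  by apply: qf0; apply: drift0 => //; [exact: slow_stx|exact: slow_stv].
have c20 : c2 t @[t --> +oo] --> 0.
  by apply: qf0; apply: drift0 => //; [exact: slow_stx|exact: slow_stv].
have dc20 : delayed T21 c2 t @[t --> +oo] --> 0.
  apply: (late_eq _ (fun t => c2 (t - T21)) T21) => [t Tt|].
    by rewrite /delayed ltNge Tt.
  apply/vanishP => e e0; move/vanishP : c20 => /(_ e e0)/(near_tail T21).
  by apply: filterS => t; apply.
have A0 : A t @[t --> +oo] --> 0.
  apply: (@contraction_vanish _ A (fun t => th * delayed T21 c2 t + c1 t) T (th ^+ 2) _ _ th2_bounds AK).
  - exact: addr_ge0.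
  - move=> t Tt; have t0 : 0 <= t by rewrite (le_trans _ Tt)// addr_ge0.
    by have := round_trip t0; rewrite {1}/delayed ltNge Tt.
  - by apply: vanishD => //; exact: vanishZ.
have root (u : R -> R) : (forall t, u t ^+ 2 <= A t) -> u t @[t --> +oo] --> 0.
  move=> uA; apply/vanishP => e e0; move/vanishP : A0 => /(_ _ (exprn_gt0 2 e0)).
  apply: filterS => t /(le_trans (ler_norm _))/(le_trans (uA t)).
  by rewrite -(real_normK (num_real (u t))) ler_sqr ?nnegrE// ltW.
by split; apply: root => t; rewrite /A /qf -?addrA;
    [rewrite lerDl|rewrite addrCA lerDl]; rewrite addr_ge0 ?sqr_ge0.
Qed.

Lemma pcont_eq (b : R) (u w : R -> R) : (forall t, 0 < t -> u t = w t) ->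
  pcont b u -> pcont b w.
Proof.
move=> uw [D cu]; exists D => t /[dup] tb /andP[t0 _] tD.
rewrite /prop_for /continuous_at -uw//; apply: cvg_trans (cu t tb tD).
apply: near_eq_cvg; near=> s; apply: uw.
by near: s; exact: lt_nbhsr.
Unshelve. all: by end_near. Qed.

(** Method of steps: piecewise continuity of what is sent passes to what is received one delay
    later, and [inc_inv] recovers the error of [r] from it. Each round trip extends the interval by
    [T], starting from the empty one. *)
Lemma link_pcont (b : R) :
  (forall t, 0 < t -> {for t, continuous x1}) ->
  (forall t, 0 < t -> {for t, continuous v1}) ->
  (forall t, 0 < t -> {for t, continuous x2}) ->
  (forall t, 0 < t -> {for t, continuous v2}) ->
  pcont b r1x /\ pcont b r1v.
Proof.
move=> /pcont_continuous px1 /pcont_continuous pv1 /pcont_continuous px2 /pcont_continuous pv2.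
have pZ (c b' : R) u : pcont b' u -> pcont b' (fun t => c * u t).
  by apply: pcontM; exact: pcont_cst.
have pavg (b' : R) (y y' : R -> R) : pcont b' y -> pcont b' y' ->
    pcont b' (fun t => (y t + y' t) / 2).
  by move=> py py'; apply: pcontM (pcont_cst _ _); exact: pcontD.
have perr (b' : R) (r y y' : R -> R) : pcont b' y -> pcont b' y' ->
    pcont b' (errx y y' r) -> pcont b' r.
  move=> py py' pe; apply: eq_pcont (pcontD pe (pavg _ _ _ py py')) => t.
  by rewrite /errx subrK.
suff [] : pcont b (errx x1 x2 r1x) /\ pcont b (errx v1 v2 r1v).
  by move=> px pv; split; [exact: perr px|exact: perr pv].
have pstx (b' : R) (y w y' w' : R -> R) : pcont b' y -> pcont b' w -> pcont b' y' -> pcont b' w' ->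
    pcont b' (stx y w y' w').
  move=> py pw py' pw'; apply: pcontB; first by apply: pZ; exact: pavg.
  by apply: pcontB; apply: pZ; apply: pcontB => //; exact: pavg.
have pstv (b' : R) (y w y' w' : R -> R) : pcont b' y -> pcont b' w -> pcont b' y' -> pcont b' w' ->
    pcont b' (stv y w y' w').
  move=> py pw py' pw'; apply: pcontB; first by apply: pZ; exact: pavg.
  by apply: pZ; apply: pcontB => //; exact: pavg.
have step (b' T' : R) (y1 w1 q1x q1v y2 w2 q2x q2v : R -> R) : 0 <= T' ->
    (forall b, pcont b y1) -> (forall b, pcont b w1) ->
    (forall b, pcont b y2) -> (forall b, pcont b w2) ->
    link T' y1 w1 q1x q1v y2 w2 q2x q2v ->
    pcont b' (errx y2 y1 q2x) -> pcont b' (errx w2 w1 q2v) ->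
    pcont (b' + T') (errx y1 y2 q1x) /\ pcont (b' + T') (errx w1 w2 q1v).
  move=> T'0 py1 pw1 py2 pw2 L pe2 pf2.
  have bb : b' <= b' + T' by rewrite lerDl.
  have pdx : pcont (b' + T') (drift T' (stx y2 w2 y1 w1)).
    by apply: pcontB; [apply: pcont_delay|]; exact: pstx.
  have pdv : pcont (b' + T') (drift T' (stv y2 w2 y1 w1)).
    by apply: pcontB; [apply: pcont_delay|]; exact: pstv.
  have pox : pcont (b' + T') (fun t => incx a eta (errx y1 y2 q1x t) (errx w1 w2 q1v t) 0 0).
    apply: pcont_eq (pcontD _ pdx) => [t t0|].
      by have [-> _] := link_err L (ltW t0); reflexivity.
    apply: pcont_delay; apply: pcontB; first exact: pZ.
    by apply: pcontB; apply: pZ; apply: pcontB => //; exact: pcont_cst.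
  have pov : pcont (b' + T') (fun t => incv a eta (errx y1 y2 q1x t) (errx w1 w2 q1v t) 0).
    apply: pcont_eq (pcontD _ pdv) => [t t0|].
      by have [_ ->] := link_err L (ltW t0); reflexivity.
    apply: pcont_delay; apply: pcontB; first exact: pZ.
    by apply: pZ; apply: pcontB => //; exact: pcont_cst.
  split.
    apply: eq_pcont (pcontM (pcontD (pZ eta _ _ pox) (pZ a _ _ pov)) (pcont_cst _ (qden a eta)^-1)) => t.
    by rewrite -(inc_inv a0 eta0 _ _).1.
  apply: eq_pcont (pcontM (pcontB (pZ (a + eta) _ _ pov) (pZ a _ _ pox)) (pcont_cst _ (qden a eta)^-1)) => t.
  by rewrite -(inc_inv a0 eta0 _ _).2.
have : 0 <= T by exact: addr_ge0.
rewrite le_eqVlt => /predU1P[T0|T0]; last first.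
  have [k bk] : exists k : nat, b <= T *+ k.
    exists (Num.bound `|b / T|); rewrite -mulr_natr -ler_pdivrMl// mulrC.
    by rewrite (le_trans (ler_norm _))// ltW// archi_boundP.
  suff [] : pcont (T *+ k) (errx x1 x2 r1x) /\ pcont (T *+ k) (errx v1 v2 r1v).
    by move=> ? ?; split; exact: pcont_sub bk _.
  elim: k {bk} => [|k [IHx IHv]].
    by rewrite mulr0n; split; exists [::] => t /andP[t0 /(lt_trans t0)]; rewrite ltxx.
  have [p2x p2v] := step _ _ _ _ _ _ _ _ _ _ T12_ge0 px2 pv2 px1 pv1 L2 IHx IHv.
  have := step _ _ _ _ _ _ _ _ _ _ T21_ge0 px1 pv1 px2 pv2 L1 p2x p2v.
  by rewrite -addrA mulrSr.
(* Without delay there is no step to make: the channel is an algebraic loop, and the contraction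
   with zero drift makes the errors vanish identically. *)
have T12E : T12 = 0 by have := T12_ge0; have := T21_ge0; move: T0; rewrite /T; lra.
have T21E : T21 = 0 by have := T12_ge0; have := T21_ge0; move: T0; rewrite /T; lra.
have A0 t : 0 <= t -> A t <= 0.
  move=> t0; have : A t <= 0 / (1 - th ^+ 2).
    apply: (@contraction_bound _ A 0 (th ^+ 2) 0 t) => //; last by rewrite t0 lexx.
    move=> r /andP[r0 _]; have := round_trip r0.
    rewrite /c1 /c2 /drift /delayed -T0 T12E T21E ltNge r0/= !subr0.
    by rewrite ltNge r0/= !subrr /qf subrr expr0n/= !addr0 !mulr0 !addr0.
  by rewrite mul0r.
have sq0 (u : R) : u ^+ 2 <= 0 -> 0 = u.
  by move=> u2; apply/esym/eqP; rewrite -sqrf_eq0 eq_le u2 sqr_ge0.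
split; apply: pcont_eq (pcont_cst _ 0) => t t0; apply: sq0;
  apply: le_trans (A0 t (ltW t0)); rewrite /A /qf -?addrA;
  [rewrite lerDl|rewrite addrCA lerDl]; by rewrite addr_ge0 ?sqr_ge0.
Qed.

End TwoWay.
End Link.

(** * Compactness *)

Section FiniteDimension.
Variable R : realType.

Lemma cvg_mx_coord (T : Type) (F : set_system T) (FF : Filter F) (p q : nat)
    (u : T -> 'M[R]_(p, q)) (l : 'M[R]_(p, q)) :
  (forall i j, u t i j @[t --> F] --> l i j) -> u t @[t --> F] --> l.
Proof.
move=> ul; apply/cvgrPdist_le => /= e e0; near=> t.
rewrite /Num.Def.normr/= mx_normrE (bigmax_le _ (ltW e0))//= => i _.
rewrite !mxE/=; move: i; near: t; apply: filter_forall => /= i.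
exact: ((cvgrPdist_le _ _).1 (ul i.1 i.2)).
Unshelve. all: by end_near. Qed.

Lemma cvg_coord (T : Type) (F : set_system T) (FF : Filter F) (p q : nat)
    (u : T -> 'M[R]_(p, q)) (l : 'M[R]_(p, q)) i j :
  u t @[t --> F] --> l -> u t i j @[t --> F] --> l i j.
Proof.
move=> ul; apply: (@cvg_comp _ _ _ u (fun M : 'M[R]_(p, q) => M i j) F _ _ ul).
exact: coord_continuous.
Qed.

Lemma cvg_rsum (T : Type) (F : set_system T) (FF : Filter F) (I : Type)
    (r : seq I) (P : pred I) (u : I -> T -> R) (l : I -> R) :
  (forall i, P i -> u i t @[t --> F] --> l i) ->
  \sum_(i <- r | P i) u i t @[t --> F] --> \sum_(i <- r | P i) l i.
Proof.
move=> ul; elim: r => [|i r IH].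
  rewrite big_nil (_ : (fun t => _) = fun=> 0); first exact: cvg_cst.
  by apply/funext => t; rewrite big_nil.
rewrite big_cons; have [Pi|Pi] := boolP (P i).
  rewrite (_ : (fun t => _) = fun t => u i t + \sum_(i <- r | P i) u i t).
    by apply: cvgD => //; exact: ul.
  by apply/funext => t; rewrite big_cons Pi.
rewrite (_ : (fun t => _) = fun t => \sum_(i <- r | P i) u i t)//.
by apply/funext => t; rewrite big_cons (negbTE Pi).
Qed.

(** Of a subsequence only [q <= s q] is kept, which makes [s] tend to infinity. *)
Lemma bolzano_weierstrass (I : finType) (y : nat -> I -> R) (B : R) :
  (forall q i, `|y q i| <= B) ->
  exists (e : I -> R) (s : nat -> nat), (forall q, (q <= s q)%N) /\
    forall i, y (s q) i @[q --> \oo] --> e i.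
Proof.
move=> yB; pose Y q : 'rV[R]_#|I| := \row_k y q (enum_val k).
pose K := [set v : 'rV[R]_#|I| | forall k, `[- B, B]%classic (v ord0 k)].
have cK : compact K by apply: (@rV_compact _ _ (fun=> `[- B, B]%classic)) => k; exact: segment_compact.
have FK : (Y @ \oo) K.
  by exists 0%N => // q _ k /=; rewrite mxE in_itv/= -ler_norml; exact: yB.
have [e [_ cl]] := cK (Y @ \oo) _ FK.
have ex q : exists p, (q <= p)%N /\ `|e - Y p| < q.+1%:R^-1.
  have [||_ [[p /= qp <-] ep]] := cl [set Y p | p in [set p | (q <= p)%N]]
    (ball e q.+1%:R^-1).
  - by exists q => // p /= qp; exists p.
  - have q0 : 0 < q.+1%:R^-1 :> R by rewrite invr_gt0.
    exact: nbhsx_ballx.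
  by exists p; split => //; move: ep; rewrite -ball_normE.
have [s sP] := choice ex.
exists (fun i => e ord0 (enum_rank i)), s; split=> [q|i]; first exact: (sP q).1.
have -> : (fun q => y (s q) i) = (fun q => Y (s q) ord0 (enum_rank i)).
  by apply/funext => q; rewrite mxE enum_rankK.
apply: cvg_coord; apply/cvgrPdist_lt => d d0; near=> q.
apply: lt_trans (sP q).2 _; near: q; exact: near_infty_natSinv_lt (PosNum d0).
Unshelve. all: by end_near. Qed.

Variable n : nat.
Implicit Types (phi : 'cV[R]_n -> R) (x y : 'cV[R]_n) (X : R -> 'cV[R]_n).

Definition in_box (B : R) x := forall j, `|x j 0| <= B.

Lemma box_subsequence (x : nat -> 'cV[R]_n) (B : R) :
  (forall q, in_box B (x q)) -> exists (e : 'cV[R]_n) (s : nat -> nat),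
    (forall q, (q <= s q)%N) /\ x (s q) @[q --> \oo] --> e.
Proof.
move=> xB; have [e [s [sq es]]] := @bolzano_weierstrass _ (fun q j => x q j 0) B xB.
exists (\col_j e j), s; split => //; apply: cvg_mx_coord => i j.
by rewrite mxE ord1; exact: es.
Qed.

Lemma box_bounded phi (B : R) : continuous phi ->
  exists K, forall x, in_box B x -> `|phi x| <= K.
Proof.
move=> cphi; apply: contrapT => nK.
have ex (q : nat) : exists x, in_box B x /\ q%:R < `|phi x|.
  apply: contrapT => nx; apply: nK; exists q%:R => x xB.
  by rewrite leNgt; apply/negP => qx; apply: nx; exists x.
have [x xP] := choice ex.
have [e [s [sq es]]] := box_subsequence (fun q => (xP q).1).
have : phi (x (s q)) @[q --> \oo] --> phi e by apply: (cvg_comp _ _ es); exact: cphi.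
move=> /cvgrPdist_le/(_ 1 ltr01) near1.
have : \forall q \near \oo, `|phi e| + 1 < q%:R :> R.
  exists (Num.bound (`|phi e| + 1)) => // q /= qb.
  by apply: lt_le_trans (archi_boundP _) _; rewrite ?addr_ge0// ler_nat.
move=> /(filterI near1) /filter_ex[q [/= h1 h2]].
have h3 : q%:R < `|phi (x (s q))|.
  by apply: le_lt_trans (xP (s q)).2; rewrite ler_nat.
have : `|phi (x (s q))| <= `|phi e| + 1.
  have -> : phi (x (s q)) = phi e - (phi e - phi (x (s q))) by ring.
  by rewrite (le_trans (ler_normB _ _))// lerD2l.
by move=> h4; have := lt_trans (lt_le_trans h3 h4) h2; rewrite ltxx.
Qed.

Lemma box_unif_continuous phi (B e : R) : continuous phi -> 0 < e ->
  exists2 d, 0 < d & forall x y, in_box B x -> in_box B y ->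
    (forall j, `|x j 0 - y j 0| <= d) -> `|phi x - phi y| <= e.
Proof.
move=> cphi e0; apply: contrapT => nd.
have ex (q : nat) : exists xy : 'cV[R]_n * 'cV[R]_n,
    [/\ in_box B xy.1, forall j, `|xy.1 j 0 - xy.2 j 0| <= q.+1%:R^-1 &
      e < `|phi xy.1 - phi xy.2|].
  apply: contrapT => nx; apply: nd; exists q.+1%:R^-1; first by rewrite invr_gt0.
  move=> x y xB yB xy; rewrite leNgt; apply/negP => exy.
  by apply: nx; exists (x, y).
have [xy xyP] := choice ex.
have bx q : in_box B (xy q).1 by have [] := xyP q.
have [l [s [sq ls]]] := box_subsequence bx.
have ls2 : (xy (s q)).2 @[q --> \oo] --> l.
  apply: cvg_mx_coord => i j; rewrite ord1.
  have -> : (fun q => (xy (s q)).2 i 0) =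
      (fun q => (xy (s q)).1 i 0 - ((xy (s q)).1 i 0 - (xy (s q)).2 i 0)).
    by apply/funext => q; ring.
  rewrite -[X in _ --> X]subr0; apply: cvgB; first exact: cvg_coord.
  apply/cvgr0Pnorm_lt => d d0; near=> q.
  have [_ /(_ i) h _] := xyP (s q); apply: le_lt_trans h _.
  apply: (@le_lt_trans _ _ q.+1%:R^-1).
    by rewrite lef_pV2 ?posrE// ler_nat ltnS.
  near: q; exact: near_infty_natSinv_lt (PosNum d0).
have h1 : phi (xy (s q)).1 @[q --> \oo] --> phi l.
  by apply: (cvg_comp _ _ ls); exact: cphi.
have h2 : phi (xy (s q)).2 @[q --> \oo] --> phi l.
  by apply: (cvg_comp _ _ ls2); exact: cphi.
have : phi (xy (s q)).1 - phi (xy (s q)).2 @[q --> \oo] --> 0.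
  by rewrite -(subrr (phi l)); exact: cvgB.
move=> /cvgr0Pnorm_le/(_ e e0)/filter_ex[q].
by rewrite leNgt; have [_ _ ->] := xyP (s q).
Unshelve. all: by end_near. Qed.

Lemma slow_comp phi X (B : R) : continuous phi ->
  (\forall t \near +oo, in_box B (X t)) ->
  (forall j, slow (fun t => X t j 0)) -> slow (fun t => phi (X t)).
Proof.
move=> cphi XB sX H e e0.
have [d d0 dP] := @box_unif_continuous phi B e cphi e0.
have : \forall t \near +oo, forall j h, 0 <= h <= H -> `|X (t + h) j 0 - X t j 0| <= d.
  by apply: filter_forall => j; exact: sX.
apply: filterS2 (near_tail 0 XB) => t XBt Xt h /[dup] hH /andP[h0 _].
apply: dP => [||j]; [apply: XBt; lra|apply: XBt; lra|exact: Xt].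
Qed.

End FiniteDimension.

(** * Convexity and multipliers *)

Section Farkas.
Variable R : realType.

Definition pairing (I : finType) (u v : I -> R) := \sum_i u i * v i.

Lemma pairingDr (I : finType) (u v w : I -> R) :
  pairing u (fun i => v i + w i) = pairing u v + pairing u w.
Proof. by rewrite -big_split/=; apply: eq_bigr => i _; rewrite mulrDr. Qed.

Lemma pairingZr (I : finType) (u v : I -> R) (k : R) :
  pairing u (fun i => k * v i) = k * pairing u v.
Proof. by rewrite mulr_sumr; apply: eq_bigr => i _; rewrite mulrCA. Qed.

Lemma pairingBl (I : finType) (u v w : I -> R) (k : R) :
  pairing (fun i => u i - k * v i) w = pairing u w - k * pairing v w.
Proof.
rewrite mulr_sumr -sumrB; apply: eq_bigr => i _.
by rewrite mulrBl mulrA.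
Qed.

(* Induction on the number of generators: if [c] is not a consequence of all
   generators but [alpha_0], there is [y] with [alpha_0 y = 1] on which the
   others are nonpositive and [c] is positive; subtract from every form its
   value at [y] times [alpha_0]. *)
Lemma farkas_ord (I : finType) (p : nat) (alpha : 'I_p -> I -> R) (c : I -> R) :
  (forall x, (forall k, pairing (alpha k) x <= 0) -> pairing c x <= 0) ->
  exists2 l : 'I_p -> R, forall k, 0 <= l k &
    forall i, c i = \sum_k l k * alpha k i.
Proof.
elim: p alpha c => [|p IH] alpha c imp.
  exists (fun=> 0) => // i; rewrite big_ord0.
  (* Without generators every vector is admissible, in particular [c] itself. *)
  have := imp c (fun k => match k with Ordinal _ h => ltac:(done) end).
  move=> cc; have : pairing c c == 0.
    by rewrite eq_le cc/= sumr_ge0// => k _; rewrite -expr2 sqr_ge0.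
  rewrite psumr_eq0 => [/allP/(_ i)|k _]; last by rewrite -expr2 sqr_ge0.
  by rewrite mem_index_enum => /(_ isT)/implyP/(_ isT); rewrite mulf_eq0 orbb => /eqP.
have [imp'|nimp] := pselect (forall x,
    (forall k, pairing (alpha (lift ord0 k)) x <= 0) -> pairing c x <= 0).
  have [l l0 lc] := IH _ _ imp'.
  exists (fun k => if unlift ord0 k is Some k' then l k' else 0).
    by move=> k; case: unlift.
  move=> i; rewrite big_ord_recl unlift_none mul0r add0r lc.
  by apply: eq_bigr => k _; rewrite liftK.
have [x [x1 x2]] : exists x, (forall k, pairing (alpha (lift ord0 k)) x <= 0) /\ 0 < pairing c x.
  apply: contrapT => nx; apply: nimp => x xle; rewrite leNgt; apply/negP => cx.
  by apply: nx; exists x.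
have ax : 0 < pairing (alpha ord0) x.
  rewrite ltNge; apply/negP => a0; have : pairing c x <= 0.
    by apply: imp => k; have [k'|] := unliftP ord0 k => ->.
  by rewrite leNgt x2.
pose y i := (pairing (alpha ord0) x)^-1 * x i.
have ay : pairing (alpha ord0) y = 1 by rewrite pairingZr mulVf// gt_eqF.
have y1 k : pairing (alpha (lift ord0 k)) y <= 0.
  by rewrite pairingZr mulr_ge0_le0// invr_ge0 ltW.
have y2 : 0 < pairing c y by rewrite pairingZr mulr_gt0// invr_gt0.
pose beta k i := alpha (lift ord0 k) i - pairing (alpha (lift ord0 k)) y * alpha ord0 i.
pose c' i := c i - pairing c y * alpha ord0 i.
have [l l0 lc] : exists2 l : 'I_p -> R, forall k, 0 <= l k &
    forall i, c' i = \sum_k l k * beta k i.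
  apply: IH => w wle; pose w' i := w i + (- pairing (alpha ord0) w) * y i.
  have w'E u : pairing u w' = pairing u w - pairing u y * pairing (alpha ord0) w.
    by rewrite pairingDr pairingZr mulNr mulrC.
  rewrite pairingBl -w'E; apply: imp => k; rewrite w'E.
  have [k'|] := unliftP ord0 k => ->; first by have := wle k'; rewrite /beta pairingBl.
  by rewrite ay mul1r subrr.
pose l0' := pairing c y - \sum_k l k * pairing (alpha (lift ord0 k)) y.
exists (fun k => if unlift ord0 k is Some k' then l k' else l0').
  move=> k; case: unlift => [//|]; rewrite subr_ge0 (le_trans _ (ltW y2))//.
  by apply: sumr_le0 => k' _; rewrite mulr_ge0_le0.
move=> i; rewrite big_ord_recl unlift_none.
under eq_bigr do rewrite liftK.
have := lc i; rewrite /c' /beta => /eqP; rewrite subr_eq => /eqP ->.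
under [in LHS]eq_bigr do rewrite mulrBr mulrA.
by rewrite sumrB -mulr_suml /l0'; ring.
Qed.

Lemma farkas (I K : finType) (alpha : K -> I -> R) (c : I -> R) :
  (forall x, (forall k, pairing (alpha k) x <= 0) -> pairing c x <= 0) ->
  exists2 l : K -> R, forall k, 0 <= l k &
    forall i, c i = \sum_k l k * alpha k i.
Proof.
move=> imp; have [x xle|l l0 lc] := @farkas_ord I #|K| (fun k => alpha (enum_val k)) c.
  by apply: imp => k; have := xle (enum_rank k); rewrite enum_rankK.
exists (fun k => l (enum_rank k)) => // i; rewrite lc.
rewrite [RHS](reindex (@enum_val K predT))/=; last first.
  by exists enum_rank => k _; [exact: enum_valK|exact: enum_rankK].
by apply: eq_bigr => k _; rewrite enum_valK.
Qed.

End Farkas.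

(** * Gradients and first-order inequalities *)

Section Gradient.
Variables (R : realType) (n : nat).
Implicit Types (f g h : 'cV[R]_n -> R) (x y z v : 'cV[R]_n).

Definition dot x y := \sum_j x j 0 * y j 0.

Lemma dotDr x y z : dot x (y + z) = dot x y + dot x z.
Proof. by rewrite -big_split; apply: eq_bigr => j _; rewrite mxE mulrDr. Qed.

Lemma dotZr x y (k : R) : dot x (k *: y) = k * dot x y.
Proof. by rewrite mulr_sumr; apply: eq_bigr => j _; rewrite mxE mulrCA. Qed.

Lemma derive_grad f z v : differentiable f z -> 'D_v f z = dot (grad f z) v.
Proof.
move=> df; rewrite deriveE//.
have -> : v = \sum_j v j 0 *: delta_mx j 0.
  rewrite {1}[v]matrix_sum_delta; apply: eq_bigr => j _; by rewrite big_ord1.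
rewrite linear_sum; apply: eq_bigr => j _; rewrite linearZ mxE deriveE//.
rewrite /GRing.scale/= mulrC; congr (_ * _).
rewrite summxE (bigD1 j)//= big1 ?addr0; last first.
  by move=> k kj; rewrite !mxE eq_sym (negbTE kj) mulr0.
by rewrite !mxE !eqxx mulr1.
Qed.

Lemma derive_cvg f z v : differentiable f z ->
  h^-1 * (f (h *: v + z) - f z) @[h --> (0 : R)^'] --> dot (grad f z) v.
Proof.
move=> df; rewrite -derive_grad//.
have := @diff_derivable _ _ _ f z v df.
exact.
Qed.

Lemma derive_cvg_right f z v : differentiable f z ->
  h^-1 * (f (h *: v + z) - f z) @[h --> (0 : R)^'+] --> dot (grad f z) v.
Proof. by move=> df; apply: cvg_dnbhs_at_right; exact: derive_cvg. Qed.

Lemma dotBr x y z : dot x (y - z) = dot x y - dot x z.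
Proof. by rewrite -sumrB; apply: eq_bigr => j _; rewrite !mxE mulrBr. Qed.

Lemma convex_grad f z y : convex_function setT f -> differentiable f z ->
  f z + dot (grad f z) (y - z) <= f y.
Proof.
move=> cf df; rewrite addrC -lerBrDr.
apply: (cvgr_to_le (@derive_cvg_right f z (y - z) df)); near=> t.
have t0 : 0 < t by near: t; exact: nbhs_right_gt.
have t1 : t <= 1 by near: t; exact: nbhs_right_le.
have := cf (Itv01 (ltW t0) t1) y z; rewrite !inE => /(_ I I).
rewrite convRE; set w := (w in f w <= _).
have -> : w = t *: (y - z) + z.
  rewrite /w /conv/= scalerBr scalerBl scale1r addrCA addrC -addrA.
  by congr (_ + _); rewrite addrC.
rewrite /= => H; rewrite mulrC ler_pdivrMr// lerBlDr (le_trans H)//.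
by rewrite /unstable.onem mulrBl mul1r; lra.
Unshelve. all: by end_near. Qed.

Lemma descent f z v : differentiable f z -> dot (grad f z) v < 0 ->
  \forall t \near (0 : R)^'+, f (t *: v + z) < f z.
Proof.
move=> df dv; have /cvgr_lt/(_ _ dv) := @derive_cvg_right f z v df.
apply: filterS2 (nbhs_right_gt 0) => t t0; rewrite mulrC ltr_pdivrMr// mul0r.
by rewrite subr_lt0.
Qed.

Lemma small_step f z v (c : R) : {for z, continuous f} -> f z < c ->
  \forall t \near (0 : R)^'+, f (t *: v + z) < c.
Proof.
move=> cf fc; have h0 : t *: v + z @[t --> (0 : R)^'+] --> z.
  rewrite -[X in _ --> X]add0r -(scale0r v); apply: cvgD; last exact: cvg_cst.
  apply: cvgZr_tmp; apply: cvg_at_right_filter; exact: cvg_id.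
have /cvgr_lt/(_ _ fc) : f (t *: v + z) @[t --> (0 : R)^'+] --> f z by apply: cvg_comp h0 cf.
exact.
Qed.

Lemma affine_grad h : affine h ->
  exists c, (forall z, grad h z = c) /\ forall z y, h y = h z + dot c (y - z).
Proof.
move=> [c [d hE]]; exists c.
have hB z y : h y = h z + dot c (y - z).
  rewrite !hE dotBr !mxE /dot.
  under eq_bigr do rewrite mxE.
  under [X in _ = X + _ + _]eq_bigr do rewrite mxE.
  ring.
split=> // z; apply/colP => j; rewrite mxE; apply: cvg_lim => //.
apply: (@cvg_trans _ ((fun=> c j 0) @ (0 : R)^')); last exact: cvg_cst.
apply: near_eq_cvg; near=> t.
have t0 : t != 0 by near: t; exact: nbhs_dnbhs_neq.
rewrite /= (hB z) addrAC subrr add0r addrK dotZr /GRing.scale/= mulrA mulVf// mul1r.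
rewrite /dot (bigD1 j)//= big1 ?addr0; last first.
  by move=> k kj; rewrite mxE (negbTE kj) mulr0.
by rewrite mxE !eqxx mulr1.
Unshelve. all: by end_near. Qed.

End Gradient.

Section FarkasEq.
Variables (R : realType) (I K1 K2 : finType).

(** Each equality is split into two opposite inequalities; [m] is the difference of their
    multipliers. *)
Lemma farkas_eq (alpha : K1 -> I -> R) (beta : K2 -> I -> R) (c : I -> R) :
  (forall x, (forall k, pairing (alpha k) x <= 0) ->
     (forall k, pairing (beta k) x = 0) -> pairing c x <= 0) ->
  exists (l : K1 -> R) (m : K2 -> R), (forall k, 0 <= l k) /\
    forall i, c i = \sum_k l k * alpha k i + \sum_k m k * beta k i.
Proof.
move=> imp.
pose gam (k : K1 + K2 * bool) i := match k with
  | inl k => alpha k i | inr (k, b) => (-1) ^+ b * beta k i end.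
have [x xle|l l0 lc] := @farkas _ _ _ gam c.
  apply: imp => k; first exact: (xle (inl k)).
  apply/eqP; rewrite eq_le; apply/andP; split.
    have := xle (inr (k, false)); rewrite /pairing /gam.
    by under eq_bigr do rewrite expr0 mul1r.
  have := xle (inr (k, true)); rewrite /pairing /gam.
  under eq_bigr do rewrite expr1 mulN1r mulNr.
  by rewrite sumrN oppr_le0.
exists (l \o inl), (fun k => l (inr (k, false)) - l (inr (k, true))).
split=> [k|i]; first exact: l0.
rewrite lc big_sumType/=; congr (_ + _).
transitivity (\sum_k \sum_b l (inr (k, b)) * gam (inr (k, b)) i).
  by rewrite pair_bigA/=; apply: eq_bigr => -[].
by apply: eq_bigr => k _; rewrite big_bool/= expr1 expr0; ring.
Qed.

End FarkasEq.

(** * The graph Laplacian as a sum over edges *)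

Section GraphLaplacian.
Variables (R : realType) (N : nat) (e : rel 'I_N) (a : 'I_N -> 'I_N -> R).
Hypothesis e_sym : symmetric e.
Hypothesis a_sym : forall i l, e i l -> a i l = a l i.
Hypothesis a_gt0 : forall i l, e i l -> 0 < a i l.

Lemma edge_swap (F : 'I_N -> 'I_N -> R) :
  \sum_i \sum_(l | e i l) F i l = \sum_i \sum_(l | e i l) F l i.
Proof.
rewrite (exchange_big_dep xpredT)//=.
by apply: eq_bigr => i _; apply: eq_bigl => l; rewrite e_sym.
Qed.

(** Symmetry of the Laplacian, that is, summation by parts over the edges. *)
Lemma edge_sum_parts (u d : 'I_N -> R) :
  \sum_i u i * (\sum_(l | e i l) a i l * (d l - d i)) =
  \sum_i d i * (\sum_(l | e i l) a i l * (u l - u i)).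
Proof.
have expand (v w : 'I_N -> R) :
    \sum_i v i * (\sum_(l | e i l) a i l * (w l - w i)) =
    \sum_i \sum_(l | e i l) a i l * (v i * w l) -
    \sum_i \sum_(l | e i l) a i l * (v i * w i).
  rewrite -sumrB; apply: eq_bigr => i _; rewrite mulr_sumr -sumrB.
  by apply: eq_bigr => l _; ring.
rewrite !expand; congr (_ - _).
  rewrite edge_swap; apply: eq_bigr => i _; apply: eq_bigr => l el.
  by rewrite -a_sym// mulrC [u l * _]mulrC mulrC.
by apply: eq_bigr => i _; apply: eq_bigr => l _; rewrite [u i * _]mulrC.
Qed.

(** Averaging the sum with its copy under exchange of the ends of each edge produces the Dirichlet
    form. *)
Lemma laplacian_energy (d : 'I_N -> R) :
  \sum_i d i * (\sum_(l | e i l) a i l * (d l - d i)) =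
  - (\sum_i \sum_(l | e i l) a i l * (d l - d i) ^+ 2) / 2.
Proof.
set S := LHS; have SE : S = \sum_i \sum_(l | e i l) a i l * (d i * (d l - d i)).
  by apply: eq_bigr => i _; rewrite mulr_sumr; apply: eq_bigr => l _; ring.
have SE' : S = \sum_i \sum_(l | e i l) a i l * (d l * (d i - d l)).
  rewrite SE edge_swap; apply: eq_bigr => i _; apply: eq_bigr => l el.
  by rewrite -a_sym.
have -> : S = (S + S) / 2 by field.
congr (_ / 2); rewrite {1}SE SE' -big_split/= -sumrN.
apply: eq_bigr => i _; rewrite -big_split/= -sumrN.
by apply: eq_bigr => l _; ring.
Qed.

Lemma laplacian_ker (d : 'I_N -> R) :
  (forall i, \sum_(l | e i l) a i l * (d l - d i) = 0) ->
  forall i l, e i l -> d i = d l.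
Proof.
move=> d0 i l el; have := laplacian_energy d.
rewrite big1 => [|k _]; last by rewrite d0 mulr0.
move/esym/eqP; rewrite mulf_eq0 invr_eq0 pnatr_eq0 orbF oppr_eq0.
have F0 k k' : e k k' -> 0 <= a k k' * (d k' - d k) ^+ 2.
  by move=> ek; rewrite mulr_ge0 ?sqr_ge0// ltW// a_gt0.
rewrite psumr_eq0 => [/allP/(_ i)|k _]; last by apply: sumr_ge0 => k' ?; exact: F0.
rewrite mem_index_enum => /(_ isT)/implyP/(_ isT).
rewrite psumr_eq0 => [/allP/(_ l)|k ek]; last exact: F0.
rewrite mem_index_enum el => /(_ isT)/implyP/(_ isT).
by rewrite mulf_eq0 gt_eqF ?a_gt0//= sqrf_eq0 subr_eq0 => /eqP.
Qed.

(** * Multipliers at an optimal point *)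

Section Kkt.
Variables (n : nat) (f g h : 'I_N -> 'cV[R]_n -> R) (z zs : 'cV[R]_n).
Hypothesis e_conn : forall i l, connect e i l.
Hypothesis df : forall i, differentiable (f i) z.
Hypothesis dg : forall i, differentiable (g i) z.
Hypothesis g_conv : forall i, convex_function setT (g i).
Hypothesis h_aff : forall i, affine (h i).
Hypothesis zs_strict : forall i, g i zs < 0 /\ h i zs = 0.
Hypothesis z_feas : forall i, g i z <= 0 /\ h i z = 0.
Hypothesis z_opt : forall y, (forall i, g i y <= 0 /\ h i y = 0) ->
  \sum_i f i z <= \sum_i f i y.

(** The conditions on [v] are not strict, so a move along [v] may leave the feasible set. Tilting
    [v] towards the Slater point makes every active [g i] strictly decrease, keeps [h i] at zero
    and, if the tilt is small, still lowers the cost. *)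
Lemma no_descent_direction (v : 'cV[R]_n) :
  (forall i, g i z = 0 -> dot (grad (g i) z) v <= 0) ->
  (forall i, dot (grad (h i) z) v = 0) ->
  0 <= \sum_i dot (grad (f i) z) v.
Proof.
move=> gv hv; rewrite leNgt; apply/negP => fv.
pose w := zs - z; pose Sv := \sum_i dot (grad (f i) z) v.
pose Sw := \sum_i dot (grad (f i) z) w.
(* Small enough that the tilt costs at most half of the descent [- Sv]. *)
pose k := - Sv / (2 * (`|Sw| + 1)).
have Sw1 : 0 < `|Sw| + 1 by rewrite ltr_pwDr.
have k0 : 0 < k by rewrite divr_gt0 ?oppr_gt0// mulr_gt0.
pose v' := v + k *: w.
have dv' u : dot u v' = dot u v + k * dot u w by rewrite dotDr dotZr.
have fv' : \sum_i dot (grad (f i) z) v' < 0.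
  under eq_bigr do rewrite dv'.
  rewrite big_split/= -mulr_sumr -/Sv -/Sw.
  have kS : k * (`|Sw| + 1) = - Sv / 2 by rewrite /k; field; rewrite gt_eqF.
  have : k * Sw <= k * (`|Sw| + 1).
    by rewrite ler_pM2l// (le_trans (ler_norm _))// lerDl.
  by move: fv; rewrite -/Sv; lra.
have hv' i y t : y = t *: v' + z -> h i y = 0.
  move=> ->; have [c [cg hE]] := affine_grad (h_aff i).
  rewrite (hE z) (z_feas i).2 add0r addrK dotZr dv'.
  have -> : dot c w = 0.
    by have := hE z zs; rewrite (zs_strict i).2 (z_feas i).2 add0r => <-.
  by have := hv i; rewrite cg => ->; rewrite mulr0 addr0 mulr0.
have gnear i : \forall t \near (0 : R)^'+, g i (t *: v' + z) <= 0.
  have [gz|gz] := eqVneq (g i z) 0.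
    have : dot (grad (g i) z) v' < 0.
      have := convex_grad zs (g_conv i) (dg i); rewrite gz add0r -/w => gw.
      have := (zs_strict i).1 => gs.
      have : k * dot (grad (g i) z) w < 0 by rewrite pmulr_rlt0//; exact: le_lt_trans gs.
      by have := gv i gz; rewrite dv'; lra.
    by move=> /(descent (dg i)); apply: filterS => t; rewrite gz => /ltW.
  have : g i z < 0 by rewrite lt_neqAle gz (z_feas i).1.
  move=> /(small_step v' (differentiable_continuous (dg i))).
  by apply: filterS => t /ltW.
pose F y := \sum_i f i y.
have dF : h^-1 * (F (h *: v' + z) - F z) @[h --> (0 : R)^'+] --> \sum_i dot (grad (f i) z) v'.
  have -> : (fun h : R => h^-1 * (F (h *: v' + z) - F z)) =
      (fun h => \sum_i h^-1 * (f i (h *: v' + z) - f i z)).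
    by apply/funext => t; rewrite /F -sumrB mulr_sumr.
  by apply: cvg_rsum => i _; exact: derive_cvg_right.
have gall : \forall t \near (0 : R)^'+, forall i, g i (t *: v' + z) <= 0.
  exact: filter_forall.
have /cvgr_lt/(_ _ fv') dF0 := dF.
have [t [[t0 tg] tF]] := filter_ex (filterI (filterI (nbhs_right_gt 0) gall) dF0).
have : F z <= F (t *: v' + z).
  by apply: z_opt => i; split; [exact: tg|exact: hv'].
rewrite leNgt => /negP; apply.
by move: tF => /=; rewrite mulrC ltr_pdivrMr// mul0r subr_lt0.
Qed.

(** Farkas' lemma on stacked vectors: a direction in the kernel of the Laplacian is one vector [v]
    repeated at all agents, so [no_descent_direction] supplies the implication. The factor 1/2 is
    that of a steady channel, where [r^xi_il - xi_i] is half of [xi_l - xi_i]. *)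
Lemma kkt_multipliers : exists (xi : 'I_N -> 'cV[R]_n) (Lam mu : 'I_N -> R),
  [/\ forall i, 0 <= Lam i, forall i, Lam i * g i z = 0 &
    forall i j, grad (f i) z j 0 + Lam i * grad (g i) z j 0
      + mu i * grad (h i) z j 0
      + \sum_(l | e i l) a i l * ((xi l j 0 - xi i j 0) / 2) = 0].
Proof.
pose I := ('I_N * 'I_n)%type.
(* Inactive constraints contribute the zero form; their multipliers are set to zero at the end. *)
pose alpha i (p : I) := (i == p.1)%:R * ((g i z == 0)%:R * grad (g i) z p.2 0).
(* The entries of minus half the Laplacian. *)
pose wt i i' := (if e i i' then a i i' / 2 else 0) - (i == i')%:R * (\sum_(l | e i l) a i l / 2).
pose beta (k : 'I_N + I) (p : I) := match k with
  | inl i => (i == p.1)%:R * grad (h i) z p.2 0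
  | inr (i, j) => (j == p.2)%:R * wt i p.1 end.
pose c (p : I) := - grad (f p.1) z p.2 0.
have pairE (u x : I -> R) : pairing u x = \sum_i \sum_j u (i, j) * x (i, j).
  by rewrite pair_bigA; apply: eq_bigr => -[].
have delta (F : 'I_N -> R) i : \sum_i' (i == i')%:R * F i' = F i.
  rewrite (bigD1 i)//= eqxx mul1r big1 ?addr0// => k ki.
  by rewrite eq_sym (negbTE ki) mul0r.
have delta' (F : 'I_n -> R) i : \sum_i' (i == i')%:R * F i' = F i.
  rewrite (bigD1 i)//= eqxx mul1r big1 ?addr0// => k ki.
  by rewrite eq_sym (negbTE ki) mul0r.
have wtE (F : 'I_N -> R) i : \sum_i' wt i i' * F i' = \sum_(l | e i l) a i l * ((F l - F i) / 2).
  under eq_bigr do rewrite mulrBl.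
  rewrite sumrB; have -> : \sum_i' (i == i')%:R * (\sum_(l | e i l) a i l / 2) * F i' =
      (\sum_(l | e i l) a i l / 2) * F i.
    by rewrite -[RHS](delta (fun i' => (\sum_(l | e i l) a i l / 2) * F i')); apply: eq_bigr => k _; rewrite mulrA.
  rewrite mulr_suml [in RHS](eq_bigr (fun l => a i l / 2 * F l - a i l / 2 * F i)); last first.
    by move=> l _; ring.
  rewrite sumrB; congr (_ - _); rewrite [RHS]big_mkcond; apply: eq_bigr => l _.
  by case: ifP => _; rewrite ?mul0r.
have wt_sym i i' : wt i i' = wt i' i.
  rewrite /wt e_sym; congr (_ - _).
    by case: ifP => // el; rewrite (a_sym el).
  by rewrite eq_sym; have [->|] := eqVneq i i'; rewrite ?mul0r.
have imp x : (forall k, pairing (alpha k) x <= 0) ->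
    (forall k, pairing (beta k) x = 0) -> pairing c x <= 0.
  (* [v] is read off at some agent, so the case of no agents is treated apart. *)
  move=> xa xb; case: (pickP (@predT 'I_N)) => [i0 _|no]; last first.
    by rewrite pairE big1 ?lexx// => i _; have := no i.
  pose v : 'cV[R]_n := \col_j x (i0, j).
  have xv i j : x (i, j) = v j 0.
    have L : forall i l, e i l -> x (i, j) = x (l, j).
      apply: (@laplacian_ker (fun i => x (i, j))) => i'.
      have := xb (inr (i', j)); rewrite pairE exchange_big/=.
      under eq_bigr do under eq_bigr do rewrite -mulrA.
      under eq_bigr do rewrite -mulr_sumr.
      rewrite (delta' (fun j => \sum_i wt i' i * x (i, j))) wtE => /(congr1 (fun y => y * 2)).
      rewrite mul0r mulr_suml => s0; rewrite -[RHS]s0; apply: eq_bigr => l _.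
      by field.
    rewrite mxE; have /connectP[p pth ->] := e_conn i i0.
    elim: p i pth => //= i1 p IH i /andP[ei /IH <-]; exact: L.
  have dvE (u : 'cV[R]_n) i : \sum_j u j 0 * x (i, j) = dot u v.
    by apply: eq_bigr => j _; rewrite xv.
  have -> : pairing c x = - \sum_i dot (grad (f i) z) v.
    rewrite pairE -sumrN; apply: eq_bigr => i _; rewrite -(dvE _ i) -sumrN.
    by apply: eq_bigr => j _; rewrite mulNr.
  rewrite oppr_le0; apply: no_descent_direction => i.
    move=> gz; have := xa i; rewrite pairE /alpha/=.
    under eq_bigr do under eq_bigr do rewrite -mulrA.
    under eq_bigr do rewrite -mulr_sumr.
    rewrite (delta (fun i' => \sum_j (g i z == 0)%:R * grad (g i) z j 0 * x (i', j))).
    by rewrite gz eqxx; under eq_bigr do rewrite mul1r; rewrite dvE.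
  have := xb (inl i); rewrite pairE/=.
  under eq_bigr do under eq_bigr do rewrite -mulrA.
  under eq_bigr do rewrite -mulr_sumr.
  by rewrite (delta (fun i' => \sum_j grad (h i) z j 0 * x (i', j))) dvE.
have [l [m [l0 lmc]]] := farkas_eq imp.
exists (fun i => \col_j m (inr (i, j))), (fun i => l i * (g i z == 0)%:R), (fun i => m (inl i)).
split=> [i|i|i j].
- by rewrite mulr_ge0.
- by have [->|] := eqVneq (g i z) 0; rewrite ?mulr0// mul0r.
- have := lmc (i, j); rewrite /c /alpha /= => H.
  have -> : grad (f i) z j 0 = - (- grad (f i) z j 0) by rewrite opprK.
  rewrite H big_sumType/=.
  have -> : \sum_k l k * ((k == i)%:R * ((g k z == 0)%:R * grad (g k) z j 0)) =
      l i * (g i z == 0)%:R * grad (g i) z j 0.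
    rewrite -mulrA -[RHS](delta (fun k => l k * ((g k z == 0)%:R * grad (g k) z j 0))).
    by apply: eq_bigr => k _; rewrite eq_sym mulrCA.
  have -> : \sum_k m (inl k) * ((k == i)%:R * grad (h k) z j 0) = m (inl i) * grad (h i) z j 0.
    rewrite -[RHS](delta (fun k => m (inl k) * grad (h k) z j 0)).
    by apply: eq_bigr => k _; rewrite eq_sym mulrCA.
  have -> : \sum_(k : I) m (inr k) * (let: (i', j') := k in (j' == j)%:R * wt i' i) =
      \sum_(k | e i k) a i k * (((\col_j0 m (inr (k, j0))) j 0 - (\col_j0 m (inr (i, j0))) j 0) / 2).
    transitivity (\sum_i' \sum_j' m (inr (i', j')) * ((j' == j)%:R * wt i' i)).
      by rewrite pair_bigA; apply: eq_bigr => -[].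
    under [RHS]eq_bigr do rewrite !mxE.
    rewrite -(wtE (fun k => m (inr (k, j)))); apply: eq_bigr => i' _.
    rewrite -[RHS](delta' (fun j' => wt i i' * m (inr (i', j')))).
    by apply: eq_bigr => j' _; rewrite eq_sym wt_sym; ring.
  by ring.
Qed.

End Kkt.
End GraphLaplacian.

(** * The closed loop *)

Section Coordinates.
Variables (R : realType) (N n m : nat) (P : system R N n m).
Implicit Types (s : state R N n m) (i l : 'I_N) (j : 'I_n) (k : 'I_m).

Lemma output_coord s i j : output s i j 0 = \sum_k rho s i k j 0.
Proof. by rewrite /output summxE. Qed.

Lemma rx_gap_coord s i j : rx_gap P s i j 0 =
  \sum_(l | edge P i l) adj P i l * (usubmx (rsig s i l) j 0 - output s i j 0).
Proof. by rewrite /rx_gap summxE; apply: eq_bigr => l _; rewrite 3!mxE mxE. Qed.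

Lemma rxi_gap_coord s i j : rxi_gap P s i j 0 =
  \sum_(l | edge P i l) adj P i l * (dsubmx (rsig s i l) j 0 - xi s i j 0).
Proof. by rewrite /rxi_gap summxE; apply: eq_bigr => l _; rewrite 3!mxE mxE. Qed.

Lemma nu_coord s i j : nu P s i j 0 =
  - grad (obj P i) (output s i) j 0
  - lam s i ^+ 2 * grad (ineq P i) (output s i) j 0
  - mu s i * grad (equa P i) (output s i) j 0
  + rx_gap P s i j 0 - rxi_gap P s i j 0.
Proof.
rewrite /nu; move: (rx_gap P s i) (rxi_gap P s i) => G H.
move: (grad (obj P i) _) (grad (ineq P i) _) (grad (equa P i) _) => A B C.
by rewrite !mxE.
Qed.

Lemma rho_field_coord s i k j : rho_field P s i k j 0 =
  - (decay P i k * rho s i k j 0) + gain P i k * nu P s i j 0.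
Proof. by rewrite /rho_field; move: (nu P s i) => V; rewrite !mxE. Qed.

Lemma coord_derive p (u : R -> 'cV[R]_p) (t : R) (l : 'cV[R]_p) (j : 'I_p) :
  is_derive t 1 u l -> is_derive t 1 (fun r => u r j 0) (l j 0).
Proof.
move=> [du ul]; have cd := (derivable_mxP u t 1).1 du.
by apply: DeriveDef; [exact: cd|rewrite -ul derive_mx// mxE].
Qed.

Lemma scat_p_coord s i l : scat_p P s i l =
  col_mx (adj P i l *: (usubmx (rsig s i l) - output s i) -
          adj P i l *: (dsubmx (rsig s i l) - xi s i))
         (adj P i l *: (usubmx (rsig s i l) - output s i)).
Proof.
rewrite /scat_p /coupling -{1}[rsig s i l]vsubmxK opp_col_mx add_col_mx mul_block_col.
by rewrite !mul_scalar_mx mul0mx addr0 scaleNr.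
Qed.

Lemma scat_out_up s i l j : usubmx (scat_out P s i l) j 0 =
  (Num.sqrt (2 * eta P))^-1 *
  outx (adj P i l) (eta P) (usubmx (rsig s i l) j 0) (dsubmx (rsig s i l) j 0)
    (output s i j 0) (xi s i j 0).
Proof.
rewrite /scat_out scat_p_coord [LHS]mxE [LHS]mxE [X in _ * X = _]mxE /outx.
move: (rsig s i l) (output s i) (xi s i) => r y v.
by rewrite [(- col_mx _ _) _ _]mxE col_mxEu !mxE; ring.
Qed.

Lemma scat_out_down s i l j : dsubmx (scat_out P s i l) j 0 =
  (Num.sqrt (2 * eta P))^-1 *
  outv (adj P i l) (eta P) (usubmx (rsig s i l) j 0) (dsubmx (rsig s i l) j 0)
    (output s i j 0).
Proof.
rewrite /scat_out scat_p_coord [LHS]mxE [LHS]mxE [X in _ * X = _]mxE /outv.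
move: (rsig s i l) (output s i) (xi s i) => r y v.
by rewrite [(- col_mx _ _) _ _]mxE col_mxEd !mxE; ring.
Qed.

Lemma scat_in_up s i l j : usubmx (scat_in P s i l) j 0 =
  (Num.sqrt (2 * eta P))^-1 *
  incx (adj P i l) (eta P) (usubmx (rsig s i l) j 0) (dsubmx (rsig s i l) j 0)
    (output s i j 0) (xi s i j 0).
Proof.
rewrite /scat_in scat_p_coord [LHS]mxE [LHS]mxE [X in _ * X = _]mxE /incx.
move: (rsig s i l) (output s i) (xi s i) => r y v.
by rewrite col_mxEu !mxE; ring.
Qed.

Lemma scat_in_down s i l j : dsubmx (scat_in P s i l) j 0 =
  (Num.sqrt (2 * eta P))^-1 *
  incv (adj P i l) (eta P) (usubmx (rsig s i l) j 0) (dsubmx (rsig s i l) j 0)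
    (output s i j 0).
Proof.
rewrite /scat_in scat_p_coord [LHS]mxE [LHS]mxE [X in _ * X = _]mxE /incv.
move: (rsig s i l) (output s i) (xi s i) => r y v.
by rewrite col_mxEd !mxE; ring.
Qed.

End Coordinates.

Section TrajectoryFacts.
Variables (R : realType) (N n m : nat) (P : system R N n m).
Variable S : R -> state R N n m.
Hypothesis trajS : trajectory P S.
Hypothesis graphP : undirected_connected_graph P.
Hypothesis eta_gt0 : 0 < eta P.

Lemma within_pos (V : topologicalType) (u : R -> V) :
  {within `[0, +oo[, continuous u} -> forall t : R, 0 < t -> {for t, continuous u}.
Proof.
move=> cu t t0; have : {in `]0, +oo[%classic, continuous u}.
  rewrite -continuous_open_subspace; last exact: interval_open.
  apply: continuous_subspaceW cu => r /=; rewrite !in_itv/= !andbT; exact: ltW.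
by apply; rewrite inE/= in_itv/= t0.
Qed.

Lemma within_bounded (u : R -> R) : {within `[0, +oo[, continuous u} ->
  forall b, exists K : R, forall t, 0 <= t <= b -> `|u t| <= K.
Proof.
move=> cu b; have [b0|b0] := ltP b 0.
  by exists 0 => t /andP[t0 tb]; have := le_lt_trans (le_trans t0 tb) b0; rewrite ltxx.
have cb : {within `[0, b], continuous (fun t => `|u t|)}.
  have cu' : {within `[0, b], continuous u}.
    by apply: continuous_subspaceW cu => r /=; rewrite !in_itv/= => /andP[->].
  by move=> t; apply: (cvg_comp _ _ (cu' t)); exact: norm_continuous.
have [c _ cmax] := EVT_max b0 cb.
by exists `|u c| => t tb; apply: cmax; rewrite in_itv.
Qed.

Lemma within_coord p (u : R -> 'cV[R]_p) (j : 'I_p) : {within `[0, +oo[, continuous u} ->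
  {within `[0, +oo[, continuous (fun t => u t j 0)}.
Proof.
move=> cu t; apply: (@cvg_comp _ _ _ u (fun M : 'cV[R]_p => M j 0) _ _ _ (cu t)).
exact: coord_continuous.
Qed.

Lemma pder_of_trajectory (u v : R -> R) :
  {within `[0, +oo[, continuous u} ->
  (exists2 D : set R, (forall t, finite_set (D `&` `[0, t])) &
     forall t, 0 < t -> ~ D t -> is_derive t 1 u (v t)) ->
  pder 0 u v.
Proof.
move=> cu [D fD dD]; split=> [t t0|b]; first exact: within_pos.
have /finite_seqP[s sD] := fD b; exists s => t /andP[t0 tb] ts.
apply: dD => // Dt; move/negP: ts; apply.
have : (D `&` `[0, b]) t by split => //=; rewrite in_itv/= !ltW.
by rewrite sD.
Qed.

Lemma rho_pder i k j : pder 0 (fun t => rho (S t) i k j 0)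
  (fun t => - (decay P i k * rho (S t) i k j 0) + gain P i k * nu P (S t) i j 0).
Proof.
have [ct [D fD dD] _] := trajS; have [c1 _ _ _] := ct i.
apply: pder_of_trajectory; first exact/within_coord/c1.
exists D => // t t0 tD; have [/(_ k) d1 _ _ _] := dD t t0 tD i.
by rewrite -rho_field_coord; exact: coord_derive.
Qed.

Lemma xi_pder i j : pder 0 (fun t => xi (S t) i j 0) (fun t => rx_gap P (S t) i j 0).
Proof.
have [ct [D fD dD] _] := trajS; have [_ c1 _ _] := ct i.
apply: pder_of_trajectory; first exact/within_coord/c1.
exists D => // t t0 tD; have [_ d1 _ _] := dD t t0 tD i.
exact: coord_derive.
Qed.

Lemma lam_pder i : pder 0 (fun t => lam (S t) i)
  (fun t => 2 * lam (S t) i * ineq P i (output (S t) i)).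
Proof.
have [ct [D fD dD] _] := trajS; have [_ _ c1 _] := ct i.
apply: pder_of_trajectory => //; exists D => // t t0 tD.
by have [_ _ d1 _] := dD t t0 tD i.
Qed.

Lemma mu_pder i : pder 0 (fun t => mu (S t) i)
  (fun t => equa P i (output (S t) i)).
Proof.
have [ct [D fD dD] _] := trajS; have [_ _ _ c1] := ct i.
apply: pder_of_trajectory => //; exists D => // t t0 tD.
by have [_ _ _ d1] := dD t t0 tD i.
Qed.

Lemma output_within i : {within `[0, +oo[, continuous (fun t => output (S t) i)}.
Proof.
have [ct _ _] := trajS; have [c1 _ _ _] := ct i.
rewrite /output => t; apply: cvg_big => // [|k _]; last exact: c1.
exact: add_continuous.
Qed.

(** For [t >= 0] the only trace of [causal] is the test [t < T] of [delayed]; the common scattering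
    factor cancels, and symmetry of the weights lets both ends use [adj P i l]. *)
Lemma edge_link i l j : edge P i l ->
  link (adj P i l) (eta P) (delay P l i)
   (fun t => output (S t) i j 0) (fun t => xi (S t) i j 0)
   (fun t => usubmx (rsig (S t) i l) j 0) (fun t => dsubmx (rsig (S t) i l) j 0)
   (fun t => output (S t) l j 0) (fun t => xi (S t) l j 0)
   (fun t => usubmx (rsig (S t) l i) j 0) (fun t => dsubmx (rsig (S t) l i) j 0).
Proof.
move=> eil; have [esym _ _ aP _] := graphP; have eli : edge P l i by rewrite esym.
have [_ _ /(_ l i eli) ch] := trajS.
have q0 : (Num.sqrt (2 * eta P))^-1 != 0.
  by rewrite invr_eq0 gt_eqF// sqrtr_gt0 mulr_gt0.
move=> t t0; have := ch t; rewrite /causal ltNge t0/= subr_lt0 /delayed => H.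
split; apply: (mulfI q0).
  rewrite -scat_in_up H; case: ifP => _; first by rewrite !mxE mulr0.
  by rewrite scat_out_up (aP _ _ eli).1.
rewrite -scat_in_down H; case: ifP => _; first by rewrite !mxE mulr0.
by rewrite scat_out_down (aP _ _ eli).1.
Qed.

End TrajectoryFacts.

(** * Positivity of the multipliers of the inequalities *)

Section PositiveMultipliers.
Variables (R : realType) (N n m : nat) (P : system R N n m).
Variable S : R -> state R N n m.
Hypothesis trajS : trajectory P S.
Hypothesis g_diff : forall i z, differentiable (ineq P i) z.
Hypothesis lam0 : forall i, 0 < lam (S 0) i.

Lemma output_bounded b : exists B : R, forall t, 0 <= t <= b ->
  forall i, in_box B (output (S t) i).
Proof.
have ex (ij : 'I_N * 'I_n) : exists B : R, forall t, 0 <= t <= b ->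
    `|output (S t) ij.1 ij.2 0| <= B.
  have cw := @within_coord _ _ _ ij.2 (@output_within _ _ _ _ _ _ trajS ij.1).
  exact: (within_bounded cw b).
have [B Bd] := choice ex.
exists (\sum_ij `|B ij|) => t tb i j.
apply: le_trans (Bd (i, j) t tb) _; rewrite (bigD1 (i, j))//=.
by rewrite (le_trans (ler_norm _))// lerDl sumr_ge0.
Qed.

(** The equation is linear in [lam], so [lam] times the exponential of [- 2 * G], with [G] an
    antiderivative of [g], is constant on positive times. Derivatives are given only there; right
    continuity carries the sign from 0 to small positive times. *)
Lemma lam_gt0 i t : 0 <= t -> 0 < lam (S t) i.
Proof.
rewrite le_eqVlt => /predU1P[<- //|t0].
pose g t := ineq P i (output (S t) i).
have cg (r : R) : 0 < r -> {for r, continuous g}.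
  move=> r0; apply: continuous_comp; first exact: (within_pos (@output_within _ _ _ _ _ _ trajS i)).
  exact/differentiable_continuous/g_diff.
have gb b : exists K : R, forall r, 0 <= r <= b -> `|g r| <= K.
  have [B Bd] := output_bounded b.
  have [K KP] := box_bounded B (fun z => differentiable_continuous (g_diff i z)).
  by exists K => r rb; apply: KP; exact: Bd.
have [G GP] := pcont_antiderivative (fun b => pcont_continuous b cg) gb.
have pG : pder 0 G g.
  split=> [r r0|b]; first exact: (GP r r0).1.
  by exists [::] => r /andP[r0 _] _; apply: (GP r r0).2; exact: cg.
have pE := pder_comp (pderZ (- 2) pG) (fun r _ => is_derive_expR _).
have pU := pderM (lam_pder trajS i) pE.
pose U r := lam (S r) i * expR (- 2 * G r).
have Ucst (r s : R) : 0 < r -> r <= s -> U s = U r.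
  move=> r0 rs; apply/eqP; rewrite -subr_eq0 eq_le; apply/andP; split.
    by have := pder_le pU r0 rs (K := 0); rewrite mul0r; apply=> w _; rewrite /g; lra.
  have := pder_le (pderZ (-1) pU) r0 rs (K := 0); rewrite mul0r => H.
  suff : -1 * U s - -1 * U r <= 0 by lra.
  by apply: H => w _; rewrite /g; lra.
have [ct _ _] := trajS; have [_ _ cl _] := ct i.
have [_ cl0] := (continuous_within_itvcyP _ _).1 cl.
have near0 : \forall r \near (0 : R)^'+, 0 < lam (S r) i.
  exact: cvgr_gt cl0 _ (lam0 i).
have [r [[r0 rt] lr]] := filter_ex (filterI (filterI (nbhs_right_gt 0) (nbhs_right_le t0)) near0).
have : 0 < U t by rewrite (Ucst r)// mulr_gt0// expR_gt0.
by rewrite pmulr_lgt0// expR_gt0.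
Qed.

Lemma ln_lam_pder i : pder 0 (fun t => ln (lam (S t) i))
  (fun t => 2 * ineq P i (output (S t) i)).
Proof.
have l0 t : 0 < t -> 0 < lam (S t) i by move=> /ltW; exact: lam_gt0.
have := pder_comp (lam_pder trajS i) (fun t t0 => is_derive1_ln (l0 t t0)).
apply: pder_ext => // t /l0 lt.
by field; rewrite gt_eqF.
Qed.

End PositiveMultipliers.

(** * Lyapunov function *)

Section Energy.
Variable R : realType.

(** With [r = (X, V)] and [p = E (r - (x, v))], the left side pairs [(x, v)] with [p]. Write
    [(x, v)] as [r] minus [r - (x, v)]: pairing [r] with [p] gives the difference of the squares of
    [eta r + p] and [eta r - p] over [4 * eta]; in the other pairing the off-diagonal part of [E] is
    skew and only the damping remains. *)
Lemma scattering_power (a eta X V x v : R) : 0 < eta ->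
  a * (x * (X - x) - x * (V - v) + v * (X - x)) =
  - (a * (X - x) ^+ 2) + (incx a eta X V x v ^+ 2 + incv a eta X V x ^+ 2) / (4 * eta)
  - (outx a eta X V x v ^+ 2 + outv a eta X V x ^+ 2) / (4 * eta).
Proof. by move=> e0; rewrite /incx /incv /outx /outv; field; rewrite gt_eqF. Qed.

(** A Bregman distance between the squares, scaled so that along [l' = 2 l g] its derivative is
    [(l ^+ 2 - lc ^+ 2) * g]. For [lc = 0] the logarithms are multiplied by zero and [l ^+ 2 / 4]
    remains. *)
Definition multiplier_energy (l lc : R) :=
  (l ^+ 2 - lc ^+ 2 - 2 * lc ^+ 2 * (ln l - ln lc)) / 4.

Lemma multiplier_energy_ge (l lc : R) : 0 < l -> 0 <= lc ->
  (l - lc) ^+ 2 / 4 <= multiplier_energy l lc.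
Proof.
move=> l0; rewrite le_eqVlt => /predU1P[<-|lc0].
  by rewrite /multiplier_energy expr0n/= mulr0 mul0r !subr0.
have w0 : 0 < l / lc by rewrite divr_gt0.
have lnE : ln l - ln lc = ln (l / lc) by rewrite ln_div ?posrE.
have lnle : ln (l / lc) <= l / lc - 1.
  have := @le_ln1Dx R (l / lc - 1); rewrite [1 + _]addrC subrK; apply.
  by rewrite ltrBrDl subrr.
rewrite /multiplier_energy lnE ler_pM2r ?invr_gt0//.
have : lc ^+ 2 * ln (l / lc) <= lc ^+ 2 * (l / lc - 1).
  by rewrite ler_pM2l// exprn_gt0.
have -> : lc ^+ 2 * (l / lc - 1) = lc * l - lc ^+ 2 by field; rewrite gt_eqF.
lra.
Qed.

Variable n : nat.

(** Gradient inequalities for [f] and [g] at both [x] and [z]; the terms of the affine [h] cancel.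
    The right side keeps [l ^+ 2 * g z] because the centre may have [g z > 0]. *)
Lemma agent_dissipation (f g h : 'cV[R]_n -> R) (x z : 'cV[R]_n) (l lc mu mc : R) :
  convex_function setT f -> convex_function setT g -> affine h ->
  (forall z, differentiable f z) -> (forall z, differentiable g z) ->
  lc * g z = 0 -> h z = 0 ->
  \sum_j (x j 0 - z j 0) *
    (- grad f x j 0 - l ^+ 2 * grad g x j 0 - mu * grad h x j 0
     + (grad f z j 0 + lc ^+ 2 * grad g z j 0 + mc * grad h z j 0))
  + (l ^+ 2 - lc ^+ 2) * g x + (mu - mc) * h x <= l ^+ 2 * g z.
Proof.
move=> cf cg ah df dg lg hz.
have [c [hc hE]] := affine_grad ah.
have -> : \sum_j (x j 0 - z j 0) *
    (- grad f x j 0 - l ^+ 2 * grad g x j 0 - mu * grad h x j 0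
     + (grad f z j 0 + lc ^+ 2 * grad g z j 0 + mc * grad h z j 0)) =
   dot (grad f x) (z - x) + l ^+ 2 * dot (grad g x) (z - x)
   + dot (grad f z) (x - z) + lc ^+ 2 * dot (grad g z) (x - z)
   + (mc - mu) * dot c (x - z).
  rewrite !hc; move: (grad f x) (grad g x) (grad f z) (grad g z) => A B C D.
  by rewrite !mulr_sumr -!big_split/=; apply: eq_bigr => j _; rewrite !mxE; ring.
have h1 := convex_grad z cf (df x); have h2 := convex_grad x cf (df z).
have h3 : l ^+ 2 * dot (grad g x) (z - x) <= l ^+ 2 * (g z - g x).
  by rewrite ler_wpM2l ?sqr_ge0//; have := convex_grad z cg (dg x); lra.
have h4 : lc ^+ 2 * dot (grad g z) (x - z) <= lc ^+ 2 * (g x - g z).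
  by rewrite ler_wpM2l ?sqr_ge0//; have := convex_grad x cg (dg z); lra.
have h5 : h x = dot c (x - z) by rewrite (hE z) hz add0r.
have h6 : lc ^+ 2 * g z = 0 by rewrite expr2 -mulrA lg mulr0.
by rewrite h5; lra.
Qed.

End Energy.

Section Lyapunov.
Variables (R : realType) (N n m : nat) (P : system R N n m).
Variable S : R -> state R N n m.
Hypothesis trajS : trajectory P S.
Hypothesis f_convex : forall i, convex_function setT (obj P i).
Hypothesis f_diff : forall i z, differentiable (obj P i) z.
Hypothesis g_convex : forall i, convex_function setT (ineq P i).
Hypothesis g_diff : forall i z, differentiable (ineq P i) z.
Hypothesis h_affine : forall i, affine (equa P i).
Hypothesis graphP : undirected_connected_graph P.
Hypothesis m_gt0 : (0 < m)%N.
Hypothesis b_first : forall i (k : 'I_m), k = 0%N :> nat -> decay P i k = 0.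
Hypothesis c_gt0 : forall i k, 0 < gain P i k.
Hypothesis eta_gt0 : 0 < eta P.
Hypothesis delay_ge0 : forall i l, edge P i l -> 0 <= delay P i l.
Hypothesis lam0 : forall i, 0 < lam (S 0) i.

Let e_sym : symmetric (edge P). Proof. by case: graphP. Qed.
Let a_sym i l : edge P i l -> adj P i l = adj P l i.
Proof. by case: graphP => _ _ _ aP _ /aP[]. Qed.
Let a_gt0 i l : edge P i l -> 0 < adj P i l.
Proof. by case: graphP => _ _ _ aP _ /aP[]. Qed.

Let x i t : 'cV[R]_n := output (S t) i.
Let rx i l t : 'cV[R]_n := usubmx (rsig (S t) i l).
Let rv i l t : 'cV[R]_n := dsubmx (rsig (S t) i l).

(** A crude common bound of the delays: past it no channel delivers the zero prehistory. *)
Definition horizon := \sum_i \sum_(l | edge P i l) delay P i l.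

Lemma delay_le_horizon i l : edge P i l -> delay P i l <= horizon.
Proof.
move=> eil; rewrite /horizon (bigD1 i)//= (bigD1 l)//= -addrA lerDl.
rewrite addr_ge0//; first by apply: sumr_ge0 => k /andP[ek _]; exact: delay_ge0.
by apply: sumr_ge0 => i' _; apply: sumr_ge0 => k; exact: delay_ge0.
Qed.

Lemma horizon_ge0 : 0 <= horizon.
Proof. by apply: sumr_ge0 => i _; apply: sumr_ge0 => l; exact: delay_ge0. Qed.

(* A steady state [rho_1 = z], [rho_k = 0] for [k > 1], without the sign
   condition [g_i z <= 0]. *)
Variables (z : 'cV[R]_n) (xc : 'I_N -> 'cV[R]_n) (lc mc : 'I_N -> R).

Definition stationary := [/\ forall i, 0 <= lc i, forall i, lc i * ineq P i z = 0,
  forall i, equa P i z = 0 &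
  forall i j, grad (obj P i) z j 0 + lc i ^+ 2 * grad (ineq P i) z j 0
      + mc i * grad (equa P i) z j 0
      + \sum_(l | edge P i l) adj P i l * ((xc l j 0 - xc i j 0) / 2) = 0].

Hypothesis centerP : stationary.

Definition rest (k : 'I_m) : 'cV[R]_n := if k == 0%N :> nat then z else 0.

Definition out_errx i l j t :=
  outx (adj P i l) (eta P) (rx i l t j 0) (rv i l t j 0) (x i t j 0) (xi (S t) i j 0)
  - steadyx (adj P i l) (eta P) (z j 0) (xc i j 0) (z j 0) (xc l j 0).
Definition out_errv i l j t :=
  outv (adj P i l) (eta P) (rx i l t j 0) (rv i l t j 0) (x i t j 0)
  - steadyv (adj P i l) (eta P) (z j 0) (xc i j 0) (z j 0) (xc l j 0).
Definition inc_errx i l j t :=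
  incx (adj P i l) (eta P) (rx i l t j 0) (rv i l t j 0) (x i t j 0) (xi (S t) i j 0)
  - steadyx (adj P i l) (eta P) (z j 0) (xc l j 0) (z j 0) (xc i j 0).
Definition inc_errv i l j t :=
  incv (adj P i l) (eta P) (rx i l t j 0) (rv i l t j 0) (x i t j 0)
  - steadyv (adj P i l) (eta P) (z j 0) (xc l j 0) (z j 0) (xc i j 0).

(** The rate at which agent [i] feeds energy into its channel to [l]: half the squared norm of the
    sent scattering variable, measured from its steady value. *)
Definition flux i l t := \sum_j (out_errx i l j t ^+ 2 + out_errv i l j t ^+ 2) / (4 * eta P).

Lemma flux_ge0 i l t : 0 <= flux i l t.
Proof.
apply: sumr_ge0 => j _; rewrite divr_ge0 ?addr_ge0 ?sqr_ge0//.
by rewrite mulr_ge0// ltW.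
Qed.

Lemma flux_delay i l t : edge P i l -> delay P i l <= t ->
  flux i l (t - delay P i l) =
  \sum_j (inc_errx l i j t ^+ 2 + inc_errv l i j t ^+ 2) / (4 * eta P).
Proof.
move=> eil Tt; have eli : edge P l i by rewrite e_sym.
apply: eq_bigr => j _; have t0 : 0 <= t by exact: le_trans (delay_ge0 eil) Tt.
have [hx hv] := edge_link trajS graphP eta_gt0 j eli t0.
rewrite /inc_errx /inc_errv /out_errx /out_errv /rx /rv /x hx hv /delayed ltNge Tt/=.
by rewrite (a_sym eli).
Qed.

Lemma state_within i (j : 'I_n) :
  {within `[0, +oo[, continuous (fun t => x i t j 0)} /\
  {within `[0, +oo[, continuous (fun t => xi (S t) i j 0)}.
Proof.
have [ct _ _] := trajS; have [_ c _ _] := ct i; split.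
  exact: (@within_coord _ _ _ j (@output_within _ _ _ _ _ _ trajS i)).
exact: (@within_coord _ _ _ j c).
Qed.

Lemma signal_pcont i l j b : edge P i l ->
  pcont b (fun t => rx i l t j 0) /\ pcont b (fun t => rv i l t j 0).
Proof.
move=> eil; have eli : edge P l i by rewrite e_sym.
have L1 := edge_link trajS graphP eta_gt0 j eil.
have := edge_link trajS graphP eta_gt0 j eli; rewrite -(a_sym eil) => L2.
apply: (link_pcont (a_gt0 eil) eta_gt0 (delay_ge0 eil) (delay_ge0 eli) L1 L2) => t t0;
  apply: within_pos t0.
- by have [] := state_within i j.
- by have [] := state_within i j.
- by have [] := state_within l j.
- by have [] := state_within l j.
Qed.

Lemma signal_bounded i l j (B : R) : edge P i l -> 0 <= B ->
  exists K : R, forall b : R, (forall t, 0 <= t <= b -> forall i,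
      `|x i t j 0| <= B /\ `|xi (S t) i j 0| <= B) ->
    forall t, 0 <= t <= b -> `|rx i l t j 0| <= K /\ `|rv i l t j 0| <= K.
Proof.
move=> eil B0; have eli : edge P l i by rewrite e_sym.
have L1 := edge_link trajS graphP eta_gt0 j eil.
have := edge_link trajS graphP eta_gt0 j eli; rewrite -(a_sym eil) => L2.
have [K KP] := link_bound (a_gt0 eil) eta_gt0 (delay_ge0 eil) (delay_ge0 eli) L1 L2 B0.
exists K => b bd; apply: KP => t tb.
by have [? ?] := bd t tb i; have [? ?] := bd t tb l.
Qed.

Lemma flux_pcont i l b : edge P i l -> pcont b (flux i l).
Proof.
move=> eil; apply: pcont_sum => j _.
have [px pv] := signal_pcont j b eil.
have [cx cv] := state_within i j.
have px' : pcont b (fun t => x i t j 0) by apply: pcont_continuous; exact: within_pos.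
have pv' : pcont b (fun t => xi (S t) i j 0) by apply: pcont_continuous; exact: within_pos.
have pZ (c : R) (u : R -> R) : pcont b u -> pcont b (fun t => c * u t).
  by apply: pcontM; exact: pcont_cst.
have pox : pcont b (out_errx i l j).
  apply: pcontB; last exact: pcont_cst.
  by apply: pcontB; [exact: pZ|apply: pcontB; apply: pZ; exact: pcontB].
have pov : pcont b (out_errv i l j).
  apply: pcontB; last exact: pcont_cst.
  by apply: pcontB; [exact: pZ|apply: pZ; exact: pcontB].
by apply: pcontM (pcont_cst _ _); apply: pcontD; exact: pcontM.
Qed.

Lemma flux_bounded i l b : edge P i l ->
  exists K : R, forall t, 0 <= t <= b -> `|flux i l t| <= K.
Proof.
move=> eil.
have ex (ij : 'I_N * 'I_n) : exists B : R, forall t, 0 <= t <= b ->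
    `|x ij.1 t ij.2 0| <= B /\ `|xi (S t) ij.1 ij.2 0| <= B.
  have [/within_bounded/(_ b)[B1 h1] /within_bounded/(_ b)[B2 h2]] := state_within ij.1 ij.2.
  exists (`|B1| + `|B2|) => t tb; split.
    by rewrite (le_trans (h1 t tb))// (le_trans (ler_norm _))// lerDl.
  by rewrite (le_trans (h2 t tb))// (le_trans (ler_norm _))// lerDr.
have [B Bd] := choice ex; pose B' := \sum_ij `|B ij|.
have BB ij : B ij <= B' by rewrite (le_trans (ler_norm _))// /B' (bigD1 ij)//= lerDl sumr_ge0.
have B'0 : 0 <= B' by apply: sumr_ge0.
have bd t j i' : 0 <= t <= b -> `|x i' t j 0| <= B' /\ `|xi (S t) i' j 0| <= B'.
  by move=> tb; have [h1 h2] := Bd (i', j) t tb; split; exact: le_trans (BB (i', j)).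
have exK j : exists K : R, forall t, 0 <= t <= b -> `|rx i l t j 0| <= K /\ `|rv i l t j 0| <= K.
  have [K KP] := signal_bounded j eil B'0; exists K; apply: KP => t tb i'.
  exact: bd.
have [K KP] := choice exK.
pose C j := eta P * K j + adj P i l * (K j + B') + adj P i l * (K j + B').
pose sx j := `|steadyx (adj P i l) (eta P) (z j 0) (xc i j 0) (z j 0) (xc l j 0)|.
pose sv j := `|steadyv (adj P i l) (eta P) (z j 0) (xc i j 0) (z j 0) (xc l j 0)|.
exists (\sum_j ((C j + sx j) ^+ 2 + (C j + sv j) ^+ 2) / (4 * eta P)) => t tb.
rewrite ger0_norm ?flux_ge0//; apply: ler_sum => j _.
have [kx kv] := KP j t tb; have [xb vb] := bd t j i tb.
have K0 : 0 <= K j by exact: le_trans kx.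
have aa := ltW (a_gt0 eil); have ee := ltW eta_gt0.
have sqle (u v : R) : `|u| <= v -> u ^+ 2 <= v ^+ 2.
  move=> uv; rewrite -(real_normK (num_real u)) ler_sqr ?nnegrE//; exact: le_trans uv.
have KB (u v : R) : `|u| <= K j -> `|v| <= B' -> `|u - v| <= K j + B'.
  by move=> h1 h2; rewrite (le_trans (ler_normB _ _))// lerD.
rewrite ler_pM2r ?invr_gt0 ?mulr_gt0//; apply: lerD; apply: sqle.
  rewrite (le_trans (ler_normB _ _))// lerD// (le_trans (ler_normB _ _))// /C -addrA lerD//.
    by rewrite normrM (ger0_norm ee) ler_wpM2l.
  by rewrite (le_trans (ler_normB _ _))// lerD// normrM (ger0_norm aa) ler_wpM2l// KB.
rewrite (le_trans (ler_normB _ _))// lerD// (le_trans (ler_normB _ _))//.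
rewrite /C -addrA lerD//; first by rewrite normrM (ger0_norm ee) ler_wpM2l.
rewrite normrM (ger0_norm aa) (@le_trans _ _ (adj P i l * (K j + B')))//.
  by rewrite ler_wpM2l// KB.
by rewrite lerDl mulr_ge0// addr_ge0.
Qed.

(** Any antiderivative will do, since only its increment over the last delay, the energy in transit,
    enters. *)
Definition is_storage (F : 'I_N -> 'I_N -> R -> R) :=
  forall i l, edge P i l -> pder 0 (F i l) (flux i l).

Lemma storage_exists : exists F, is_storage F.
Proof.
have ex (il : 'I_N * 'I_N) : exists F : R -> R,
    edge P il.1 il.2 -> pder 0 F (flux il.1 il.2).
  have [eil|_] := boolP (edge P il.1 il.2); last by exists (fun=> 0).
  have [F FP] := pcont_antiderivative (fun b => flux_pcont b eil) (fun b => flux_bounded b eil).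
  exists F => _; split=> [t t0|b]; first exact: (FP t t0).1.
  have [D cD] := flux_pcont b eil; exists D => t tb tD.
  by apply: (FP t _).2; [case/andP: tb|exact: cD].
have [F FP] := choice ex.
by exists (fun i l => F (i, l)) => i l; exact: (FP (i, l)).
Qed.

Variable F : 'I_N -> 'I_N -> R -> R.
Hypothesis FP : is_storage F.

(** The weights [1 / (2 c)] cancel the gains in the derivative, so the [nu] terms of the internal
    states add up to [(x - z) * nu]. *)
Definition agent_energy i t :=
  \sum_j \sum_k (rho (S t) i k j 0 - rest k j 0) ^+ 2 / (2 * gain P i k)
  + \sum_j (xi (S t) i j 0 - xc i j 0) ^+ 2 / 2
  + multiplier_energy (lam (S t) i) (lc i) + (mu (S t) i - mc i) ^+ 2 / 2.

Definition channel_energy i l t := F i l t - F i l (t - delay P i l).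

Definition energy t := \sum_i agent_energy i t +
  \sum_i \sum_(l | edge P i l) channel_energy i l t.

Definition agent_power i t :=
  \sum_j \sum_k (rho (S t) i k j 0 - rest k j 0) *
     (- (decay P i k * rho (S t) i k j 0) + gain P i k * nu P (S t) i j 0) / gain P i k
  + \sum_j (xi (S t) i j 0 - xc i j 0) * rx_gap P (S t) i j 0
  + (lam (S t) i ^+ 2 - lc i ^+ 2) * ineq P i (x i t)
  + (mu (S t) i - mc i) * equa P i (x i t).

Definition power t := \sum_i agent_power i t +
  \sum_i \sum_(l | edge P i l) (flux i l t - flux i l (t - delay P i l)).

Lemma agent_energy_pder i : pder 0 (agent_energy i) (agent_power i).
Proof.
have p1 : pder 0 (fun t => \sum_j \sum_k (rho (S t) i k j 0 - rest k j 0) ^+ 2 / (2 * gain P i k))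
   (fun t => \sum_j \sum_k (rho (S t) i k j 0 - rest k j 0) *
     (- (decay P i k * rho (S t) i k j 0) + gain P i k * nu P (S t) i j 0) / gain P i k).
  apply: pder_sum => j _; apply: pder_sum => k _.
  apply: pder_ext (pderZ (2 * gain P i k)^-1 (pder_sqr (rest k j 0) (rho_pder trajS i k j))) => t.
    by move=> _; field; rewrite gt_eqF.
  by rewrite mulrC.
have p2 : pder 0 (fun t => \sum_j (xi (S t) i j 0 - xc i j 0) ^+ 2 / 2)
   (fun t => \sum_j (xi (S t) i j 0 - xc i j 0) * rx_gap P (S t) i j 0).
  apply: pder_sum => j _.
  apply: pder_ext (pderZ 2^-1 (pder_sqr (xc i j 0) (xi_pder trajS i j))) => t.
    by move=> _; field.
  by rewrite mulrC.
have p3 : pder 0 (fun t => multiplier_energy (lam (S t) i) (lc i))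
   (fun t => (lam (S t) i ^+ 2 - lc i ^+ 2) * ineq P i (x i t)).
  have q1 := pder_sqr 0 (lam_pder trajS i).
  have q2 := pderZ (2 * lc i ^+ 2) (ln_lam_pder trajS g_diff lam0 i).
  apply: pder_ext (pderD (pderZ 4^-1 (pderB q1 q2))
    (pder_cst 0 ((2 * lc i ^+ 2 * ln (lc i) - lc i ^+ 2) / 4))) => t.
    by move=> _; rewrite /x; field.
  by rewrite /multiplier_energy; field.
have p4 : pder 0 (fun t => (mu (S t) i - mc i) ^+ 2 / 2)
   (fun t => (mu (S t) i - mc i) * equa P i (x i t)).
  apply: pder_ext (pderZ 2^-1 (pder_sqr (mc i) (mu_pder trajS i))) => t.
    by move=> _; rewrite /x; field.
  by rewrite mulrC.
exact: pderD (pderD (pderD p1 p2) p3) p4.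
Qed.

Lemma energy_pder : pder horizon energy power.
Proof.
apply: pderD; apply: pder_sum => i _.
  by apply: pder_sub (agent_energy_pder i); exact: horizon_ge0.
apply: pder_sum => l eil; apply: pderB.
  by apply: pder_sub (FP eil); exact: horizon_ge0.
have := pder_shift (delay P i l) (FP eil); rewrite add0r.
exact: pder_sub (delay_le_horizon eil).
Qed.

Definition dissipation t :=
  \sum_i \sum_j \sum_k decay P i k / gain P i k * (rho (S t) i k j 0 - rest k j 0) ^+ 2
  + \sum_i \sum_(l | edge P i l) \sum_j adj P i l * (rx i l t j 0 - x i t j 0) ^+ 2.

(** After [agent_dissipation], what is left of an agent's power is exchanged with its channels, and
    [scattering_power] splits it into damping, incoming and outgoing flux. The outgoing flux enters
    the stored energy; the incoming one is the neighbour's delayed flux, which leaves it. Both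
    cancel in the sum over edges. *)
Lemma power_le t : horizon <= t ->
  power t <= \sum_i lam (S t) i ^+ 2 * ineq P i z - dissipation t.
Proof.
move=> ht; have [lc_ge0 lcg hz stat] := centerP.
have rest_sum j : \sum_k rest k j 0 = z j 0.
  rewrite (bigD1 (Ordinal m_gt0))//= big1 ?addr0; first by rewrite /rest eqxx.
  move=> k; rewrite -val_eqE/= /rest => /negbTE ->; by rewrite mxE.
have agentE i : agent_power i t <=
    lam (S t) i ^+ 2 * ineq P i z
    - \sum_j \sum_k decay P i k / gain P i k * (rho (S t) i k j 0 - rest k j 0) ^+ 2
    + \sum_(l | edge P i l) \sum_j adj P i l *
       ((x i t j 0 - z j 0) * ((rx i l t j 0 - z j 0) - (x i t j 0 - z j 0))
        - (x i t j 0 - z j 0) * ((rv i l t j 0 - (xc i j 0 + xc l j 0) / 2) - (xi (S t) i j 0 - xc i j 0))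
        + (xi (S t) i j 0 - xc i j 0) * ((rx i l t j 0 - z j 0) - (x i t j 0 - z j 0))).
  have AD := agent_dissipation (x i t) (lam (S t) i) (mu (S t) i) (mc i)
    (f_convex i) (g_convex i) (h_affine i) (f_diff i) (g_diff i) (lcg i) (hz i).
  have storeE : \sum_j \sum_k (rho (S t) i k j 0 - rest k j 0) *
     (- (decay P i k * rho (S t) i k j 0) + gain P i k * nu P (S t) i j 0) / gain P i k =
     - \sum_j \sum_k decay P i k / gain P i k * (rho (S t) i k j 0 - rest k j 0) ^+ 2
     + \sum_j (x i t j 0 - z j 0) * nu P (S t) i j 0.
    rewrite -sumrN -big_split/=; apply: eq_bigr => j _.
    rewrite /x output_coord -rest_sum -sumrB mulr_suml -sumrN -big_split/=.
    (* For each [k] either the decay or the rest value is zero, so the decay acts on the deviation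
       [rho - rest]. *)
    apply: eq_bigr => k _; have [k0|k0] := eqVneq (k : nat) 0%N.
      by rewrite (b_first _ k0); field; rewrite gt_eqF.
    by rewrite /rest (negbTE k0) mxE; field; rewrite gt_eqF.
  have nuE j : nu P (S t) i j 0 =
     (- grad (obj P i) (x i t) j 0 - lam (S t) i ^+ 2 * grad (ineq P i) (x i t) j 0
       - mu (S t) i * grad (equa P i) (x i t) j 0
     + (grad (obj P i) z j 0 + lc i ^+ 2 * grad (ineq P i) z j 0 + mc i * grad (equa P i) z j 0))
     + (rx_gap P (S t) i j 0 - (rxi_gap P (S t) i j 0
         - \sum_(l | edge P i l) adj P i l * ((xc l j 0 - xc i j 0) / 2))).
    by rewrite nu_coord; have := stat i j; rewrite /x; lra.
  rewrite /agent_power storeE.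
  under [X in _ + X + _ + _ + _ <= _]eq_bigr do rewrite nuE mulrDr.
  rewrite big_split/=.
  have edgeE : \sum_j (x i t j 0 - z j 0) * (rx_gap P (S t) i j 0 - (rxi_gap P (S t) i j 0
         - \sum_(l | edge P i l) adj P i l * ((xc l j 0 - xc i j 0) / 2)))
      + \sum_j (xi (S t) i j 0 - xc i j 0) * rx_gap P (S t) i j 0 =
    \sum_(l | edge P i l) \sum_j adj P i l *
       ((x i t j 0 - z j 0) * ((rx i l t j 0 - z j 0) - (x i t j 0 - z j 0))
        - (x i t j 0 - z j 0) * ((rv i l t j 0 - (xc i j 0 + xc l j 0) / 2) - (xi (S t) i j 0 - xc i j 0))
        + (xi (S t) i j 0 - xc i j 0) * ((rx i l t j 0 - z j 0) - (x i t j 0 - z j 0))).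
    rewrite exchange_big -big_split/=; apply: eq_bigr => j _.
    rewrite rx_gap_coord rxi_gap_coord -!sumrB !mulr_sumr -big_split/=.
    by apply: eq_bigr => l _; rewrite /rx /rv /x; field.
  by rewrite -edgeE; move: AD; rewrite /x; lra.
have edge_power i l : edge P i l -> \sum_j adj P i l *
       ((x i t j 0 - z j 0) * ((rx i l t j 0 - z j 0) - (x i t j 0 - z j 0))
        - (x i t j 0 - z j 0) * ((rv i l t j 0 - (xc i j 0 + xc l j 0) / 2) - (xi (S t) i j 0 - xc i j 0))
        + (xi (S t) i j 0 - xc i j 0) * ((rx i l t j 0 - z j 0) - (x i t j 0 - z j 0))) =
     - (\sum_j adj P i l * (rx i l t j 0 - x i t j 0) ^+ 2)
     + \sum_j (inc_errx i l j t ^+ 2 + inc_errv i l j t ^+ 2) / (4 * eta P) - flux i l t.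
  move=> _; rewrite /flux -sumrN -big_split/= -sumrB; apply: eq_bigr => j _.
  rewrite (scattering_power _ _ _ _ _ eta_gt0); congr (- (_ * _) + _ / _ - _ / _).
  - by congr (_ ^+ 2); ring.
  - congr (_ ^+ 2 + _ ^+ 2).
      by rewrite /inc_errx /steadyx /incx /outx; field.
    by rewrite /inc_errv /steadyv /incv /outv; field.
  - congr (_ ^+ 2 + _ ^+ 2).
      by rewrite /out_errx /steadyx /outx; field.
    by rewrite /out_errv /steadyv /outv; field.
have delayE : \sum_i \sum_(l | edge P i l) flux i l (t - delay P i l) =
    \sum_i \sum_(l | edge P i l) \sum_j (inc_errx i l j t ^+ 2 + inc_errv i l j t ^+ 2) / (4 * eta P).
  rewrite [RHS](edge_swap e_sym); apply: eq_bigr => i _; apply: eq_bigr => l eil.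
  by rewrite flux_delay// (le_trans (delay_le_horizon eil)).
have sum_le : \sum_i agent_power i t <= \sum_i (
    lam (S t) i ^+ 2 * ineq P i z
    - \sum_j \sum_k decay P i k / gain P i k * (rho (S t) i k j 0 - rest k j 0) ^+ 2
    + \sum_(l | edge P i l) (- (\sum_j adj P i l * (rx i l t j 0 - x i t j 0) ^+ 2)
     + \sum_j (inc_errx i l j t ^+ 2 + inc_errv i l j t ^+ 2) / (4 * eta P) - flux i l t)).
  apply: ler_sum => i _; apply: le_trans (agentE i) _.
  by rewrite lerD2l (eq_bigr _ (edge_power i)).
rewrite /power; apply: le_trans (lerD sum_le (lexx _)) _.
have -> : \sum_i \sum_(l | edge P i l) (flux i l t - flux i l (t - delay P i l)) =
    \sum_i \sum_(l | edge P i l) flux i l t -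
    \sum_i \sum_(l | edge P i l) flux i l (t - delay P i l).
  by rewrite -sumrB; apply: eq_bigr => i _; rewrite -sumrB.
rewrite delayE /dissipation big_split sumrB/=.
under [X in _ - _ + X + _ <= _]eq_bigr do rewrite sumrB big_split/= sumrN.
by rewrite sumrB big_split/= sumrN; lra.
Qed.

Lemma channel_energy_ge0 i l t : edge P i l -> horizon < t -> 0 <= channel_energy i l t.
Proof.
move=> eil ht; have := pderZ (-1) (FP eil) => pF.
have := pder_le pF (_ : 0 < t - delay P i l) (_ : _ <= t) (K := 0).
rewrite mul0r subr_gt0 lerBlDr lerDl (delay_ge0 eil) (le_lt_trans (delay_le_horizon eil))//.
move=> /(_ isT isT) H; rewrite /channel_energy.
suff : -1 * F i l t - -1 * F i l (t - delay P i l) <= 0 by lra.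
by apply: H => r _; have := flux_ge0 i l r; lra.
Qed.

Lemma channel_energy_le i l t (K : R) : edge P i l -> horizon < t ->
  (forall r, t - delay P i l <= r <= t -> flux i l r <= K) ->
  channel_energy i l t <= K * delay P i l.
Proof.
move=> eil ht fK; have := pder_le (FP eil) (_ : 0 < t - delay P i l) (_ : _ <= t) (K := K).
rewrite subr_gt0 lerBlDr lerDl (delay_ge0 eil) (le_lt_trans (delay_le_horizon eil))//.
have -> : t - (t - delay P i l) = delay P i l by ring.
move=> /(_ isT isT); apply.
by move=> r /andP[r1 r2]; apply: fK; rewrite !ltW.
Qed.

Lemma energy_lower t : horizon < t -> forall i,
  [/\ forall k j, (rho (S t) i k j 0 - rest k j 0) ^+ 2 / (2 * gain P i k) <= energy t,
      forall j, (xi (S t) i j 0 - xc i j 0) ^+ 2 / 2 <= energy t,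
      (lam (S t) i - lc i) ^+ 2 / 4 <= energy t,
      (mu (S t) i - mc i) ^+ 2 / 2 <= energy t & 0 <= energy t].
Proof.
move=> ht i; have t0 : 0 <= t by rewrite ltW// (le_lt_trans horizon_ge0).
have [lc_ge0 _ _ _] := centerP.
have r0 i' k j : 0 <= (rho (S t) i' k j 0 - rest k j 0) ^+ 2 / (2 * gain P i' k).
  by rewrite divr_ge0 ?sqr_ge0// mulr_ge0// ltW.
have r1 i' : 0 <= \sum_j \sum_k (rho (S t) i' k j 0 - rest k j 0) ^+ 2 / (2 * gain P i' k).
  by apply: sumr_ge0 => j _; apply: sumr_ge0.
have s0 (y w : R) : 0 <= (y - w) ^+ 2 / 2 by rewrite divr_ge0 ?sqr_ge0.
have s1 i' : 0 <= \sum_j (xi (S t) i' j 0 - xc i' j 0) ^+ 2 / 2 by apply: sumr_ge0.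
have l0 i' : (lam (S t) i' - lc i') ^+ 2 / 4 <= multiplier_energy (lam (S t) i') (lc i').
  exact: multiplier_energy_ge (lam_gt0 trajS g_diff lam0 i' t0) (lc_ge0 i').
have l1 i' : 0 <= (lam (S t) i' - lc i') ^+ 2 / 4 by rewrite divr_ge0 ?sqr_ge0.
have a0 i' : 0 <= agent_energy i' t.
  by rewrite /agent_energy; have := r1 i'; have := s1 i'; have := l0 i'; have := l1 i';
    have := s0 (mu (S t) i') (mc i'); lra.
have aE : agent_energy i t <= energy t.
  rewrite /energy (bigD1 i)//= -addrA lerDl addr_ge0//; first exact: sumr_ge0.
  by apply: sumr_ge0 => i' _; apply: sumr_ge0 => l el; exact: channel_energy_ge0.
have e0 := le_trans (a0 i) aE.
have rE k j : (rho (S t) i k j 0 - rest k j 0) ^+ 2 / (2 * gain P i k) <=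
    \sum_j \sum_k (rho (S t) i k j 0 - rest k j 0) ^+ 2 / (2 * gain P i k).
  rewrite (bigD1 j)//= (bigD1 k)//= -addrA lerDl addr_ge0//; first exact: sumr_ge0.
  by apply: sumr_ge0 => j' _; apply: sumr_ge0.
have sE j : (xi (S t) i j 0 - xc i j 0) ^+ 2 / 2 <= \sum_j (xi (S t) i j 0 - xc i j 0) ^+ 2 / 2.
  by rewrite (bigD1 j)//= lerDl sumr_ge0.
move: aE; rewrite /agent_energy => aE.
have := r1 i; have := s1 i; have := l0 i; have := l1 i;
    have := s0 (mu (S t) i) (mc i) => h1 h2 h3 h4 h5.
split=> //.
- by move=> k j; have := rE k j; lra.
- by move=> j; have := sE j; lra.
- by lra.
- by lra.
Qed.

End Lyapunov.

(** * Convergence *)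

(** [c] is the infimum of the times from [s] on at which [u] is at least [d]. *)
Lemma first_hit (R : realType) (u : R -> R) (a s t d : R) :
  (forall r, a < r -> {for r, continuous u}) -> a < s -> s <= t ->
  u s < d -> d <= u t ->
  exists c, [/\ s <= c, u c = d & forall r, s <= r <= c -> u r <= d].
Proof.
move=> cu sa st us ut.
pose A := [set r | s <= r /\ d <= u r].
have hA : has_inf A by split; [exists t|exists s => r []].
have sA : s <= inf A by apply: lb_le_inf; [exact: hA.1|move=> r []].
have cA : {for (inf A), continuous u} by apply: cu; exact: lt_le_trans sA.
have before r : s <= r -> r < inf A -> u r < d.
  move=> sr rA; rewrite ltNge; apply/negP => dr.
  by have := ge_inf hA.2 (conj sr dr : A r); rewrite leNgt rA.
have ge : d <= u (inf A).
  rewrite leNgt; apply/negP => lt.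
  have nb : \forall r \near inf A, u r < d by exact: (cvgr_lt _ cA _ lt).
  have /nbhs_ballP[e /= e0 eP] := nb.
  have [r [sr dr] re] := inf_adherent e0 hA.
  have rA : inf A <= r by apply: ge_inf => //; exact: hA.2.
  have : u r < d by apply: eP; rewrite /ball/= distrC ger0_norm ?subr_ge0// ltrBlDl.
  by rewrite ltNge dr.
have le : u (inf A) <= d.
  rewrite leNgt; apply/negP => gt.
  have sA' : s < inf A.
    rewrite lt_neqAle sA andbT; apply/eqP => sE.
    by have := lt_trans us gt; rewrite -sE ltxx.
  have nb : \forall r \near inf A, d < u r by exact: (cvgr_gt _ cA _ gt).
  have /nbhs_ballP[e /= e0 eP] := nb.
  pose r := Num.max s (inf A - e / 2).
  have rA : r < inf A by rewrite gt_max sA' ltrBlDr ltrDl divr_gt0.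
  have sr : s <= r by rewrite le_max lexx.
  have := before r sr rA; rewrite ltNge => /negP; apply; apply: ltW; apply: eP.
  have h : inf A - e / 2 <= r by rewrite le_max lexx orbT.
  clearbody r; rewrite /ball/= ger0_norm; last by rewrite subr_ge0 ltW.
  by move: e0; lra.
have eq : u (inf A) = d by apply/eqP; rewrite eq_le le.
exists (inf A); split=> // r /andP[sr].
by rewrite le_eqVlt => /predU1P[->|/(before _ sr)/ltW //]; rewrite eq.
Qed.

Lemma eq_limit (R : realType) (T : Type) (F : set_system T) (FF : ProperFilter F) (u : T -> R) (a b : R) :
  u t @[t --> F] --> a -> u t @[t --> F] --> b -> a = b.
Proof. by move=> /(cvg_lim (@Rhausdorff R)) <- /(cvg_lim (@Rhausdorff R)). Qed.

(** Nothing here mentions a centre of the energy: the facts are proved with an optimal centre and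
    used with another one. *)
Record settling (R : realType) (N n m : nat) (P : system R N n m)
    (S : R -> state R N n m) : Prop := Settling {
  settling_bounded : exists B : R, forall t, 0 <= t -> forall i,
    [/\ forall k j, `|rho (S t) i k j 0| <= B, forall j, `|output (S t) i j 0| <= B,
        forall j, `|xi (S t) i j 0| <= B, `|lam (S t) i| <= B & `|mu (S t) i| <= B];
  settling_rho : forall i (k : 'I_m) j, k <> 0%N :> nat ->
    rho (S t) i k j 0 @[t --> +oo] --> 0;
  settling_x_slow : forall i j, slow (fun t => output (S t) i j 0);
  settling_xi_slow : forall i j, slow (fun t => xi (S t) i j 0);
  settling_signal : forall i l j, edge P i l ->
    usubmx (rsig (S t) i l) j 0 - (output (S t) i j 0 + output (S t) l j 0) / 2
      @[t --> +oo] --> 0 /\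
    dsubmx (rsig (S t) i l) j 0 - (xi (S t) i j 0 + xi (S t) l j 0) / 2
      @[t --> +oo] --> 0;
  settling_consensus : forall i l j, edge P i l ->
    output (S t) l j 0 - output (S t) i j 0 @[t --> +oo] --> 0;
  settling_rx_gap : forall i j, rx_gap P (S t) i j 0 @[t --> +oo] --> 0;
  settling_equa : forall i, equa P i (output (S t) i) @[t --> +oo] --> 0;
  settling_lam : forall i, lam (S t) i * ineq P i (output (S t) i) @[t --> +oo] --> 0;
  settling_nu : forall i j, nu P (S t) i j 0 @[t --> +oo] --> 0
}.

Section Attractor.
Variables (R : realType) (N n m : nat) (P : system R N n m).
Variable S : R -> state R N n m.
Hypothesis trajS : trajectory P S.
Hypothesis f_convex : forall i, convex_function setT (obj P i).
Hypothesis f_diff : forall i, twice_differentiable (obj P i).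
Hypothesis g_convex : forall i, convex_function setT (ineq P i).
Hypothesis g_diff : forall i, twice_differentiable (ineq P i).
Hypothesis h_affine : forall i, affine (equa P i).
Hypothesis graphP : undirected_connected_graph P.
Hypothesis m_ge2 : (2 <= m)%N.
Hypothesis b_first : forall i (k : 'I_m), k = 0%N :> nat -> decay P i k = 0.
Hypothesis b_pos : forall i (k : 'I_m), k <> 0%N :> nat -> 0 < decay P i k.
Hypothesis c_gt0 : forall i k, 0 < gain P i k.
Hypothesis eta_gt0 : 0 < eta P.
Hypothesis delay_ge0 : forall i l, edge P i l -> 0 <= delay P i l.
Hypothesis lam0 : forall i, 0 < lam (S 0) i.

Let m_gt0 : (0 < m)%N. Proof. exact: ltnW. Qed.
Let e_sym : symmetric (edge P). Proof. by case: graphP. Qed.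
Let a_sym i l : edge P i l -> adj P i l = adj P l i.
Proof. by case: graphP => _ _ _ aP _ /aP[]. Qed.
Let a_gt0 i l : edge P i l -> 0 < adj P i l.
Proof. by case: graphP => _ _ _ aP _ /aP[]. Qed.
Let df i z : differentiable (obj P i) z. Proof. by have [] := f_diff i. Qed.
Let dg i z : differentiable (ineq P i) z. Proof. by have [] := g_diff i. Qed.
Let cgrad_f i j : continuous (fun z => grad (obj P i) z j 0).
Proof.
move=> z; have [_ d] := f_diff i.
have h : {for z, continuous (grad (obj P i))} by exact: differentiable_continuous (d z).
exact: (@cvg_coord _ _ _ _ n 1 (grad (obj P i)) (grad (obj P i) z) j 0 h).
Qed.
Let cgrad_g i j : continuous (fun z => grad (ineq P i) z j 0).
Proof.
move=> z; have [_ d] := g_diff i.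
have h : {for z, continuous (grad (ineq P i))} by exact: differentiable_continuous (d z).
exact: (@cvg_coord _ _ _ _ n 1 (grad (ineq P i)) (grad (ineq P i) z) j 0 h).
Qed.
Let cg i : continuous (ineq P i).
Proof. by move=> z; exact: differentiable_continuous (dg i z). Qed.

Let x i t : 'cV[R]_n := output (S t) i.
Let rx i l t : 'cV[R]_n := usubmx (rsig (S t) i l).
Let rv i l t : 'cV[R]_n := dsubmx (rsig (S t) i l).

Lemma energy_power z xc lc mc F : stationary P z xc lc mc -> is_storage P S z xc F ->
  [/\ pder (horizon P) (energy P S z xc lc mc F) (power P S z xc lc mc),
      forall t, horizon P < t -> power P S z xc lc mc t <=
        \sum_i lam (S t) i ^+ 2 * ineq P i z - dissipation P S z t &
      forall t, horizon P < t -> 0 <= dissipation P S z t].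
Proof.
move=> st FP; split.
- exact: energy_pder.
- move=> t ht.
  exact: (power_le trajS f_convex df g_convex dg h_affine graphP m_gt0 b_first c_gt0 eta_gt0 delay_ge0 st (ltW ht)).
- move=> t _; apply: addr_ge0.
    apply: sumr_ge0 => i _; apply: sumr_ge0 => j _; apply: sumr_ge0 => k _.
    rewrite mulr_ge0 ?sqr_ge0// divr_ge0 ?(ltW (c_gt0 _ _))//.
    by have [/b_first ->//|/b_pos/ltW] := pselect (k = 0%N :> nat).
  apply: sumr_ge0 => i _; apply: sumr_ge0 => l el; apply: sumr_ge0 => j _.
  by rewrite mulr_ge0 ?sqr_ge0// ltW// a_gt0.
Qed.

(** * Asymptotics from an optimal centre *)

Section Saddle.
Variables (z : 'cV[R]_n) (xc : 'I_N -> 'cV[R]_n) (lc mc : 'I_N -> R).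
Hypothesis centerP : stationary P z xc lc mc.
Hypothesis z_feas : forall i, ineq P i z <= 0.
Variable F : 'I_N -> 'I_N -> R -> R.
Hypothesis FP : is_storage P S z xc F.

Let V := energy P S z xc lc mc F.
Let dV := power P S z xc lc mc.
Let pV : pder (horizon P) V dV. Proof. by have [] := energy_power centerP FP. Qed.
Let diss_ge0 t : horizon P < t -> 0 <= dissipation P S z t.
Proof. by have [_ _] := energy_power centerP FP; apply. Qed.
Let dV_le t : horizon P < t -> dV t <= - dissipation P S z t.
Proof.
move=> ht; have [_ /(_ t ht) + _] := energy_power centerP FP => /le_trans; apply.
rewrite gerDr; apply: sumr_le0 => i _.
by rewrite mulr_ge0_le0 ?sqr_ge0.
Qed.
Let dV_le0 t : horizon P < t -> dV t <= 0.
Proof.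
by move=> ht; rewrite (le_trans (dV_le ht))// oppr_le0 diss_ge0.
Qed.
Let low t (ht : horizon P < t) := energy_lower trajS dg c_gt0 eta_gt0 delay_ge0 lam0 centerP FP ht.

Lemma states_bounded : exists B : R, forall t, 0 <= t -> forall i,
  [/\ forall k j, `|rho (S t) i k j 0| <= B, forall j, `|x i t j 0| <= B,
      forall j, `|xi (S t) i j 0| <= B, `|lam (S t) i| <= B & `|mu (S t) i| <= B].
Proof.
pose I := (('I_N * 'I_m * 'I_n) + ('I_N * 'I_n) + ('I_N * 'I_n) + 'I_N + 'I_N)%type.
pose y (c : I) t := match c with
  | inl (inl (inl (inl (i, k, j)))) => rho (S t) i k j 0
  | inl (inl (inl (inr (i, j)))) => x i t j 0
  | inl (inl (inr (i, j))) => xi (S t) i j 0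
  | inl (inr i) => lam (S t) i
  | inr i => mu (S t) i end.
suff H (c : I) : exists B : R, forall t, 0 <= t -> `|y c t| <= B.
  have [B Bd] := choice H; exists (\sum_c `|B c|) => t t0 i.
  have bd c : `|y c t| <= \sum_c `|B c|.
    apply: le_trans (Bd c t t0) _; rewrite (bigD1 c)//= (le_trans (ler_norm _))//.
    by rewrite lerDl sumr_ge0.
  split=> [k j|j|j||].
  - exact: (bd (inl (inl (inl (inl (i, k, j)))))).
  - exact: (bd (inl (inl (inl (inr (i, j)))))).
  - exact: (bd (inl (inl (inr (i, j))))).
  - exact: (bd (inl (inr i))).
  - exact: (bd (inr i)).
pose t1 := horizon P + 1.
have ht1 : horizon P < t1 by rewrite ltrDl.
(* The energy controls the states only past [horizon]; before that, continuity on a compact interval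
   does. *)
have early (u : R -> R) : {within `[0, +oo[, continuous u} ->
    (exists B : R, forall t, t1 <= t -> `|u t| <= B) ->
    exists B : R, forall t, 0 <= t -> `|u t| <= B.
  move=> /within_bounded/(_ t1)[B1 h1] [B2 h2]; exists (`|B1| + `|B2|) => t t0.
  have [tt1|tt1] := leP t t1.
    rewrite (le_trans (h1 t _)) ?t0//.
    by rewrite (le_trans (ler_norm _))// lerDl.
  by rewrite (le_trans (h2 t (ltW tt1)))// (le_trans (ler_norm _))// lerDr.
have V1 t : t1 <= t -> V t <= V t1.
  move=> tt; have := pder_le pV ht1 tt (K := 0); rewrite mul0r subr_le0; apply.
  by move=> r /andP[r1 _]; apply: dV_le0; exact: lt_trans r1.
have sq (w d K : R) : 0 < d -> (w ^+ 2) / d <= K -> `|w| <= K * d + 1.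
  move=> d0; rewrite ler_pdivrMr// => h.
  have h1 : 0 <= (w - 1) ^+ 2 by exact: sqr_ge0.
  have h2 : 0 <= (w + 1) ^+ 2 by exact: sqr_ge0.
  have h3 : 0 <= w ^+ 2 by exact: sqr_ge0.
  by rewrite ler_norml; apply/andP; split; lra.
have sh (u : R -> R) (w d : R) : 0 < d -> (forall t, t1 <= t -> (u t - w) ^+ 2 / d <= V t) ->
    exists B : R, forall t, t1 <= t -> `|u t| <= B.
  move=> d0 h; exists (V t1 * d + 1 + `|w|) => t tt.
  have := sq _ _ _ d0 (le_trans (h t tt) (V1 t tt)) => hw.
  by rewrite -(subrK w (u t)) (le_trans (ler_normD _ _))// lerD2r.
have [ct _ _] := trajS.
have late t : t1 <= t -> horizon P < t by exact: lt_le_trans.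
have rb i k j : exists B : R, forall t, 0 <= t -> `|rho (S t) i k j 0| <= B.
  apply: early; first by have [/(_ k) cc _ _ _] := ct i; exact: (@within_coord _ _ _ j cc).
  apply: (sh (fun t => rho (S t) i k j 0) (rest z k j 0) (2 * gain P i k)); first by rewrite mulr_gt0.
  by move=> t /late ht; have [h _ _ _ _] := low ht i; exact: h.
case: c => [[[[[[i k] j]|[i j]]|[i j]]|i]|i]; rewrite /y.
- exact: rb.
- have [B Bd] := choice (fun k => rb i k j).
  exists (\sum_k B k) => t t0; rewrite /x output_coord.
  by apply: le_trans (ler_norm_sum _ _ _) _; apply: ler_sum => k _; exact: Bd.
- apply: early; first by have [_ cc _ _] := ct i; exact: (@within_coord _ _ _ j cc).
  apply: (sh (fun t => xi (S t) i j 0) (xc i j 0) 2) => // t /late ht; have [_ h _ _ _] := low ht i; exact: h.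
- apply: early; first by have [_ _ cc _] := ct i.
  by apply: (sh (fun t => lam (S t) i) (lc i) 4) => // t /late ht; have [_ _ h _ _] := low ht i; exact: h.
- apply: early; first by have [_ _ _ cc] := ct i.
  by apply: (sh (fun t => mu (S t) i) (mc i) 2) => // t /late ht; have [_ _ _ h _] := low ht i; exact: h.
Qed.

Lemma signals_bounded : exists K : R, forall t, 0 <= t -> forall i l j, edge P i l ->
  `|rx i l t j 0| <= K /\ `|rv i l t j 0| <= K.
Proof.
have [B bd] := states_bounded.
have ex (c : 'I_N * 'I_N * 'I_n) : exists K : R, forall t, 0 <= t -> edge P c.1.1 c.1.2 ->
    `|rx c.1.1 c.1.2 t c.2 0| <= K /\ `|rv c.1.1 c.1.2 t c.2 0| <= K.
  have [el|_] := boolP (edge P c.1.1 c.1.2); last by exists 0.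
  have B0 : 0 <= B.
    by have [_ h _ _ _] := bd 0 (lexx 0) c.1.1; exact: le_trans (h c.2).
  have [K KP] := signal_bounded trajS graphP eta_gt0 delay_ge0 c.2 el B0.
  exists K => t t0 _; apply: (KP t) => [r /andP[r0 _] i|]; last by rewrite t0 lexx.
  by have [_ h1 h2 _ _] := bd r r0 i.
have [K KP] := choice ex; exists (\sum_c `|K c|) => t t0 i l j el.
have [h1 h2] := KP (i, l, j) t t0 el.
have KK : K (i, l, j) <= \sum_c `|K c|.
  by rewrite (bigD1 (i, l, j))//= (le_trans (ler_norm _))// lerDl sumr_ge0.
by split; [exact: le_trans h1 KK|exact: le_trans h2 KK].
Qed.

Lemma nu_bounded i j : exists K : R, forall t, 0 <= t -> `|nu P (S t) i j 0| <= K.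
Proof.
have [B bd] := states_bounded; have [K sb] := signals_bounded.
have [Kf kf] := box_bounded B (@cgrad_f i j).
have [Kg kg] := box_bounded B (@cgrad_g i j).
have [c [hc _]] := affine_grad (h_affine i).
exists (Kf + B ^+ 2 * Kg + B * `|c j 0| + (\sum_(l | edge P i l) adj P i l * (K + B))
  + (\sum_(l | edge P i l) adj P i l * (K + B))) => t t0.
have [_ xb vb lb mb] := bd t t0 i.
rewrite nu_coord; apply: le_trans (ler_normB _ _) _; apply: lerD; last first.
  rewrite rxi_gap_coord; apply: le_trans (ler_norm_sum _ _ _) _; apply: ler_sum => l el.
  rewrite normrM gtr0_norm ?a_gt0// ler_pM2l ?a_gt0// (le_trans (ler_normB _ _))// lerD//.
  by have [_] := sb t t0 i l j el.
apply: le_trans (ler_normD _ _) _; apply: lerD; last first.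
  rewrite rx_gap_coord; apply: le_trans (ler_norm_sum _ _ _) _; apply: ler_sum => l el.
  rewrite normrM gtr0_norm ?a_gt0// ler_pM2l ?a_gt0// (le_trans (ler_normB _ _))// lerD//.
  by have [] := sb t t0 i l j el.
apply: le_trans (ler_normB _ _) _; apply: lerD; last first.
  by rewrite normrM hc ler_wpM2r.
apply: le_trans (ler_normB _ _) _; apply: lerD.
  by rewrite normrN; exact: kf.
rewrite normrM normrX; apply: ler_pM => //; last exact: kg.
by apply: lerXn2r => //; rewrite ?nnegrE// (le_trans _ lb).
Qed.

Lemma rho_vanish i (k : 'I_m) j : k <> 0%N :> nat -> rho (S t) i k j 0 @[t --> +oo] --> 0.
Proof.
move=> k0; have b0 := b_pos i k0.
have r0 : rest z k j 0 = 0.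
  by rewrite /rest; case: eqP => // _; rewrite mxE.
have V0 t : horizon P < t -> 0 <= V t by move=> /low/(_ i)[].
have [K nK] := nu_bounded i j; have [B bd] := states_bounded.
apply: (barbalat pV V0 (divr_gt0 b0 (c_gt0 i k))).
  move=> t ht; apply: le_trans (dV_le ht) _; rewrite lerN2 /dissipation.
  rewrite (bigD1 i)//= (bigD1 j)//= (bigD1 k)//= r0 subr0 -!addrA lerDl.
  have nn i' j' k' : 0 <= decay P i' k' / gain P i' k' * (rho (S t) i' k' j' 0 - rest z k' j' 0) ^+ 2.
    rewrite mulr_ge0 ?sqr_ge0// divr_ge0 ?(ltW (c_gt0 _ _))//.
    by have [/b_first ->//|/b_pos/ltW] := pselect (k' = 0%N :> nat).
  rewrite addr_ge0 ?sumr_ge0//; rewrite addr_ge0 ?sumr_ge0//.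
    by move=> j' _; rewrite sumr_ge0.
  rewrite addr_ge0 ?sumr_ge0//.
    by move=> i' _; rewrite sumr_ge0// => j' _; rewrite sumr_ge0.
  move=> i' _; rewrite sumr_ge0// => l el; rewrite sumr_ge0// => j' _.
  by rewrite mulr_ge0 ?sqr_ge0// ltW// a_gt0.
apply: (lipschitz_luc (K := decay P i k * B + gain P i k * K) (rho_pder trajS i k j)) => t t0.
have [rb _ _ _ _] := bd t (ltW t0) i.
apply: le_trans (ler_normD _ _) _; rewrite normrN !normrM (gtr0_norm b0) (gtr0_norm (c_gt0 i k)).
by apply: lerD; rewrite ler_pM2l// nK// ltW.
Qed.

(** After division by the gains, the difference of the equations for [k = 0] and [k1] is free of
    [nu], and its right-hand side is a multiple of the vanishing [rho_k1]. This is what the second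
    internal state is for. *)
Lemma rho_slow i k j : slow (fun t => rho (S t) i k j 0).
Proof.
have [k0|k0] := pselect (k = 0%N :> nat); last exact/slow_vanish/rho_vanish.
pose k1 := Ordinal m_ge2; have k10 : k1 <> 0%N :> nat by [].
have p := pderB (pderZ (gain P i k)^-1 (rho_pder trajS i k j))
                (pderZ (gain P i k1)^-1 (rho_pder trajS i k1 j)).
have sd : slow (fun t => (gain P i k)^-1 * rho (S t) i k j 0 - (gain P i k1)^-1 * rho (S t) i k1 j 0).
  apply: (pder_slow p).
  apply: eq_vanish (vanishZ (decay P i k1 / gain P i k1) (rho_vanish i j k10)) => t.
  by rewrite (b_first i k0); field; rewrite !gt_eqF.
apply: eq_slow (slowZ (gain P i k) (slowD sd (slowZ (gain P i k1)^-1 (slow_vanish (rho_vanish i j k10))))) => t.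
by field; rewrite !gt_eqF.
Qed.

Lemma x_slow i j : slow (fun t => x i t j 0).
Proof.
apply: eq_slow (@slow_sum _ _ (index_enum 'I_m) xpredT (fun k t => rho (S t) i k j 0) (fun k _ => rho_slow i k j)) => t.
by rewrite /x output_coord.
Qed.

Let dissipation_edges t i j : horizon P < t ->
  \sum_(l | edge P i l) adj P i l * (rx i l t j 0 - x i t j 0) ^+ 2 <= - dV t.
Proof.
move=> ht; rewrite lerNr (le_trans (dV_le ht))// lerN2 /dissipation.
have sq_ge0 i' l j' : edge P i' l -> 0 <= adj P i' l * (rx i' l t j' 0 - x i' t j' 0) ^+ 2.
  by move=> el; rewrite mulr_ge0 ?sqr_ge0// ltW// a_gt0.
apply: (@le_trans _ _ (\sum_i \sum_(l | edge P i l) \sum_j adj P i l * (rx i l t j 0 - x i t j 0) ^+ 2)).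
  rewrite [leRHS](bigD1 i)//= -[leLHS]addr0 lerD//.
    apply: ler_sum => l el; rewrite [leRHS](bigD1 j)//= lerDl sumr_ge0// => j' _.
    exact: sq_ge0.
  apply: sumr_ge0 => i' _; apply: sumr_ge0 => l el; apply: sumr_ge0 => j' _.
  exact: sq_ge0.
rewrite lerDr; apply: sumr_ge0 => i' _; apply: sumr_ge0 => j' _; apply: sumr_ge0 => k _.
rewrite mulr_ge0 ?sqr_ge0// divr_ge0 ?(ltW (c_gt0 _ _))//.
by have [/b_first ->//|/b_pos/ltW] := pselect (k = 0%N :> nat).
Qed.

(** On each edge [|d| <= k + d ^+ 2 / k] for the gap [d]. The regularity of [rx] that Barbalat's
    lemma would ask for is itself derived from this lemma. *)
Lemma xi_slow i j : slow (fun t => xi (S t) i j 0).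
Proof.
have V0 t : horizon P < t -> 0 <= V t by move=> /low/(_ i)[].
have A0 : 0 <= \sum_(l | edge P i l) adj P i l.
  by apply: sumr_ge0 => l el; rewrite ltW// a_gt0.
apply: (slow_of_dissipation pV (pder_sub (horizon_ge0 delay_ge0) (xi_pder trajS i j)) V0 A0).
move=> k t k0 ht; rewrite rx_gap_coord.
apply: le_trans (ler_norm_sum _ _ _) _.
apply: (@le_trans _ _ (\sum_(l | edge P i l)
    (k * adj P i l + adj P i l * (rx i l t j 0 - x i t j 0) ^+ 2 / k))).
  apply: ler_sum => l el; rewrite normrM gtr0_norm ?a_gt0//.
  rewrite [k * _]mulrC -mulrA -mulrDr ler_pM2l ?a_gt0// /rx /x.
  set d := _ - _; rewrite -(real_normK (num_real d)).
  set q := `|d|; have q0 : 0 <= q by exact: normr_ge0.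
  rewrite -subr_ge0 (_ : _ - _ = ((q - k) ^+ 2 + q * k) / k).
    by rewrite divr_ge0 ?addr_ge0 ?sqr_ge0 ?mulr_ge0// ltW.
  by field; rewrite gt_eqF.
rewrite big_split/= -mulr_sumr lerD2l -mulr_suml -mulNr ler_pM2r ?invr_gt0//.
exact: dissipation_edges.
Qed.

Lemma signal_vanish i l j : edge P i l ->
  rx i l t j 0 - (x i t j 0 + x l t j 0) / 2 @[t --> +oo] --> 0 /\
  rv i l t j 0 - (xi (S t) i j 0 + xi (S t) l j 0) / 2 @[t --> +oo] --> 0.
Proof.
move=> eil; have eli : edge P l i by rewrite e_sym.
have L1 := edge_link trajS graphP eta_gt0 j eil.
have := edge_link trajS graphP eta_gt0 j eli; rewrite -(a_sym eil) => L2.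
have [B bd] := states_bounded.
have B0 : 0 <= B.
  by have [_ h _ _ _] := bd 0 (lexx 0) i; exact: le_trans (h j).
apply: (link_vanish (a_gt0 eil) eta_gt0 (delay_ge0 eil) (delay_ge0 eli) L1 L2 B0).
- by move=> t t0; have [_ h1 h2 _ _] := bd t t0 i; have [_ h3 h4 _ _] := bd t t0 l.
- exact: x_slow.
- exact: xi_slow.
- exact: x_slow.
- exact: xi_slow.
Qed.

Lemma rx_slow i l j : edge P i l -> slow (fun t => rx i l t j 0).
Proof.
move=> el; have [/slow_vanish h _] := signal_vanish j el.
apply: eq_slow (slowD h (slowZ 2^-1 (slowD (x_slow i j) (x_slow l j)))) => t.
by field.
Qed.

Lemma rv_slow i l j : edge P i l -> slow (fun t => rv i l t j 0).
Proof.
move=> el; have [_ /slow_vanish h] := signal_vanish j el.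
apply: eq_slow (slowD h (slowZ 2^-1 (slowD (xi_slow i j) (xi_slow l j)))) => t.
by field.
Qed.

(** Barbalat's lemma, available now that the channel has made [rx] slow. *)
Lemma gap_vanish i l j : edge P i l -> rx i l t j 0 - x i t j 0 @[t --> +oo] --> 0.
Proof.
move=> el; have V0 t : horizon P < t -> 0 <= V t by move=> /low/(_ i)[].
apply: (barbalat pV V0 (a_gt0 el)); last first.
  by apply: slow_luc; apply: slowB; [exact: rx_slow|exact: x_slow].
move=> t ht; rewrite lerNr; apply: le_trans (dissipation_edges i j ht).
rewrite (bigD1 l)//= lerDl; apply: sumr_ge0 => l' /andP[el' _].
by rewrite mulr_ge0 ?sqr_ge0// ltW// a_gt0.
Qed.

(** [rx] is asymptotic both to the state of [i] and to the mean of the two states. *)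
Lemma consensus i l j : edge P i l -> x l t j 0 - x i t j 0 @[t --> +oo] --> 0.
Proof.
move=> el; have [h _] := signal_vanish j el.
by apply: eq_vanish (vanishZ 2 (vanishB (gap_vanish j el) h)) => t; field.
Qed.

Lemma rx_gap_vanish i j : rx_gap P (S t) i j 0 @[t --> +oo] --> 0.
Proof.
apply: eq_vanish (@vanish_sum _ _ (index_enum 'I_N) (edge P i)
  (fun l t => adj P i l * (rx i l t j 0 - x i t j 0)) _) => [t|l el].
  by rewrite rx_gap_coord.
by apply: vanishZ; exact: gap_vanish.
Qed.

Let near_bounded (u : R -> R) (B : R) : (forall t, 0 <= t -> `|u t| <= B) ->
  \forall t \near +oo, `|u t| <= B.
Proof. by move=> uB; apply: filterS (near_ge 0) => t; exact: uB. Qed.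

Lemma equa_vanish i : equa P i (x i t) @[t --> +oo] --> 0.
Proof.
have [B bd] := states_bounded.
apply: (pder_vanish (B := B) (mu_pder trajS i)).
  by apply: near_bounded => t /bd/(_ i)[].
have [c [_ hE]] := affine_grad (h_affine i).
apply: eq_slow (slowD (slow_cst (equa P i 0)) (slow_sum (index_enum 'I_n) (P := xpredT)
  (fun j _ => slowZ (c j 0) (x_slow i j)))) => t.
by rewrite (hE 0 (output (S t) i)) subr0.
Qed.

Lemma near_box i : exists B : R, \forall t \near +oo, in_box B (x i t).
Proof.
have [B bd] := states_bounded; exists B.
by apply: filterS (near_ge 0) => t /bd/(_ i)[].
Qed.

Lemma ineq_slow i : slow (fun t => ineq P i (x i t)).
Proof. by have [B bd] := near_box i; exact: (@slow_comp _ _ (ineq P i) (x i) B (@cg i) bd (x_slow i)). Qed.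

Lemma ineq_bounded i : exists G : R, \forall t \near +oo, `|ineq P i (x i t)| <= G.
Proof.
have [B bd] := near_box i; have [K KP] := box_bounded B (@cg i).
by exists K; apply: filterS bd => t; exact: KP.
Qed.

Lemma complementarity i : lam (S t) i * ineq P i (x i t) @[t --> +oo] --> 0.
Proof.
have [G gG] := ineq_bounded i; have [B bd] := states_bounded.
have lE t : 0 <= t -> expR (ln (lam (S t) i)) = lam (S t) i.
  by move=> t0; rewrite lnK// posrE; exact: (lam_gt0 trajS dg lam0 i t0).
have := exp_mul_vanish (ln_lam_pder trajS dg lam0 i) (ineq_slow i) gG (B := B).
move=> H; apply: cvg_trans (H _).
  by apply: near_eq_cvg; apply: filterS (near_ge 0) => t t0; rewrite lE.
apply: filterS (near_ge 0) => t t0; rewrite lE//.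
by have [_ _ _ h _] := bd t t0 i; exact: le_trans (ler_norm _) h.
Qed.

Lemma lam_slow i : slow (fun t => lam (S t) i).
Proof.
apply: (pder_slow (lam_pder trajS i)).
by apply: eq_vanish (vanishZ 2 (complementarity i)) => t; rewrite mulrA.
Qed.

Lemma mu_slow i : slow (fun t => mu (S t) i).
Proof. exact: pder_slow (mu_pder trajS i) (equa_vanish i). Qed.

Lemma nu_slow i j : slow (fun t => nu P (S t) i j 0).
Proof.
have [B bd] := near_box i; have [B' bd'] := states_bounded.
have sf : slow (fun t => grad (obj P i) (x i t) j 0).
  exact: (@slow_comp _ _ (fun z => grad (obj P i) z j 0) (x i) B (@cgrad_f i j) bd (x_slow i)).
have sg : slow (fun t => grad (ineq P i) (x i t) j 0).
  exact: (@slow_comp _ _ (fun z => grad (ineq P i) z j 0) (x i) B (@cgrad_g i j) bd (x_slow i)).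
have [K KP] := box_bounded B (@cgrad_g i j).
have [c [hc _]] := affine_grad (h_affine i).
have lB : \forall t \near +oo, `|lam (S t) i| <= B'.
  by apply: near_bounded => t /bd'/(_ i)[].
have l2 : slow (fun t => lam (S t) i * lam (S t) i).
  by apply: (slowM (K := B')) => //; exact: lam_slow.
have slg : slow (fun t => lam (S t) i * lam (S t) i * grad (ineq P i) (x i t) j 0).
  apply: (slowM (K := B' ^+ 2 + K)) => //; apply: filterS2 lB bd => t lt bt.
    rewrite normrM (@le_trans _ _ (B' ^+ 2))// ?expr2 ?ler_pM//.
    by rewrite lerDl (le_trans (normr_ge0 _) (KP _ bt)).
  by rewrite (le_trans (KP _ bt))// lerDr sqr_ge0.
have sxi : slow (fun t => rxi_gap P (S t) i j 0).
  apply: eq_slow (@slow_sum _ _ (index_enum 'I_N) (edge P i)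
    (fun l t => adj P i l * (rv i l t j 0 - xi (S t) i j 0)) _) => [t|l el].
    by rewrite rxi_gap_coord.
  by apply: slowZ; apply: slowB; [exact: rv_slow|exact: xi_slow].
have snu := slowB (slowD (slowB (slowB (slowZ (-1) sf) slg) (slowZ (c j 0) (mu_slow i)))
   (slow_vanish (rx_gap_vanish i j))) sxi.
by apply: eq_slow snu => t; rewrite nu_coord hc /x; ring.
Qed.

(** [rho_k1] is bounded with a slow derivative, so the derivative vanishes; since [rho_k1] vanishes
    too, only [nu] is left of it. *)
Lemma nu_vanish i j : nu P (S t) i j 0 @[t --> +oo] --> 0.
Proof.
pose k1 := Ordinal m_ge2; have k10 : k1 <> 0%N :> nat by [].
have rk := rho_vanish i j k10; have [B bd] := states_bounded.
have d0 := pder_vanish (B := B) (rho_pder trajS i k1 j).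
have {}d0 : - (decay P i k1 * rho (S t) i k1 j 0) + gain P i k1 * nu P (S t) i j 0 @[t --> +oo] --> 0.
  apply: d0; first by apply: near_bounded => t /bd/(_ i)[].
  apply: slowD (slowZ _ (nu_slow i j)).
  by apply: eq_slow (slowZ (- decay P i k1) (slow_vanish rk)) => t; rewrite mulNr.
apply: eq_vanish (vanishZ (gain P i k1)^-1 (vanishD d0 (vanishZ (decay P i k1) rk))) => t.
by field; rewrite gt_eqF.
Qed.

Lemma settles : settling P S.
Proof.
split; [exact: states_bounded|exact: rho_vanish|exact: x_slow|exact: xi_slow|
  exact: signal_vanish|exact: consensus|exact: rx_gap_vanish|exact: equa_vanish|
  exact: complementarity|exact: nu_vanish].
Qed.

End Saddle.

(** * Cluster points are stationary *)

Section Limit.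
Hypothesis settleP : settling P S.

Lemma cluster_point : exists (T : nat -> R) (z : 'cV[R]_n) (xe : 'I_N -> 'cV[R]_n)
    (le me : 'I_N -> R),
  [/\ T q @[q --> \oo] --> +oo, stationary P z xe le me,
      forall i j, x i (T q) j 0 @[q --> \oo] --> z j 0,
      forall i j, xi (S (T q)) i j 0 @[q --> \oo] --> xe i j 0 &
      forall i, lam (S (T q)) i @[q --> \oo] --> le i /\
                mu (S (T q)) i @[q --> \oo] --> me i].
Proof.
have [B bd] := settling_bounded settleP.
pose I := (('I_N * 'I_n) + ('I_N * 'I_n) + 'I_N + 'I_N)%type.
pose y (q : nat) (c : I) := match c with
  | inl (inl (inl (i, j))) => x i q%:R j 0
  | inl (inl (inr (i, j))) => xi (S q%:R) i j 0
  | inl (inr i) => lam (S q%:R) i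
  | inr i => mu (S q%:R) i end.
have yB q c : `|y q c| <= B.
  have q0 : 0 <= q%:R :> R by [].
  case: c => [[[[i j]|[i j]]|i]|i] /=; have [_ h1 h2 h3 h4] := bd _ q0 i.
  - exact: h1.
  - exact: h2.
  - exact: h3.
  - exact: h4.
have [e [s [sq es]]] := bolzano_weierstrass yB.
pose T q : R := (s q)%:R.
have Toy : T q @[q --> \oo] --> +oo.
  move=> A /nearyP[M MA]; exists (Num.bound `|M|) => // q /= Mq; apply: MA.
  rewrite (le_trans (ler_norm _))// ltW// (lt_le_trans (archi_boundP _))//.
  by rewrite ler_nat (leq_trans Mq).
have along (u : R -> R) (l : R) : u t @[t --> +oo] --> l -> u (T q) @[q --> \oo] --> l.
  by move=> ul; exact: cvg_comp Toy ul.
pose xx i : 'cV[R]_n := \col_j e (inl (inl (inl (i, j)))).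
pose xe i : 'cV[R]_n := \col_j e (inl (inl (inr (i, j)))).
pose le i := e (inl (inr i)); pose me i := e (inr i).
have xc i j : x i (T q) j 0 @[q --> \oo] --> xx i j 0.
  by rewrite mxE; exact: (es (inl (inl (inl (i, j))))).
have xic i j : xi (S (T q)) i j 0 @[q --> \oo] --> xe i j 0.
  by rewrite mxE; exact: (es (inl (inl (inr (i, j))))).
have lc i : lam (S (T q)) i @[q --> \oo] --> le i := es (inl (inr i)).
have mc i : mu (S (T q)) i @[q --> \oo] --> me i := es (inr i).
have xxE i l : xx i = xx l.
  have [_ /(_ i l)/connectP[p pth ->] _ _ _] := graphP.
  elim: p i pth => //= i1 p IH i /andP[ei /IH <-].
  apply/colP => j; apply/eqP; rewrite eq_sym -subr_eq0; apply/eqP.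
  apply: (@eq_limit _ _ \oo _ (fun q => x i1 (T q) j 0 - x i (T q) j 0)).
    exact: cvgB.
  exact: (along _ _ (settling_consensus settleP j ei)).
(* The default 0 is taken only when there are no agents. *)
pose z := if [pick i : 'I_N | true] is Some i then xx i else 0.
have zE i : xx i = z by rewrite /z; case: pickP => [i' _|/(_ i)//]; exact: xxE.
have xz i j : x i (T q) j 0 @[q --> \oo] --> z j 0 by rewrite -(zE i).
have xzV i : x i (T q) @[q --> \oo] --> z.
  by apply: cvg_mx_coord => j k; rewrite ord1; exact: xz.
exists T, z, xe, le, me; split=> //; split.
- move=> i; apply: (cvgr_to_ge (lc i)); apply: nearW => q; apply: ltW.
  by apply: (lam_gt0 trajS dg lam0).
- move=> i; apply: (@eq_limit _ _ \oo _ (fun q => lam (S (T q)) i * ineq P i (x i (T q)))).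
    apply: cvgM => //; apply: (cvg_comp _ _ (xzV i)).
    exact: differentiable_continuous (dg i z).
  exact: (along _ _ (settling_lam settleP i)).
- move=> i; have [c [_ hE]] := affine_grad (h_affine i).
  apply: (@eq_limit _ _ \oo _ (fun q => equa P i (x i (T q)))); last first.
    exact: (along _ _ (settling_equa settleP i)).
  have -> : (fun q => equa P i (x i (T q))) =
      (fun q => equa P i z + \sum_j c j 0 * (x i (T q) j 0 - z j 0)).
    apply/funext => q; rewrite (hE z); congr (_ + _); apply: eq_bigr => j _.
    by rewrite !mxE.
  rewrite -[X in _ --> X]addr0; apply: cvgD; first exact: cvg_cst.
  have s0 : \sum_j c j 0 * (z j 0 - z j 0) = 0.
    by rewrite big1// => j _; rewrite subrr mulr0.
  rewrite -[X in _ --> X]s0.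
  apply: cvg_rsum => j _; apply: cvgM; first exact: cvg_cst.
  by apply: cvgB; [exact: xz|exact: cvg_cst].
- move=> i j; have [c [hc _]] := affine_grad (h_affine i).
  have gf : grad (obj P i) (x i (T q)) j 0 @[q --> \oo] --> grad (obj P i) z j 0.
    apply: cvg_coord; apply: (cvg_comp _ _ (xzV i)).
    by have [_ d] := f_diff i; exact: differentiable_continuous (d z).
  have gg : grad (ineq P i) (x i (T q)) j 0 @[q --> \oo] --> grad (ineq P i) z j 0.
    apply: cvg_coord; apply: (cvg_comp _ _ (xzV i)).
    by have [_ d] := g_diff i; exact: differentiable_continuous (d z).
  have rxi : rxi_gap P (S (T q)) i j 0 @[q --> \oo] -->
      \sum_(l | edge P i l) adj P i l * ((xe l j 0 - xe i j 0) / 2).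
    have -> : (fun q => rxi_gap P (S (T q)) i j 0) = (fun q =>
        \sum_(l | edge P i l) adj P i l * ((rv i l (T q) j 0 - (xi (S (T q)) i j 0 + xi (S (T q)) l j 0) / 2)
          + (xi (S (T q)) l j 0 - xi (S (T q)) i j 0) / 2)).
      apply/funext => q; rewrite rxi_gap_coord; apply: eq_bigr => l _; congr (_ * _).
      by rewrite /rv; field.
    apply: cvg_rsum => l el; apply: cvgM; first exact: cvg_cst.
    rewrite -[X in _ --> X]add0r; apply: cvgD.
      by have [_ h] := settling_signal settleP j el; exact: (along _ _ h).
    by apply: cvgM; [exact: cvgB|exact: cvg_cst].
  apply/eqP; rewrite -oppr_eq0; apply/eqP.
  apply: (@eq_limit _ _ \oo _ (fun q => nu P (S (T q)) i j 0)); last first.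
    exact: (along _ _ (settling_nu settleP i j)).
  have -> : (fun q => nu P (S (T q)) i j 0) = (fun q =>
     - grad (obj P i) (x i (T q)) j 0
     - lam (S (T q)) i * lam (S (T q)) i * grad (ineq P i) (x i (T q)) j 0
     - mu (S (T q)) i * grad (equa P i) z j 0
     + rx_gap P (S (T q)) i j 0 - rxi_gap P (S (T q)) i j 0).
    by apply/funext => q; rewrite nu_coord !hc -expr2.
  have -> : - (grad (obj P i) z j 0 + le i ^+ 2 * grad (ineq P i) z j 0 + me i * grad (equa P i) z j 0 +
      \sum_(l | edge P i l) adj P i l * ((xe l j 0 - xe i j 0) / 2)) =
      - grad (obj P i) z j 0 - le i * le i * grad (ineq P i) z j 0 - me i * grad (equa P i) z j 0
      + 0 - \sum_(l | edge P i l) adj P i l * ((xe l j 0 - xe i j 0) / 2) by ring.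
  apply: cvgB => //; apply: cvgD; last exact: (along _ _ (settling_rx_gap settleP i j)).
  apply: cvgB; last by apply: cvgM => //; exact: cvg_cst.
  apply: cvgB; first exact: cvgN.
  by apply: cvgM => //; apply: cvgM.
Qed.

(** * Convergence to the cluster point *)

Section Trap.
Variables (T : nat -> R) (z : 'cV[R]_n) (xe : 'I_N -> 'cV[R]_n) (le me : 'I_N -> R).
Hypothesis Toy : T q @[q --> \oo] --> +oo.
Hypothesis centerP : stationary P z xe le me.
Hypothesis x_lim : forall i j, x i (T q) j 0 @[q --> \oo] --> z j 0.
Hypothesis xi_lim : forall i j, xi (S (T q)) i j 0 @[q --> \oo] --> xe i j 0.
Hypothesis lm_lim : forall i, lam (S (T q)) i @[q --> \oo] --> le i /\
  mu (S (T q)) i @[q --> \oo] --> me i.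
Variable F : 'I_N -> 'I_N -> R -> R.
Hypothesis FP : is_storage P S z xe F.

Let V := energy P S z xe le me F.
Let pV : pder (horizon P) V (power P S z xe le me).
Proof.
by have [] := energy_power centerP FP.
Qed.
Let low t (ht : horizon P < t) := energy_lower trajS dg c_gt0 eta_gt0 delay_ge0 lam0 centerP FP ht.

Let late (p : R -> Prop) : (\forall t \near +oo, p t) -> \forall q \near \oo, p (T q).
Proof. by move=> pP; exact: (Toy pP). Qed.

Let along (u : R -> R) (l : R) : u t @[t --> +oo] --> l -> u (T q) @[q --> \oo] --> l.
Proof. by move=> ul; exact: cvg_comp Toy ul. Qed.

Let lam_pos i t : 0 <= t -> 0 < lam (S t) i.
Proof. exact: (lam_gt0 trajS dg lam0). Qed.

(** Slowness looks forward, so both [r] and [T q] are compared with the left end [T q - H]. *)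
Lemma slow_window (w : R -> R) (e H : R) : slow w -> w (T q) @[q --> \oo] --> 0 -> 0 < e ->
  \forall q \near \oo, forall r, T q - H <= r <= T q -> `|w r| <= e.
Proof.
move=> sw w0 e0; have e3 : 0 < e / 3 by rewrite divr_gt0.
have h1 := late (near_tail H (sw H _ e3)).
move/cvgr0Pnorm_le : w0 => /(_ _ e3) h2.
apply: filterS2 h1 h2 => q sq wq r /andP[r1 r2].
have Hr : 0 <= r - (T q - H) <= H by apply/andP; split; lra.
have HH : 0 <= H <= H by rewrite lexx andbT; lra.
have := sq (T q - H) (lexx _) _ Hr; rewrite subrKC => d1.
have := sq (T q - H) (lexx _) _ HH; rewrite subrK => d2.
have -> : w r = w (T q) - (w (T q) - w (T q - H)) + (w r - w (T q - H)) by ring.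
rewrite (le_trans (ler_normD _ _))//.
have := ler_normB (w (T q)) (w (T q) - w (T q - H)); lra.
Qed.

Let rx_slow i l j : edge P i l -> slow (fun t => rx i l t j 0).
Proof.
move=> el; have [/slow_vanish h _] := settling_signal settleP j el.
apply: eq_slow (slowD h (slowZ 2^-1 (slowD (settling_x_slow settleP i j) (settling_x_slow settleP l j)))) => t.
by rewrite /rx; field.
Qed.

Let rv_slow i l j : edge P i l -> slow (fun t => rv i l t j 0).
Proof.
move=> el; have [_ /slow_vanish h] := settling_signal settleP j el.
apply: eq_slow (slowD h (slowZ 2^-1 (slowD (settling_xi_slow settleP i j) (settling_xi_slow settleP l j)))) => t.
by rewrite /rv; field.
Qed.

Let rx_lim i l j : edge P i l -> rx i l (T q) j 0 @[q --> \oo] --> (z j 0 + z j 0) / 2.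
Proof.
move=> el; have [h _] := settling_signal settleP j el.
have -> : (fun q => rx i l (T q) j 0) = (fun q =>
   (rx i l (T q) j 0 - (x i (T q) j 0 + x l (T q) j 0) / 2) + (x i (T q) j 0 + x l (T q) j 0) / 2).
  by apply/funext => q; rewrite subrK.
rewrite -[X in _ --> X]add0r; apply: cvgD; first exact: (along h).
by apply: cvgM; [apply: cvgD|exact: cvg_cst].
Qed.

Let rv_lim i l j : edge P i l -> rv i l (T q) j 0 @[q --> \oo] --> (xe i j 0 + xe l j 0) / 2.
Proof.
move=> el; have [_ h] := settling_signal settleP j el.
have -> : (fun q => rv i l (T q) j 0) = (fun q =>
   (rv i l (T q) j 0 - (xi (S (T q)) i j 0 + xi (S (T q)) l j 0) / 2)
   + (xi (S (T q)) i j 0 + xi (S (T q)) l j 0) / 2).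
  by apply/funext => q; rewrite subrK.
rewrite -[X in _ --> X]add0r; apply: cvgD; first exact: (along h).
by apply: cvgM; [apply: cvgD|exact: cvg_cst].
Qed.

Lemma out_err_slow i l j : edge P i l ->
  [/\ slow (out_errx P S z xe i l j), slow (out_errv P S z xe i l j),
      out_errx P S z xe i l j (T q) @[q --> \oo] --> 0 &
      out_errv P S z xe i l j (T q) @[q --> \oo] --> 0].
Proof.
move=> el; have sx := settling_x_slow settleP i j; have sv := settling_xi_slow settleP i j.
have srx := rx_slow j el; have srv := rv_slow j el.
have lrx := @rx_lim i l j el; have lrv := @rv_lim i l j el.
split.
- apply: slowB; last exact: slow_cst.
  by apply: slowB; [exact: slowZ|apply: slowB; apply: slowZ; exact: slowB].
- apply: slowB; last exact: slow_cst.
  by apply: slowB; [exact: slowZ|apply: slowZ; exact: slowB].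
- rewrite -[X in _ --> X](subrr (steadyx (adj P i l) (eta P) (z j 0) (xe i j 0) (z j 0) (xe l j 0))).
  apply: cvgB; last exact: cvg_cst.
  apply: cvgB; first by apply: cvgM => //; exact: cvg_cst.
  apply: cvgB; apply: cvgM; (try exact: cvg_cst); apply: cvgB => //; exact: x_lim.
- rewrite -[X in _ --> X](subrr (steadyv (adj P i l) (eta P) (z j 0) (xe i j 0) (z j 0) (xe l j 0))).
  apply: cvgB; last exact: cvg_cst.
  apply: cvgB; first by apply: cvgM => //; exact: cvg_cst.
  apply: cvgM; first exact: cvg_cst.
  by apply: cvgB => //; exact: x_lim.
Qed.

(** The energy in transit depends on the signals over the whole preceding delay; [slow_window] makes
    them small on all of it. *)
Lemma channel_energy_vanish i l : edge P i l ->
  channel_energy P F i l (T q) @[q --> \oo] --> 0.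
Proof.
move=> el; apply/cvgr0Pnorm_le => e e0.
pose C := delay P i l * (n%:R / (2 * eta P)).
have C0 : 0 <= C by rewrite mulr_ge0 ?delay_ge0// divr_ge0// mulr_ge0// ltW.
(* Since [d <= 1], squares of errors below [d] are themselves below [d]. *)
pose d := Num.min 1 (e / (C + 1)).
have d0 : 0 < d by rewrite lt_min ltr01 divr_gt0// ltr_wpDl.
have d1 : d <= 1 by rewrite ge_min lexx.
have dC : C * d <= e.
  rewrite (@le_trans _ _ ((C + 1) * (e / (C + 1))))//.
    by rewrite ler_pM// ?(ltW d0)// ?lerDl// ge_min lexx orbT.
  by rewrite mulrC divfK// gt_eqF// ltr_wpDl.
have win : \forall q \near \oo, forall j r, T q - delay P i l <= r <= T q ->
    `|out_errx P S z xe i l j r| <= d /\ `|out_errv P S z xe i l j r| <= d.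
  apply: filter_forall => j; have [s1 s2 l1 l2] := out_err_slow j el.
  apply: filterS2 (slow_window (delay P i l) s1 l1 d0) (slow_window (delay P i l) s2 l2 d0).
  by move=> q h1 h2 r rr; split; [exact: h1|exact: h2].
apply: filterS2 win (late (near_gt (horizon P))) => q wq hq.
rewrite ger0_norm; last exact: (channel_energy_ge0 eta_gt0 delay_ge0 FP el hq).
apply: le_trans (@channel_energy_le _ _ _ _ P S delay_ge0 z xe F FP i l (T q) (n%:R / (2 * eta P) * d) el hq _) _.
  move=> r rr; rewrite /flux.
  have -> : n%:R / (2 * eta P) * d = \sum_(j < n) (d + d) / (4 * eta P).
    rewrite sumr_const card_ord -mulr_natl; field.
    by rewrite gt_eqF.
  apply: ler_sum => j _; have [h1 h2] := wq j r rr.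
  rewrite ler_pM2r ?invr_gt0 ?mulr_gt0//.
  have sq (u : R) : `|u| <= d -> u ^+ 2 <= d.
    move=> ud; rewrite -(real_normK (num_real u)) expr2.
    by rewrite (le_trans _ ud)// ler_piMr// (le_trans ud).
  by apply: lerD; exact: sq.
apply: le_trans dC; rewrite /C le_eqVlt; apply/orP; left; apply/eqP; ring.
Qed.

Lemma rho_lim i k j : rho (S (T q)) i k j 0 @[q --> \oo] --> rest z k j 0.
Proof.
rewrite /rest; case: eqP => k0; last first.
  by rewrite mxE; exact: (along (settling_rho settleP i j k0)).
have -> : (fun q => rho (S (T q)) i k j 0) =
    (fun q => x i (T q) j 0 - \sum_(k' | k' != k) rho (S (T q)) i k' j 0).
  by apply/funext => q; rewrite /x output_coord (bigD1 k)//= addrK.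
rewrite -[X in _ --> X]subr0; apply: cvgB; first exact: x_lim.
have s0 : \sum_(k' | k' != k) (0 : R) = 0 by rewrite big1.
rewrite -[X in _ --> X]s0; apply: cvg_rsum => k' k'k.
apply: (along (settling_rho settleP i j _)) => k'0.
by move/eqP: k'k; apply; apply: val_inj; rewrite /= k'0 k0.
Qed.

(** The case [le i = 0] is apart because [ln] is continuous only at positive arguments. *)
Lemma multiplier_energy_lim i :
  multiplier_energy (lam (S (T q)) i) (le i) @[q --> \oo] --> 0.
Proof.
have [le_ge0 _ _ _] := centerP; have [ll _] := lm_lim i.
have := le_ge0 i; rewrite le_eqVlt => /predU1P[l0|l0].
  have -> : (fun q => multiplier_energy (lam (S (T q)) i) (le i)) =
      (fun q => lam (S (T q)) i * lam (S (T q)) i / 4).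
    by apply/funext => q; rewrite /multiplier_energy -l0 expr0n/= mulr0 mul0r !subr0 expr2.
  have e0 : le i * le i / 4 = 0 by rewrite -l0 !mul0r.
  by rewrite -[X in _ --> X]e0; apply: cvgM; [apply: cvgM|exact: cvg_cst].
have e0 : (le i * le i - le i ^+ 2 - 2 * le i ^+ 2 * (ln (le i) - ln (le i))) / 4 = 0.
  by field.
rewrite -[X in _ --> X]e0.
have -> : (fun q => multiplier_energy (lam (S (T q)) i) (le i)) = (fun q =>
   (lam (S (T q)) i * lam (S (T q)) i - le i ^+ 2 - 2 * le i ^+ 2 * (ln (lam (S (T q)) i) - ln (le i))) / 4).
  by apply/funext => q; rewrite /multiplier_energy expr2.
apply: cvgM; last exact: cvg_cst.
apply: cvgB; first by apply: cvgB; [apply: cvgM|exact: cvg_cst].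
apply: cvgM; first exact: cvg_cst.
apply: cvgB; last exact: cvg_cst.
apply: (cvg_comp _ _ ll); exact: continuous_ln.
Qed.

Lemma energy_along : V (T q) @[q --> \oo] --> 0.
Proof.
have sq (u : R -> R) (w c : R) : u (T q) @[q --> \oo] --> w ->
    (u (T q) - w) ^+ 2 / c @[q --> \oo] --> 0.
  move=> uw; have e0 : (w - w) * (w - w) / c = 0 by rewrite subrr !mul0r.
  rewrite -[X in _ --> X]e0.
  have -> : (fun q => (u (T q) - w) ^+ 2 / c) = (fun q => (u (T q) - w) * (u (T q) - w) / c).
    by apply/funext => q; rewrite expr2.
  by apply: cvgM (cvg_cst _); apply: cvgM; apply: cvgB (cvg_cst _).
have sum0 (I : finType) (Q : pred I) (u : I -> nat -> R) :
    (forall i, Q i -> u i q @[q --> \oo] --> 0) -> \sum_(i | Q i) u i q @[q --> \oo] --> 0.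
  move=> u0; have e0 : \sum_(i | Q i) (0 : R) = 0 by rewrite big1.
  by rewrite -[X in _ --> X]e0; apply: cvg_rsum.
rewrite -[X in _ --> X]addr0; apply: cvgD; last first.
  apply: (sum0) => i _; apply: (sum0) => l el; exact: channel_energy_vanish.
apply: (sum0) => i _; have [_ mm] := lm_lim i.
rewrite -[X in _ --> X](addr0 0); apply: cvgD; last exact: (sq (fun t => mu (S t) i)).
rewrite -[X in _ --> X](addr0 0); apply: cvgD; last exact: multiplier_energy_lim.
rewrite -[X in _ --> X](addr0 0); apply: cvgD.
  apply: (sum0) => j _; apply: (sum0) => k _.
  exact: (sq (fun t => rho (S t) i k j 0) _ _ (@rho_lim i k j)).
by apply: (sum0) => j _; exact: (sq (fun t => xi (S t) i j 0)).
Qed.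

Lemma energy_close (e : R) : 0 < e -> \forall d \near (0 : R)^'+,
  forall t, horizon P < t -> V t <= d -> forall i j, `|x i t j 0 - z j 0| <= e.
Proof.
move=> e0; have m0 : 0 < m%:R :> R by rewrite ltr0n.
have em : 0 < e / m%:R by rewrite divr_gt0.
have : \forall d \near (0 : R)^'+, forall i k, d <= (e / m%:R) ^+ 2 / (2 * gain P i k).
  apply: filter_forall => i; apply: filter_forall => k; apply: nbhs_right_le.
  by rewrite divr_gt0 ?exprn_gt0// mulr_gt0.
apply: filterS => d dP t ht Vd i j.
have rest_sum : \sum_(k < m) rest z k j 0 = z j 0.
  rewrite (bigD1 (Ordinal m_gt0))//= big1 ?addr0; first by rewrite /rest eqxx.
  move=> k; rewrite -val_eqE/= /rest => /negbTE ->; by rewrite mxE.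
rewrite /x output_coord -rest_sum -sumrB.
apply: le_trans (ler_norm_sum _ _ _) _.
have -> : e = \sum_(k < m) e / m%:R.
  by rewrite sumr_const card_ord -(mulr_natr (e / _)) divfK// gt_eqF.
apply: ler_sum => k _; have [h _ _ _ _] := low ht i.
have := le_trans (h k j) (le_trans Vd (dP i k)).
rewrite ler_pM2r ?invr_gt0 ?mulr_gt0// -(real_normK (num_real (_ - _))).
by rewrite ler_sqr ?nnegrE// ltW.
Qed.

(* Where [g_i z > 0] the multiplier of agent [i] vanishes at the cluster point
   and the energy is not a Lyapunov function; subtracting [lam_i^2 / 2] makes
   it one as long as [g_i (x_i) >= g_i z / 2]. *)
Lemma energy_zone (e : R) : 0 < e -> \forall d \near (0 : R)^'+, d <= e /\
  forall t, horizon P < t -> V t <= d -> forall i, 0 < ineq P i z ->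
    ineq P i z / 2 <= ineq P i (x i t).
Proof.
move=> e0; have [B bd] := settling_bounded settleP.
pose B' := `|B| + \sum_j `|z j 0|.
have zB : in_box B' z.
  move=> j; rewrite /B' (bigD1 j)//= addrCA lerDl addr_ge0//.
  exact: sumr_ge0.
have xB t i : 0 <= t -> in_box B' (x i t).
  move=> t0 j; have [_ h _ _ _] := bd t t0 i.
  rewrite (le_trans (h j))// (le_trans (ler_norm _))// /B' lerDl.
  exact: sumr_ge0.
have hi i : \forall d \near (0 : R)^'+, forall t, horizon P < t -> V t <= d ->
    0 < ineq P i z -> ineq P i z / 2 <= ineq P i (x i t).
  have [gz|gz] := ltP 0 (ineq P i z); last by apply: nearW.
  have g2 : 0 < ineq P i z / 2 by rewrite divr_gt0.
  have cgi : continuous (ineq P i).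
    by move=> w; exact: differentiable_continuous (dg i w).
  have [d d0 dP] := @box_unif_continuous _ _ (ineq P i) B' _ cgi g2.
  apply: filterS (energy_close d0) => c cP t ht Vc _.
  have t0 : 0 <= t by rewrite ltW// (le_lt_trans (horizon_ge0 delay_ge0)).
  have := dP _ _ (xB t i t0) zB (cP t ht Vc i).
  by rewrite ler_distl => /andP[]; lra.
have hall : \forall d \near (0 : R)^'+, forall i t, horizon P < t -> V t <= d ->
    0 < ineq P i z -> ineq P i z / 2 <= ineq P i (x i t) by exact: filter_forall.
apply: filterS2 (nbhs_right_le e0) hall => d de dP; split=> // t ht Vd i.
exact: dP.
Qed.

Lemma energy_vanish : V t @[t --> +oo] --> 0.
Proof.
apply/vanishP => e e0.
have [d [[dle zone] d0]] := filter_ex (filterI (energy_zone e0) (nbhs_right_gt 0)).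
pose bad i := 0 < ineq P i z.
(* Multipliers that are at most [b] at all [N] agents contribute at most [d / 4] to the sum
   subtracted from [V]. *)
pose b := Num.min 1 (d / (2 * (N%:R + 1))).
have N1 : 0 < N%:R + 1 :> R by rewrite ltr_wpDl.
have b0 : 0 < b by rewrite lt_min ltr01 divr_gt0// mulr_gt0.
have b1 : b <= 1 by rewrite ge_min lexx.
have Nb : N%:R * b <= d / 2.
  rewrite (@le_trans _ _ ((N%:R + 1) * (d / (2 * (N%:R + 1)))))//.
    by rewrite ler_pM// ?(ltW b0)// ?lerDl// ge_min lexx orbT.
  by rewrite le_eqVlt; apply/orP; left; apply/eqP; field; rewrite gt_eqF.
have lam_small : \forall t \near +oo, forall i, bad i ->
    lam (S t) i * ineq P i (x i t) <= ineq P i z / 2 * b.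
  apply: filter_forall => i; have [gi|gi] := boolP (bad i); last exact: nearW.
  have g2 : 0 < ineq P i z / 2 * b by rewrite mulr_gt0// divr_gt0.
  have /vanishP/(_ _ g2) := settling_lam settleP i.
  by apply: filterS => t /(le_trans (ler_norm _)).
have /nearyP[t1 t1P] := lam_small.
have Vq : \forall q \near \oo, `|V (T q)| <= d / 4.
  by move/cvgr0Pnorm_le : energy_along; apply; rewrite divr_gt0.
have [q [[hq tq] Vq4]] := filter_ex (filterI
  (filterI (late (near_gt (horizon P))) (late (near_ge t1))) Vq).
have lam_zone t : T q <= t -> V t <= d -> \sum_(i | bad i) lam (S t) i ^+ 2 / 2 <= d / 4.
  move=> qt Vd; have ht : horizon P < t by exact: lt_le_trans qt.
  have t0 : 0 <= t by rewrite ltW// (le_lt_trans (horizon_ge0 delay_ge0)).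
  have lb i : bad i -> lam (S t) i <= b.
    move=> gi; have g2 : 0 < ineq P i z / 2 by rewrite divr_gt0.
    rewrite -(ler_pM2l g2); apply: le_trans (t1P t (le_trans tq qt) i gi).
    rewrite mulrC ler_wpM2l ?(ltW (lam_pos i t0))//; exact: zone.
  apply: (@le_trans _ _ (\sum_(i < N) b / 2)).
    rewrite [leRHS](bigID bad)/= -[leLHS]addr0 lerD//.
      apply: ler_sum => i gi; rewrite ler_pM2r ?invr_gt0// expr2.
      have l0 := lam_pos i t0; have lbi := lb i gi.
      by rewrite (le_trans _ lbi)// ler_piMl ?(ltW l0)// (le_trans lbi).
    by apply: sumr_ge0 => i _; rewrite divr_ge0// ltW.
  by rewrite sumr_const card_ord -mulr_natl; move: Nb; lra.
have stay t : T q <= t -> V t <= d.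
  move=> qt; rewrite leNgt; apply/negP => Vt.
  have Vq' : V (T q) < d by have := ler_norm (V (T q)); lra.
  (* Up to [c] the trajectory stays in the zone, so [U] below does not increase. But [U (T q)] is at
     most [d / 4], while [V c = d] makes [U c] at least [d - d / 4]. *)
  have [c [qc Vc below]] := first_hit pV.1 hq qt Vq' (ltW Vt).
  pose U r := V r - \sum_(i | bad i) lam (S r) i ^+ 2 / 2.
  have pU : pder (horizon P) U (fun r => power P S z xe le me r -
      \sum_(i | bad i) 2 * (lam (S r) i ^+ 2 * ineq P i (x i r))).
    apply: pderB; first exact: pV.
    apply: pder_sum => i _.
    have := pder_sqr 0 (pder_sub (horizon_ge0 delay_ge0) (lam_pder trajS i)).
    move=> /(pderZ 2^-1); apply: pder_ext => r.
      by move=> _; rewrite /x; field.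
    by rewrite subr0 mulrC.
  have UU : U c - U (T q) <= 0.
    rewrite -(mul0r (c - T q)); apply: (pder_le pU hq qc) => r /andP[r1 r2].
    have hr : horizon P < r by exact: lt_trans r1.
    have [_ /(_ r hr) pw /(_ r hr) dis] := energy_power centerP FP.
    have Vr : V r <= d by apply: below; rewrite !ltW.
    rewrite subr_le0; apply: le_trans pw _.
    apply: (@le_trans _ _ (\sum_i lam (S r) i ^+ 2 * ineq P i z)); first by rewrite gerBl.
    rewrite (bigID bad)/= -[leRHS]addr0 lerD//.
      apply: ler_sum => i gi; rewrite mulrCA ler_wpM2l ?sqr_ge0//.
      by have := zone r hr Vr i gi; lra.
    by apply: sumr_le0 => i; rewrite /bad -leNgt => gi; rewrite mulr_ge0_le0 ?sqr_ge0.
  have Vcd : V c <= d by rewrite Vc.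
  have h1 := lam_zone c qc Vcd.
  have h2 : 0 <= \sum_(i | bad i) lam (S (T q)) i ^+ 2 / 2.
    by apply: sumr_ge0 => i _; rewrite divr_ge0 ?sqr_ge0.
  have h3 := ler_norm (V (T q)); move: UU; rewrite /U Vc; lra.
case: (pickP (@predT 'I_N)) => [i0 _|no].
  apply: filterS2 (near_ge (T q)) (near_gt (horizon P)) => t qt ht.
  have [_ _ _ _ V0] := low ht i0.
  by rewrite ger0_norm// (le_trans (stay t qt)).
apply/nearyP; exists 0 => t _.
rewrite /V /energy !big1 ?addr0 ?normr0 ?ltW// => i; by have := no i.
Qed.

Lemma state_limits i :
  [/\ forall k j, rho (S t) i k j 0 @[t --> +oo] --> rest z k j 0,
      forall j, xi (S t) i j 0 @[t --> +oo] --> xe i j 0,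
      lam (S t) i @[t --> +oo] --> le i & mu (S t) i @[t --> +oo] --> me i].
Proof.
have sq (u : R -> R) (w c : R) : 0 < c ->
    (forall t, horizon P < t -> (u t - w) ^+ 2 / c <= V t) -> u t @[t --> +oo] --> w.
  move=> c0 uV; apply/cvgrPdist_le => e e0.
  have e2 : 0 < e ^+ 2 / c by rewrite divr_gt0// exprn_gt0.
  have /vanishP/(_ _ e2) := energy_vanish.
  apply: filterS2 (near_gt (horizon P)) => t ht /(le_trans (ler_norm _)) Ve.
  have := le_trans (uV t ht) Ve; rewrite ler_pM2r ?invr_gt0//.
  rewrite -(real_normK (num_real (u t - w))) ler_sqr ?nnegrE ?(ltW e0)//.
  by rewrite distrC.
split=> [k j|j||].
- apply: (sq (fun t => rho (S t) i k j 0) _ (2 * gain P i k)); first by rewrite mulr_gt0.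
  by move=> t ht; have [h _ _ _ _] := low ht i; exact: h.
- apply: (sq (fun t => xi (S t) i j 0) _ 2) => // t ht.
  by have [_ h _ _ _] := low ht i; exact: h.
- by apply: (sq (fun t => lam (S t) i) _ 4) => // t ht; have [_ _ h _ _] := low ht i.
- by apply: (sq (fun t => mu (S t) i) _ 2) => // t ht; have [_ _ _ h _] := low ht i.
Qed.

Lemma limit_feasible i : ineq P i z <= 0.
Proof.
rewrite leNgt; apply/negP => gz; have [_ _ ll _] := state_limits i.
have [_ comp _ _] := centerP.
have l0 : le i = 0.
  by have /eqP := comp i; rewrite mulf_eq0 (gt_eqF gz) orbF => /eqP.
have [d [[_ zone] d0]] := filter_ex (filterI (energy_zone ltr01) (nbhs_right_gt 0)).
have /vanishP/(_ _ d0)/nearyP[t1 t1P] := energy_vanish.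
pose t2 := Num.max t1 (horizon P + 1).
have ht2 : horizon P < t2 by rewrite lt_max ltrDl ltr01 orbT.
have t20 : 0 <= t2 by rewrite ltW// (le_lt_trans (horizon_ge0 delay_ge0)).
have mono t : t2 <= t -> lam (S t2) i <= lam (S t) i.
  move=> tt; have := pder_le (pderZ (-1) (lam_pder trajS i))
    (le_lt_trans (horizon_ge0 delay_ge0) ht2) tt (K := 0).
  rewrite mul0r => H; suff : -1 * lam (S t) i - -1 * lam (S t2) i <= 0 by lra.
  apply: H => r /andP[r1 _]; rewrite mulN1r oppr_le0.
  have hr : horizon P < r by exact: lt_trans r1.
  have r0 : 0 <= r by rewrite (le_trans t20)// ltW.
  rewrite mulr_ge0 ?mulr_ge0 ?(ltW (lam_pos i r0))//.
  apply: le_trans (zone r hr _ i gz); first by rewrite divr_ge0// ltW.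
  apply: le_trans (ler_norm _) (t1P r _).
  by rewrite (le_trans _ (ltW r1))// le_max lexx.
have : lam (S t2) i <= le i.
  by apply: (cvgr_to_ge ll); apply: filterS (near_ge t2) => t; exact: mono.
by rewrite l0 leNgt lam_pos.
Qed.

End Trap.

End Limit.

End Attractor.

(** * Optimality of the limit *)

Section Assembly.
Variables (R : realType) (N n m : nat) (P : system R N n m).
Hypothesis graphP : undirected_connected_graph P.

Lemma block_stack (u : 'I_N -> 'cV[R]_n) i : block (stack u) i = u i.
Proof. by apply/colP => j; rewrite !mxE mxtens_indexK. Qed.

Lemma big_laplacian_coord (X : 'cV[R]_(N * n)) i j :
  (big_laplacian P *m X) (mxtens_index (i, j)) 0 =
  - \sum_(l | edge P i l) adj P i l * (block X l j 0 - block X i j 0).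
Proof.
have [_ _ _ _ a0] := graphP.
rewrite mxE (reindex (@mxtens_index N n)); last first.
  exists (@mxtens_unindex N n) => k _; [exact: mxtens_indexK|exact: mxtens_unindexK].
transitivity (\sum_i' \sum_j' big_laplacian P (mxtens_index (i, j)) (mxtens_index (i', j')) *
   X (mxtens_index (i', j')) 0).
  by rewrite pair_bigA; apply: eq_bigr => -[].
have -> : - \sum_(l | edge P i l) adj P i l * (block X l j 0 - block X i j 0) =
    - \sum_l adj P i l * (block X l j 0 - block X i j 0).
  congr (- _); rewrite [RHS](bigID (edge P i))/= [X in _ = _ + X]big1 ?addr0//.
  by move=> l /a0 ->; rewrite mul0r.
transitivity (\sum_l laplacian (adj P) i l * block X l j 0).
  apply: eq_bigr => l _; rewrite (bigD1 j)//= big1 ?addr0; last first.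
    move=> j' j'j; rewrite /big_laplacian tensmxE [X in _ * X * _]mxE.
    by rewrite eq_sym (negbTE j'j) mulr0 mul0r.
  rewrite /big_laplacian tensmxE [X in _ * X * _]mxE eqxx mulr1.
  by rewrite [block X l j 0]mxE.
have lapE l : laplacian (adj P) i l = (\sum_l' adj P i l') *+ (i == l) - adj P i l.
  rewrite /laplacian !mxE; congr (_ *+ _ - _).
  by apply: eq_bigr => l' _; rewrite mxE mulr1.
under eq_bigr do rewrite lapE mulrBl.
have s0 : \sum_(l | l != i) (\sum_l' adj P i l') *+ (i == l) * block X l j 0 = 0.
  by rewrite big1// => l li; rewrite eq_sym (negbTE li) mulr0n mul0r.
rewrite sumrB (bigD1 i)//= eqxx mulr1n s0 addr0.
rewrite mulr_suml -sumrB -sumrN; apply: eq_bigr => l _; ring.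
Qed.

Lemma big_laplacian_eq0 (X : 'cV[R]_(N * n)) : big_laplacian P *m X = 0 <->
  forall i j, \sum_(l | edge P i l) adj P i l * (block X l j 0 - block X i j 0) = 0.
Proof.
split=> [X0 i j|X0].
  apply/eqP; rewrite -oppr_eq0 -big_laplacian_coord X0; apply/eqP; exact: mxE.
apply/colP => k; have [[i j] ->] : exists ij, k = mxtens_index ij.
  by exists (mxtens_unindex k); rewrite mxtens_unindexK.
by rewrite big_laplacian_coord X0 oppr0 mxE.
Qed.

Hypothesis f_convex : forall i, convex_function setT (obj P i).
Hypothesis f_diff : forall i, twice_differentiable (obj P i).
Hypothesis g_convex : forall i, convex_function setT (ineq P i).
Hypothesis g_diff : forall i, twice_differentiable (ineq P i).
Hypothesis h_affine : forall i, affine (equa P i).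

(** On the feasible set the quadratic term is zero, and gradient inequalities reduce the claim to a
    sign. Stationarity bounds the sum below by a pairing of [d] with the Laplacian of [xe]; by
    symmetry this pairs [xe] with the Laplacian of [d], which is zero. *)
Lemma stationary_optimal (z : 'cV[R]_n) xe le me : stationary P z xe le me ->
  (forall i, ineq P i z <= 0) ->
  optimal (consensus_cost P) (consensus_feasible P) (stack (fun=> z)).
Proof.
move=> [le_ge0 comp hz stat] gz.
have [e_sym _ _ aP _] := graphP.
have Lz : big_laplacian P *m stack (fun _ : 'I_N => z) = 0.
  by apply/big_laplacian_eq0 => i j; rewrite big1// => l _; rewrite !block_stack subrr mulr0.
split; first by split=> [i|//]; rewrite block_stack; split.
move=> y [yP Ly]; rewrite /consensus_cost -!mulmxA Lz Ly !mulmx0 !mxE !addr0.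
under eq_bigr do rewrite block_stack.
pose d i := block y i - z.
have fd i : obj P i z + dot (grad (obj P i) z) (d i) <= obj P i (block y i).
  by apply: convex_grad => //; have [] := f_diff i.
suff : 0 <= \sum_i dot (grad (obj P i) z) (d i).
  move=> h; apply: le_trans (ler_sum _ (fun i _ => fd i)).
  by rewrite big_split lerDl.
have term i : - \sum_j d i j 0 * (\sum_(l | edge P i l) adj P i l * ((xe l j 0 - xe i j 0) / 2))
     <= dot (grad (obj P i) z) (d i).
  have [c [hc hE]] := affine_grad (h_affine i).
  have [gy hy] := yP i.
  have hd : dot (grad (equa P i) z) (d i) = 0.
    by rewrite hc; have := hE z (block y i); rewrite hy hz add0r => <-.
  have gd : le i ^+ 2 * dot (grad (ineq P i) z) (d i) <= 0.
    have dgz : differentiable (ineq P i) z by have [] := g_diff i.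
    have gg := convex_grad (block y i) (g_convex i) dgz.
    have [l0|ln0] := eqVneq (le i) 0; first by rewrite l0 expr0n mul0r.
    have g0 : ineq P i z = 0.
      by have /eqP := comp i; rewrite mulf_eq0 (negbTE ln0) => /eqP.
    by rewrite mulr_ge0_le0 ?sqr_ge0//; move: gg; rewrite -/(d i) g0; lra.
  have -> : \sum_j d i j 0 * (\sum_(l | edge P i l) adj P i l * ((xe l j 0 - xe i j 0) / 2)) =
      - (dot (grad (obj P i) z) (d i) + le i ^+ 2 * dot (grad (ineq P i) z) (d i)
        + me i * dot (grad (equa P i) z) (d i)).
    rewrite !mulr_sumr -!big_split/= -sumrN; apply: eq_bigr => j _.
    have := stat i j; set s := \sum_(l | _) _ => sE.
    have -> : s = - (grad (obj P i) z j 0 + le i ^+ 2 * grad (ineq P i) z j 0 +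
        me i * grad (equa P i) z j 0) by apply/eqP; rewrite -addr_eq0 addrC sE.
    by ring.
  by rewrite hd mulr0 addr0 opprK gerDl.
apply: le_trans (ler_sum _ (fun i _ => term i)).
rewrite sumrN exchange_big/= oppr_ge0 big1// => j _.
have := edge_sum_parts e_sym (fun i l el => (aP i l el).1) (fun i => d i j 0) (fun i => xe i j 0).
rewrite [RHS]big1 => [s0|i _]; last first.
  have -> : \sum_(l | edge P i l) adj P i l * (d l j 0 - d i j 0) =
     \sum_(l | edge P i l) adj P i l * (block y l j 0 - block y i j 0).
    by apply: eq_bigr => l _; rewrite ![d _ j 0]mxE; ring.
  by have := (big_laplacian_eq0 y).1 Ly i j => ->; rewrite mulr0.
have -> : \sum_i d i j 0 * (\sum_(l | edge P i l) adj P i l * ((xe l j 0 - xe i j 0) / 2)) =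
   (\sum_i d i j 0 * (\sum_(l | edge P i l) adj P i l * (xe l j 0 - xe i j 0))) / 2.
  rewrite mulr_suml; apply: eq_bigr => i _; rewrite -mulrA mulr_suml; congr (_ * _).
  by apply: eq_bigr => l _; rewrite mulrA.
by rewrite s0 mul0r.
Qed.

Definition rest_state (z : 'cV[R]_n) (xe : 'I_N -> 'cV[R]_n) (le me : 'I_N -> R) :
    state R N n m :=
  {| rho := fun _ k => rest z k; xi := xe; lam := le; mu := me;
     rsig := fun i l => col_mx z (2^-1 *: (xe i + xe l)) |}.

Hypothesis m_gt0 : (0 < m)%N.
Hypothesis b_first : forall i (k : 'I_m), k = 0%N :> nat -> decay P i k = 0.

Lemma rest_output z xe le me : output (rest_state z xe le me) = fun=> z.
Proof.
apply/funext => i; rewrite /output (bigD1 (Ordinal m_gt0))//= big1 ?addr0.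
  by rewrite /rest eqxx.
by move=> k; rewrite -val_eqE/= /rest => /negbTE ->.
Qed.

Lemma rest_equilibrium z xe le me : stationary P z xe le me ->
  equilibrium P (rest_state z xe le me).
Proof.
move=> [_ comp hz stat]; have [e_sym _ _ aP _] := graphP.
have rx0 i : rx_gap P (rest_state z xe le me) i = 0.
  apply/colP => j; rewrite rx_gap_coord rest_output mxE big1// => l _.
  by rewrite col_mxKu subrr mulr0.
have nu0 i : nu P (rest_state z xe le me) i = 0.
  apply/colP => j; have zero : (0 : 'cV[R]_n) j 0 = 0 by rewrite mxE.
  rewrite nu_coord rx0 rxi_gap_coord rest_output zero /=.
  have -> : \sum_(l | edge P i l) adj P i l *
      (dsubmx (col_mx z (2^-1 *: (xe i + xe l))) j 0 - xe i j 0) =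
      \sum_(l | edge P i l) adj P i l * ((xe l j 0 - xe i j 0) / 2).
    by apply: eq_bigr => l _; rewrite col_mxKd !mxE; field.
  by have := stat i j; lra.
split=> [i|i l el].
  split=> [k|||].
  - rewrite /rho_field nu0 scaler0 addr0 /= /rest.
    by case: eqP => [/b_first ->|_]; rewrite ?scale0r ?scaler0 oppr0.
  - exact: rx0.
  - by rewrite /lam_field rest_output /= -mulrA comp mulr0.
  - by rewrite /mu_field rest_output hz.
have [ail _] := aP i l el.
rewrite -[LHS]vsubmxK -[RHS]vsubmxK; congr col_mx; apply/colP => j.
  rewrite scat_in_up scat_out_up rest_output /= !col_mxKu !col_mxKd !mxE -ail.
  by congr (_ * _); rewrite /incx /outx; field.
rewrite scat_in_down scat_out_down rest_output /= !col_mxKu !col_mxKd !mxE -ail.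
by congr (_ * _); rewrite /incv /outv; field.
Qed.

End Assembly.

Theorem theorem2 (R : realType) (N n m : nat) (P : system R N n m)
  (f_convex : forall i, convex_function setT (obj P i))
  (f_diff : forall i, twice_differentiable (obj P i))
  (g_convex : forall i, convex_function setT (ineq P i))
  (g_diff : forall i, twice_differentiable (ineq P i))
  (h_affine : forall i, affine (equa P i))
  (slaterP : slater P)
  (solvable : exists z, optimal (central_cost P) (central_feasible P) z)
  (graphP : undirected_connected_graph P)
  (m_ge2 : (2 <= m)%N)
  (b_first : forall i (k : 'I_m), k = 0%N :> nat -> decay P i k = 0)
  (b_incr : forall i (k l : 'I_m), (k < l)%N -> decay P i k < decay P i l)
  (c_gt0 : forall i k, 0 < gain P i k)
  (eta_gt0 : 0 < eta P)
  (delay_ge0 : forall i j, edge P i j -> 0 <= delay P i j) :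
  forall S : R -> state R N n m,
    trajectory P S -> (forall i, 0 < lam (S 0) i) ->
    exists e : state R N n m,
      [/\ equilibrium P e,
          converges_to P S e &
          optimal (consensus_cost P) (consensus_feasible P)
                  (stack (output e))].
Proof.
move=> S trajS lam0.
have m_gt0 : (0 < m)%N by exact: ltnW.
have b_pos i (k : 'I_m) : k <> 0%N :> nat -> 0 < decay P i k.
  move=> k0; rewrite -(b_first i (Ordinal m_gt0) erefl); apply: b_incr.
  by rewrite /= lt0n; apply/eqP.
have [e_sym e_conn _ aP _] := graphP.
have [zs zsP] := slaterP; have [z0 [z0_feas z0_opt]] := solvable.
have df0 i : differentiable (obj P i) z0 by have [] := f_diff i.
have dg0 i : differentiable (ineq P i) z0 by have [] := g_diff i.
have [xi0 [Lam [mu0 [Lam_ge0 comp0 stat0]]]] := kkt_multipliers e_sym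
  (fun i l el => (aP i l el).1) (fun i l el => (aP i l el).2) e_conn
  df0 dg0 g_convex h_affine zsP z0_feas z0_opt.
(* The loop uses [lam ^+ 2] as the multiplier of [g], hence the square root. *)
have center0 : stationary P z0 xi0 (fun i => Num.sqrt (Lam i)) mu0.
  split=> [i|i|i|i j].
  - exact: sqrtr_ge0.
  - have /eqP := comp0 i; rewrite mulf_eq0 => /orP[/eqP ->|/eqP ->].
      by rewrite sqrtr0 mul0r.
    by rewrite mulr0.
  - exact: (z0_feas i).2.
  - by rewrite sqr_sqrtr.
have [F0 F0P] := storage_exists trajS graphP eta_gt0 delay_ge0 z0 xi0.
have settleP := settles trajS f_convex f_diff g_convex g_diff h_affine graphP
  m_ge2 b_first b_pos c_gt0 eta_gt0 delay_ge0 lam0 center0 (fun i => (z0_feas i).1) F0P.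
have [T [z [xe [le [me [Toy centerP x_lim xi_lim lm_lim]]]]]] :=
  cluster_point trajS f_diff g_diff h_affine graphP lam0 settleP.
(* The flux is measured from the steady signals of the centre, so the new centre needs its own
   storage. *)
have [F FP] := storage_exists trajS graphP eta_gt0 delay_ge0 z xe.
have lims := state_limits trajS f_convex f_diff g_convex g_diff h_affine graphP
  m_ge2 b_first b_pos c_gt0 eta_gt0 delay_ge0 lam0 settleP Toy centerP x_lim xi_lim lm_lim FP.
have feas := limit_feasible trajS f_convex f_diff g_convex g_diff h_affine graphP
  m_ge2 b_first b_pos c_gt0 eta_gt0 delay_ge0 lam0 settleP Toy centerP x_lim xi_lim lm_lim FP.
exists (rest_state m z xe le me); split.
- exact: rest_equilibrium.
- have out_lim i j : output (S t) i j 0 @[t --> +oo] --> z j 0.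
    have -> : z j 0 = \sum_(k < m) rest z k j 0.
      by have := output_coord (rest_state m z xe le me) i j; rewrite rest_output.
    have -> : (fun t => output (S t) i j 0) = (fun t => \sum_k rho (S t) i k j 0).
      by apply/funext => t; rewrite output_coord.
    by apply: cvg_rsum => k _; have [h _ _ _] := lims i; exact: h.
  split=> [i|i l el].
    have [h1 h2 h3 h4] := lims i; split=> //.
      by move=> k; apply: cvg_mx_coord => j j'; rewrite ord1; exact: h1.
    by apply: cvg_mx_coord => j j'; rewrite ord1; exact: h2.
  apply: cvg_mx_coord => p q; rewrite ord1 {q}.
  have [j ->|j ->] := split_ordP p.
    have [hx _] := settling_signal settleP j el.
    rewrite /= col_mxEu.
    have -> : (fun t => rsig (S t) i l (lshift n j) 0) = (fun t =>
        (usubmx (rsig (S t) i l) j 0 - (output (S t) i j 0 + output (S t) l j 0) / 2)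
        + (output (S t) i j 0 + output (S t) l j 0) / 2).
      by apply/funext => t; rewrite subrK mxE.
    have -> : z j 0 = 0 + (z j 0 + z j 0) / 2 by field.
    apply: cvgD => //; apply: cvgM; last exact: cvg_cst.
    by apply: cvgD; exact: out_lim.
  have [_ hv] := settling_signal settleP j el.
  rewrite /= col_mxEd.
  have -> : (fun t => rsig (S t) i l (rshift n j) 0) = (fun t =>
      (dsubmx (rsig (S t) i l) j 0 - (xi (S t) i j 0 + xi (S t) l j 0) / 2)
      + (xi (S t) i j 0 + xi (S t) l j 0) / 2).
    by apply/funext => t; rewrite subrK mxE.
  have -> : (2^-1 *: (xe i + xe l)) j 0 = 0 + (xe i j 0 + xe l j 0) / 2.
    by rewrite !mxE add0r mulrC.
  apply: cvgD => //; apply: cvgM; last exact: cvg_cst.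
  have [_ hi _ _] := lims i; have [_ hl _ _] := lims l.
  by apply: cvgD; [exact: hi|exact: hl].
- rewrite rest_output//; exact: stationary_optimal centerP feas.
Qed.
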